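(* Suppose the simply connected Riemannian 3-manifold $M$ has a coordinate chart $(r,\psi,\theta)$ with Riemannian metric given by the doubly-warped product $$ds^2=dr^2+\alpha(r)^2\,d\psi^2+\beta(r)^2\,d\theta^2.$$ Then $K=\partial_\theta$ is a Killing field. Suppose that either (rotational case) $\theta\in S^1$, $\beta$ extends to a $C^\infty$ odd function through $r=0$ with $\beta'(0)=1$ and $\alpha$ extends to a $C^\infty$ even function through $r=0$ with $\alpha(0)=1$; or $\theta\in\mathbb{R}$ with $\alpha$ nowhere zero. Suppose also that $M$ is oriented so that $dV=\alpha(r)\beta(r)\,dr\wedge d\psi\wedge d\theta$ is the volume form. Then functions $f$ on $M$ satisfying $K(f)=0$ are given by functions of $r$ and $\psi$, arbitrary except for the condition that $f$ extends to an even function through $r=0$ in the rotational case. The Poisson bracket and $K$-Laplacian are given by $$\{f,g\}=\frac{1}{\alpha(r)\beta(r)}\Big(\frac{\partial f}{\partial r}\frac{\partial g}{\partial\psi}-\frac{\partial f}{\partial\psi}\frac{\partial g}{\partial r}\Big),$$ $$\Delta_Kf=\frac{1}{\alpha(r)\beta(r)}\frac{\partial}{\partial r}\Big(\frac{\alpha(r)}{\beta(r)}\frac{\partial f}{\partial r}\Big)+\frac{1}{\alpha(r)^2\beta(r)^2}\frac{\partial^2f}{\partial\psi^2},$$ while the axisymmetric Euler equation is given by $$\partial_t\Delta_Kf+\{f,\Delta_Kf\}+\frac{\beta'(r)}{\alpha(r)\beta(r)^4}\frac{\partial}{\partial\psi}(\sigma^2)=0,\qquad\partial_t\sigma+\{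f,\sigma\}=0.$$
   Context: For functions $f,g$ with $K(f)=K(g)=0$ (away from zeros of $K$): $$\nabla^\perp f=\frac{K\times\nabla f}{|K|^2},\qquad\{f,g\}=\langle\nabla^\perp f,\nabla g\rangle=\frac{\langle K,\nabla f\times\nabla g\rangle}{|K|^2},\qquad\Delta_Kf=\operatorname{div}\big(\nabla f/|K|^2\big).$$ An axisymmetric vector field is a divergence-free $u$ with $[K,u]=0$; it is written $u=\nabla^\perp f+\frac{\sigma K}{|K|^2}$ with $K(f)=K(\sigma)=0$, where $f$ is the stream function and $\sigma=\langle u,K\rangle$ the swirl. The axisymmetric Euler equation is the incompressible Euler equation $\partial_tu+\nabla_uu=-\nabla p$, $\operatorname{div}u=0$ for such $u$, expressed in terms of $f$ and $\sigma$.
   Formalization: For θ∈ℝ the Euler pressure is required to satisfy K(p)=0 (u=t∂_θ, p=−θ in flat space violates the swirl equation otherwise), and M is taken to be exactly the chart region, plus the axis r=0 in the rotational case, as the ''arbitrary functions of r,ψ'' clause needs. *)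

(* Defs.v *)
From Stdlib Require Import Reals.
From Coquelicot Require Import Coquelicot.
Open Scope R_scope.

Definition dderiv {E : NormedModule R_AbsRing} (v : E) (f : E -> R) (x : E) : R :=
  Derive (fun s : R => f (plus x (scal s v))) 0.

(* Used below only for E = R, R^2, R^3 and R x R^3 (space-time), where this is
   the classical class C^k: all iterated directional derivatives of order at
   most k exist and are continuous on the open set U. *)
Fixpoint Ck_on {E : NormedModule R_AbsRing} (k : nat) (U : E -> Prop) (f : E -> R) : Prop :=
  match k with
  | O => forall x, U x -> continuous f x
  | S k' =>
      (forall x, U x -> continuous f x) /\
      forall v : E,
        (forall x, U x -> ex_derive (fun s : R => f (plus x (scal s v))) 0) /\
        Ck_on k' U (dderiv v f)
  end.

Definition smooth_on {E : NormedModule R_AbsRing} (U : E -> Prop) (f : E -> R) : Prop :=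
  forall k, Ck_on k U f.

Definition pt : Type := (R * R * R)%type.

Inductive ix : Set := I1 | I2 | I3.

Definition sum3 (F : ix -> R) : R := F I1 + F I2 + F I3.

Definition coord (i : ix) (x : pt) : R :=
  let '(a, b, c) := x in match i with I1 => a | I2 => b | I3 => c end.

Definition basis (i : ix) : pt :=
  match i with I1 => (1, 0, 0) | I2 => (0, 1, 0) | I3 => (0, 0, 1) end.

Definition partial (i : ix) (f : pt -> R) (x : pt) : R := dderiv (basis i) f x.

(* Vector fields by their components X^i, metrics by their components g_ij. *)
Definition vfield : Type := pt -> ix -> R.
Definition tensor2 : Type := pt -> ix -> ix -> R.

Definition smooth_vfield_on (U : pt -> Prop) (X : vfield) : Prop :=
  forall i, smooth_on U (fun x => X x i).

Definition next (i : ix) : ix := match i with I1 => I2 | I2 => I3 | I3 => I1 end.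

Definition eps (i j k : ix) : R :=
  match i, j, k with
  | I1, I2, I3 | I2, I3, I1 | I3, I1, I2 => 1
  | I1, I3, I2 | I3, I2, I1 | I2, I1, I3 => -1
  | _, _, _ => 0
  end.

(* Indices are taken cyclically, so no sign is needed. *)
Definition cofactor (A : ix -> ix -> R) (i j : ix) : R :=
  A (next i) (next j) * A (next (next i)) (next (next j))
  - A (next i) (next (next j)) * A (next (next i)) (next j).

Definition det3 (A : ix -> ix -> R) : R := sum3 (fun j => A I1 j * cofactor A I1 j).

Definition inv3 (A : ix -> ix -> R) (i j : ix) : R := cofactor A j i / det3 A.

Definition riemannian_metric_on (U : pt -> Prop) (g : tensor2) : Prop :=
  (forall i j, smooth_on U (fun x => g x i j)) /\
  (forall x, U x -> forall i j, g x i j = g x j i) /\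
  (forall x, U x -> forall v : ix -> R, (exists i, v i <> 0) ->
     0 < sum3 (fun i => sum3 (fun j => g x i j * v i * v j))).

(* mu stands for the 3-form mu dx^1 /\ dx^2 /\ dx^3; the choice of sign of mu
   is the choice of orientation. *)
Definition volume_form_on (U : pt -> Prop) (g : tensor2) (mu : pt -> R) : Prop :=
  smooth_on U mu /\ forall x, U x -> mu x ^ 2 = det3 (g x).

Definition inner (g : tensor2) (X Y : vfield) (x : pt) : R :=
  sum3 (fun i => sum3 (fun j => g x i j * X x i * Y x j)).

Definition deriv_along (X : vfield) (f : pt -> R) (x : pt) : R :=
  sum3 (fun i => X x i * partial i f x).

Definition grad (g : tensor2) (f : pt -> R) : vfield :=
  fun x i => sum3 (fun j => inv3 (g x) i j * partial j f x).

(* Characterised by <X * Y, Z> = dV(X, Y, Z). *)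
Definition cross (g : tensor2) (mu : pt -> R) (X Y : vfield) : vfield :=
  fun x k => sum3 (fun l => inv3 (g x) k l *
    sum3 (fun i => sum3 (fun j => mu x * eps l i j * X x i * Y x j))).

Definition divergence (mu : pt -> R) (X : vfield) (x : pt) : R :=
  / mu x * sum3 (fun i => partial i (fun y => mu y * X y i) x).

Definition lie_bracket (X Y : vfield) : vfield :=
  fun x i => deriv_along X (fun y => Y y i) x - deriv_along Y (fun y => X y i) x.

Definition christoffel (g : tensor2) (x : pt) (k i j : ix) : R :=
  / 2 * sum3 (fun l => inv3 (g x) k l *
    (partial i (fun y => g y j l) x + partial j (fun y => g y i l) x
     - partial l (fun y => g y i j) x)).

(* nabla_X Y for the Levi-Civita connection. *)
Definition covariant (g : tensor2) (X Y : vfield) : vfield :=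
  fun x k => deriv_along X (fun y => Y y k) x
    + sum3 (fun i => sum3 (fun j => christoffel g x k i j * X x i * Y x j)).

Definition lie_derivative_metric (K : vfield) (g : tensor2) : tensor2 :=
  fun x i j => deriv_along K (fun y => g y i j) x
    + sum3 (fun k => g x k j * partial i (fun y => K y k) x
                     + g x i k * partial j (fun y => K y k) x).

Definition killing_on (U : pt -> Prop) (g : tensor2) (K : vfield) : Prop :=
  smooth_vfield_on U K /\
  forall x, U x -> forall i j, lie_derivative_metric K g x i j = 0.

Definition jacobian (Phi : pt -> pt) (q : pt) (i a : ix) : R :=
  partial a (fun p => coord i (Phi p)) q.

Definition pullback_metric (Phi : pt -> pt) (g : tensor2) : tensor2 :=
  fun q a b => sum3 (fun i => sum3 (fun j =>
    g (Phi q) i j * jacobian Phi q i a * jacobian Phi q j b)).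

Definition pullback_volume (Phi : pt -> pt) (mu : pt -> R) (q : pt) : R :=
  mu (Phi q) * det3 (jacobian Phi q).

Definition nonzero_set (U : pt -> Prop) (g : tensor2) (K : vfield) (x : pt) : Prop :=
  U x /\ inner g K K x <> 0.

(* The operators dividing by |K|^2 are meaningful only where |K| is nonzero. *)
Definition grad_perp (g : tensor2) (mu : pt -> R) (K : vfield) (f : pt -> R) : vfield :=
  fun x i => cross g mu K (grad g f) x i / inner g K K x.

Definition poisson (g : tensor2) (mu : pt -> R) (K : vfield) (f h : pt -> R) (x : pt) : R :=
  inner g (grad_perp g mu K f) (grad g h) x.

Definition laplacianK (g : tensor2) (mu : pt -> R) (K : vfield) (f : pt -> R) (x : pt) : R :=
  divergence mu (fun y i => grad g f y i / inner g K K y) x.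

Definition stream_swirl_field (g : tensor2) (mu : pt -> R) (K : vfield)
    (f sigma : pt -> R) : vfield :=
  fun x i => grad_perp g mu K f x i + sigma x * K x i / inner g K K x.

Definition invariant_on (U : pt -> Prop) (K : vfield) (f : pt -> R) : Prop :=
  forall x, U x -> deriv_along K f x = 0.

Definition axisymmetric_on (U : pt -> Prop) (mu : pt -> R) (K X : vfield) : Prop :=
  forall x, U x -> divergence mu X x = 0 /\ forall i, lie_bracket K X x i = 0.

Definition spacetime_smooth (T : R -> Prop) (U : pt -> Prop) (f : R -> pt -> R) : Prop :=
  smooth_on (fun z : R * pt => T (fst z) /\ U (snd z)) (fun z => f (fst z) (snd z)).

Definition euler_on (T : R -> Prop) (U : pt -> Prop) (g : tensor2) (mu : pt -> R)
    (u : R -> vfield) (p : R -> pt -> R) : Prop :=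
  forall t x, T t -> U x ->
    (forall i, Derive (fun s => u s x i) t + covariant g (u t) (u t) x i
               = - grad g (p t) x i) /\
    divergence mu (u t) x = 0.

(* Paths and homotopies are taken to be continuous on all of R and R^2, and
   only their restrictions to [0,1] and [0,1]^2 matter: a continuous map on the
   interval or the square always extends, by clamping the arguments. *)
Definition unit_interval (s : R) : Prop := 0 <= s <= 1.

Definition path_in {E : UniformSpace} (U : E -> Prop) (gamma : R -> E) : Prop :=
  (forall s, continuous gamma s) /\ forall s, unit_interval s -> U (gamma s).

Definition simply_connected {E : UniformSpace} (U : E -> Prop) : Prop :=
  (forall x y, U x -> U y ->
     exists gamma : R -> E, path_in U gamma /\ gamma 0 = x /\ gamma 1 = y) /\
  (forall gamma : R -> E, path_in U gamma -> gamma 0 = gamma 1 ->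
     exists H : R * R -> E,
       (forall z, continuous H z) /\
       (forall a s, unit_interval a -> unit_interval s -> U (H (a, s))) /\
       (forall s, unit_interval s -> H (0, s) = gamma s /\ H (1, s) = gamma 0) /\
       (forall a, unit_interval a -> H (a, 0) = gamma 0 /\ H (a, 1) = gamma 0)).

Inductive symmetry : Set := Rotational | Translational.

(* M is covered by the chart, together with the axis r = 0 in the rotational
   case, where smoothness at the axis refers to the coordinates
   (r cos theta, psi, r sin theta). *)
Definition chart (c : symmetry) (q : pt) : pt :=
  let '(r, psi, theta) := q in
  match c with
  | Rotational => (r * cos theta, psi, r * sin theta)
  | Translational => (r, psi, theta)
  end.

(* Omega is the range of (r, psi), symmetric under r -> -r in the rotational
   case, so that "extending through r = 0" means being defined on Omega. *)
Definition range_ok (c : symmetry) (Omega : R * R -> Prop) : Prop :=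
  open Omega /\
  (c = Rotational -> forall r psi, Omega (r, psi) -> Omega (- r, psi)).

Definition manifold (c : symmetry) (Omega : R * R -> Prop) (x : pt) : Prop :=
  let '(x1, x2, x3) := x in
  match c with
  | Rotational => Omega (sqrt (x1 ^ 2 + x3 ^ 2), x2)
  | Translational => Omega (x1, x2)
  end.

(* In the rotational case theta runs over R, covering the circle. *)
Definition chart_domain (c : symmetry) (Omega : R * R -> Prop) (q : pt) : Prop :=
  let '(r, psi, theta) := q in
  Omega (r, psi) /\ (c = Rotational -> 0 < r).

(* The same with the axis r = 0 added in the rotational case; its image is M. *)
Definition closed_chart_domain (c : symmetry) (Omega : R * R -> Prop) (q : pt) : Prop :=
  let '(r, psi, theta) := q in
  Omega (r, psi) /\ (c = Rotational -> 0 <= r).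

Definition r_range (Omega : R * R -> Prop) (r : R) : Prop := exists psi, Omega (r, psi).

Definition warped_metric (alpha beta : R -> R) : tensor2 :=
  fun q a b =>
    match a, b with
    | I1, I1 => 1
    | I2, I2 => alpha (coord I1 q) ^ 2
    | I3, I3 => beta (coord I1 q) ^ 2
    | _, _ => 0
    end.

Definition warping_ok (c : symmetry) (Omega : R * R -> Prop) (alpha beta : R -> R) : Prop :=
  smooth_on (r_range Omega) alpha /\ smooth_on (r_range Omega) beta /\
  match c with
  | Rotational =>
      (forall r, r_range Omega r -> beta (- r) = - beta r) /\ Derive beta 0 = 1 /\
      (forall r, r_range Omega r -> alpha (- r) = alpha r) /\ alpha 0 = 1
  | Translational => forall r, r_range Omega r -> alpha r <> 0
  end.

Definition profile (c : symmetry) (Omega : R * R -> Prop) (F : R * R -> R) : Prop :=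
  smooth_on Omega F /\
  (c = Rotational -> forall r psi, Omega (r, psi) -> F (- r, psi) = F (r, psi)).

Definition given_by_profile (c : symmetry) (Omega : R * R -> Prop)
    (f : pt -> R) (F : R * R -> R) : Prop :=
  forall r psi theta, closed_chart_domain c Omega (r, psi, theta) ->
    f (chart c (r, psi, theta)) = F (r, psi).

Definition in_chart (c : symmetry) (f : pt -> R) : pt -> R := fun q => f (chart c q).

(* Main.v *)
Require Import Defs.
From Stdlib Require Import Reals Lra Lia Arith Factorial Classical ClassicalEpsilon FunctionalExtensionality.
From Coquelicot Require Import Coquelicot.
Open Scope R_scope.

(** The metric equation in the chart says that [chart c] is an isometry, so the inner product,
    gradient, cross product and divergence at [chart c q] are those of the diagonal metric
    [warped_metric]; this gives the formulas for the bracket and the Laplacian.  Smoothness of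
    [F (|x|, psi)] for [F] even in [r] follows by differentiating: the radial derivative is
    [x . G (|x|, psi)] with [G = F_r / r] again smooth and even.

    For the Euler equation write [om] for the one-form dual to [- (d_t u + nabla_u u)].  Since
    [(nabla_u u)^flat = i_u d(u^flat) + d|u|^2 / 2], Euler's equation with some pressure says that
    [om] is exact.  In the chart [u^flat = - f_psi / (alpha beta) dr + alpha f_r / beta dpsi + sigma dtheta],
    so the [dr dpsi] component of [d om] is [- alpha beta] times the left side of the vorticity equation
    and the [dtheta] component of [om] is minus the left side of the swirl equation.  The latter is
    independent of [theta], hence vanishes when [om] is exact, by periodicity (rotational case) or
    invariance of the pressure (translational case).  Conversely the two equations make [om] closed off
    the axis, hence everywhere by continuity, and a closed form on a simply connected set is exact; its
    primitives, normalised at a point, are smooth in time because differentiation in time commutes with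
    taking the primitive. *)
(** * Calculus of [Ck_on] and [smooth_on] *)

(** [Ck_on] speaks only of derivatives along single lines. Linearity in the direction, the chain
    rule and the symmetry of second derivatives all have to be recovered from it before any tensor
    calculation. The paths and homotopies of [simply_connected] are merely continuous, so a one-form
    cannot be pulled back along them; primitives are built instead from potentials on small cubes
    and from increments along continuous paths. The chart degenerates on the axis, where $|K|$
    vanishes too: component formulas live on [chart_domain], where the jacobian is invertible, and
    statements on the axis follow by density. Tensors are given in Cartesian components, so each
    operator is carried to the chart by contraction with the jacobian or its adjugate. In the
    translational case the theta lines are not closed: with $f = 0$ and $\sigma = t$ the field
    solves Euler's equation with a pressure affine in theta although $\partial_t\sigma \neq 0$.
    Hence the invariance of the pressure on that side of the equivalence. *)

Notation plane_module := (prod_NormedModule R_AbsRing R_NormedModule R_NormedModule).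
Notation pt_module := (prod_NormedModule R_AbsRing plane_module R_NormedModule).

Section Calculus.
Context {E : NormedModule R_AbsRing}.
Implicit Types (f h : E -> R) (U : E -> Prop) (x v w : E).

Lemma line_zero x v : plus x (scal 0 v) = x.
Proof. change (plus x (scal zero v) = x). now rewrite scal_zero_l, plus_zero_r. Qed.

Lemma line_continuous x v (s : R) : continuous (fun s : R => plus x (scal s v)) s.
Proof.
apply (continuous_plus (fun _ => x) (fun s : R => scal s v)).
- apply continuous_const.
- apply (continuous_scal_l (fun s : R => s) v), continuous_id.
Qed.

Lemma line_locally (P : E -> Prop) x v (s : R) :
  locally (plus x (scal s v)) P -> locally s (fun s : R => P (plus x (scal s v))).
Proof. intros H. exact (line_continuous x v s P H). Qed.

Lemma line_locally_0 (P : E -> Prop) x v :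
  locally x P -> locally 0 (fun s : R => P (plus x (scal s v))).
Proof. intros H. apply line_locally. now rewrite line_zero. Qed.

Lemma dderiv_ext U f h v x :
  open U -> U x -> (forall y, U y -> f y = h y) -> dderiv v f x = dderiv v h x.
Proof.
intros oU Ux H. apply Derive_ext_loc.
apply (line_locally_0 (fun y => f y = h y)).
exact (filter_imp U _ H (oU x Ux)).
Qed.

Lemma dderiv_unique f v x (l : R) :
  is_derive (fun s : R => f (plus x (scal s v))) 0 l -> dderiv v f x = l.
Proof. apply is_derive_unique. Qed.

Lemma dderiv_const (a : R) v x : dderiv v (fun _ : E => a) x = 0.
Proof. unfold dderiv. apply Derive_const. Qed.

(** Agreement on an open set suffices, because all derivatives at a point look only at nearby
    points. Formulas such as the product rule, valid only on [U], enter the later inductions through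
    this lemma. *)
Lemma Ck_ext k U f h :
  open U -> (forall x, U x -> f x = h x) -> Ck_on k U f -> Ck_on k U h.
Proof.
intros oU; revert f h; induction k as [|k IH]; intros f h e H.
- intros x Ux. apply (continuous_ext_loc h f); [|now apply H].
  exact (filter_imp U _ e (oU x Ux)).
- destruct H as [Hc Hd]; split.
  + intros x Ux. apply (continuous_ext_loc h f); [|now apply Hc].
    exact (filter_imp U _ e (oU x Ux)).
  + intros v; destruct (Hd v) as [He Hk]; split.
    * intros x Ux. apply (ex_derive_ext_loc (fun s : R => f (plus x (scal s v)))); [|now apply He].
      apply (line_locally_0 (fun y => f y = h y)).
      exact (filter_imp U _ e (oU x Ux)).
    * apply (IH (dderiv v f)); [|easy].
      intros x Ux. now apply (dderiv_ext U).
Qed.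

Lemma Ck_subset k (U V : E -> Prop) f :
  (forall x, V x -> U x) -> Ck_on k U f -> Ck_on k V f.
Proof.
intros i; revert f; induction k as [|k IH]; intros f H.
- intros x Vx. apply H; auto.
- destruct H as [Hc Hd]; split; [auto|].
  intros v; destruct (Hd v) as [He Hk]; split; auto.
Qed.

Lemma Ck_S k U f : Ck_on (S k) U f -> Ck_on k U f.
Proof.
revert f; induction k as [|k IH]; intros f [Hc Hd]; [exact Hc|].
split; [exact Hc|]. intros v; destruct (Hd v) as [He Hk]; auto.
Qed.

Lemma Ck_const k U (a : R) : Ck_on k U (fun _ : E => a).
Proof.
revert a; induction k as [|k IH]; intros a.
- intros x _. apply continuous_const.
- split; [intros x _; apply continuous_const|].
  intros v; split; [intros x _; apply ex_derive_const|].
  replace (dderiv v (fun _ : E => a)) with (fun _ : E => 0); [apply IH|].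
  apply functional_extensionality; intros x; now rewrite dderiv_const.
Qed.

Lemma dderiv_plus f h v x :
  ex_derive (fun s : R => f (plus x (scal s v))) 0 ->
  ex_derive (fun s : R => h (plus x (scal s v))) 0 ->
  dderiv v (fun y => f y + h y) x = dderiv v f x + dderiv v h x.
Proof. apply (Derive_plus (fun s : R => f (plus x (scal s v)))). Qed.

Lemma dderiv_mult f h v x :
  ex_derive (fun s : R => f (plus x (scal s v))) 0 ->
  ex_derive (fun s : R => h (plus x (scal s v))) 0 ->
  dderiv v (fun y => f y * h y) x = dderiv v f x * h x + f x * dderiv v h x.
Proof.
intros H1 H2. unfold dderiv.
rewrite (Derive_mult (fun s : R => f (plus x (scal s v))) (fun s : R => h (plus x (scal s v))) 0 H1 H2).
now rewrite !line_zero.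
Qed.

Lemma dderiv_inv h v x :
  ex_derive (fun s : R => h (plus x (scal s v))) 0 -> h x <> 0 ->
  dderiv v (fun y => / h y) x = - (dderiv v h x * (/ h x * / h x)).
Proof.
intros H1 H2. unfold dderiv.
rewrite (Derive_inv (fun s : R => h (plus x (scal s v))) 0 H1); rewrite line_zero; [|exact H2].
now field.
Qed.

Lemma Ck_plus k U f h :
  open U -> Ck_on k U f -> Ck_on k U h -> Ck_on k U (fun x => f x + h x).
Proof.
intros oU; revert f h; induction k as [|k IH]; intros f h Hf Hh.
- intros x Ux. apply (continuous_plus f h); auto.
- destruct Hf as [cf df], Hh as [ch dh]; split.
  + intros x Ux. apply (continuous_plus f h); auto.
  + intros v; destruct (df v) as [ef kf], (dh v) as [eh kh]; split.
    * intros x Ux. apply (ex_derive_plus (fun s : R => f (plus x (scal s v)))); auto.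
    * apply (Ck_ext k U (fun x => dderiv v f x + dderiv v h x)); auto.
      intros x Ux. symmetry; apply dderiv_plus; auto.
Qed.

Lemma Ck_mult k U f h :
  open U -> Ck_on k U f -> Ck_on k U h -> Ck_on k U (fun x => f x * h x).
Proof.
intros oU; revert f h; induction k as [|k IH]; intros f h Hf Hh.
- intros x Ux. apply (continuous_mult f h); auto.
(* The Leibniz rule brings back the undifferentiated factors, which are needed at level [k] only. *)
- pose proof (Ck_S _ _ _ Hf) as Sf. pose proof (Ck_S _ _ _ Hh) as Sh.
  destruct Hf as [cf df], Hh as [ch dh]; split.
  + intros x Ux. apply (continuous_mult f h); auto.
  + intros v; destruct (df v) as [ef kf], (dh v) as [eh kh]; split.
    * intros x Ux. apply (ex_derive_mult (fun s : R => f (plus x (scal s v)))); auto.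
    * apply (Ck_ext k U (fun x => dderiv v f x * h x + f x * dderiv v h x)); auto.
      -- intros x Ux. symmetry; apply dderiv_mult; auto.
      -- apply Ck_plus; auto.
Qed.

Lemma Ck_opp k U f : open U -> Ck_on k U f -> Ck_on k U (fun x => - f x).
Proof.
intros oU H. apply (Ck_ext k U (fun x => (-1) * f x)); [easy|intros; ring|].
apply Ck_mult; auto using Ck_const.
Qed.

Lemma continuous_inv h x : continuous h x -> h x <> 0 -> continuous (fun y => / h y) x.
Proof.
intros ch nz. apply (continuous_comp h Rinv); [exact ch|].
apply continuous_Rinv_comp; [apply continuous_id|exact nz].
Qed.

Lemma Ck_inv k U h :
  open U -> (forall x, U x -> h x <> 0) -> Ck_on k U h -> Ck_on k U (fun x => / h x).
Proof.
intros oU nz; induction k as [|k IH]; intros Hh.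
- intros x Ux. apply continuous_inv; auto.
- pose proof (IH (Ck_S _ _ _ Hh)) as Si.
  destruct Hh as [ch dh]; split.
  + intros x Ux. apply continuous_inv; auto.
  + intros v; destruct (dh v) as [eh kh]; split.
    * intros x Ux. apply (ex_derive_inv (fun s : R => h (plus x (scal s v)))); auto.
      rewrite line_zero; auto.
    * apply (Ck_ext k U (fun x => - (dderiv v h x * (/ h x * / h x)))); auto.
      -- intros x Ux. symmetry; apply dderiv_inv; auto.
      -- apply Ck_opp; auto. repeat apply Ck_mult; auto.
Qed.

(** [Ck_on] differentiates at parameter 0 only; moving the base point along the line gives the
    derivative at every parameter. *)
Lemma is_derive_line k U f x v (s : R) :
  Ck_on (S k) U f -> U (plus x (scal s v)) ->
  is_derive (fun s : R => f (plus x (scal s v))) s (dderiv v f (plus x (scal s v))).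
Proof.
intros [_ H] Us. destruct (H v) as [He _]. specialize (He _ Us).
apply Derive_correct in He.
apply (is_derive_ext (fun s' : R => f (plus (plus x (scal s v)) (scal (s' - s) v)))).
- intros t. f_equal. rewrite <- plus_assoc. f_equal.
  etransitivity; [symmetry; apply (scal_distr_r s (t - s) v)|]. f_equal. unfold plus; simpl; ring.
- evar_last.
  + apply (is_derive_comp (fun r : R => f (plus (plus x (scal s v)) (scal r v))) (fun s' => s' - s)).
    * rewrite Rminus_diag. exact He.
    * auto_derive; [easy|reflexivity].
  + apply (scal_one (dderiv v f (plus x (scal s v)))) .
Qed.

Lemma smooth_ex U f v x : smooth_on U f -> U x -> ex_derive (fun s : R => f (plus x (scal s v))) 0.
Proof. intros H Ux. destruct (H 1%nat) as [_ Hd]. now apply (Hd v). Qed.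

Lemma smooth_dderiv U f v : smooth_on U f -> smooth_on U (dderiv v f).
Proof. intros H k. destruct (H (S k)) as [_ Hd]. now apply (Hd v). Qed.

Lemma smooth_continuous U f x : smooth_on U f -> U x -> continuous f x.
Proof. intros H. exact (H 0%nat x). Qed.

Lemma smooth_ext U f h : open U -> (forall x, U x -> f x = h x) -> smooth_on U f -> smooth_on U h.
Proof. intros oU e H k. now apply (Ck_ext k U f). Qed.

Lemma smooth_subset (U V : E -> Prop) f : (forall x, V x -> U x) -> smooth_on U f -> smooth_on V f.
Proof. intros i H k. now apply (Ck_subset k U). Qed.

Lemma smooth_const U (a : R) : smooth_on U (fun _ : E => a).
Proof. intros k. apply Ck_const. Qed.

Lemma smooth_plus U f h : open U -> smooth_on U f -> smooth_on U h -> smooth_on U (fun x => f x + h x).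
Proof. intros oU Hf Hh k. now apply Ck_plus. Qed.

Lemma smooth_mult U f h : open U -> smooth_on U f -> smooth_on U h -> smooth_on U (fun x => f x * h x).
Proof. intros oU Hf Hh k. now apply Ck_mult. Qed.

Lemma smooth_opp U f : open U -> smooth_on U f -> smooth_on U (fun x => - f x).
Proof. intros oU Hf k. now apply Ck_opp. Qed.

Lemma smooth_minus U f h : open U -> smooth_on U f -> smooth_on U h -> smooth_on U (fun x => f x - h x).
Proof. intros oU Hf Hh k. apply Ck_plus; [easy|apply Hf|]. now apply Ck_opp. Qed.

Lemma smooth_inv U h :
  open U -> (forall x, U x -> h x <> 0) -> smooth_on U h -> smooth_on U (fun x => / h x).
Proof. intros oU nz Hh k. now apply Ck_inv. Qed.

Lemma smooth_div U f h :
  open U -> (forall x, U x -> h x <> 0) -> smooth_on U f -> smooth_on U h ->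
  smooth_on U (fun x => f x / h x).
Proof. intros. now apply smooth_mult; [| |apply smooth_inv]. Qed.

Lemma smooth_pow U h n : open U -> smooth_on U h -> smooth_on U (fun x => h x ^ n).
Proof.
intros oU H; induction n as [|n IH]; simpl; [apply smooth_const|now apply smooth_mult].
Qed.

Lemma dderiv_plus_on U f h v x : smooth_on U f -> smooth_on U h -> U x ->
  dderiv v (fun y => f y + h y) x = dderiv v f x + dderiv v h x.
Proof. intros. apply dderiv_plus; eapply smooth_ex; eauto. Qed.

Lemma dderiv_mult_on U f h v x : smooth_on U f -> smooth_on U h -> U x ->
  dderiv v (fun y => f y * h y) x = dderiv v f x * h x + f x * dderiv v h x.
Proof. intros. apply dderiv_mult; eapply smooth_ex; eauto. Qed.

Lemma dderiv_opp f v x : dderiv v (fun y => - f y) x = - dderiv v f x.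
Proof. apply (Derive_opp (fun s : R => f (plus x (scal s v)))). Qed.

Lemma dderiv_minus_on U f h v x : smooth_on U f -> smooth_on U h -> U x ->
  dderiv v (fun y => f y - h y) x = dderiv v f x - dderiv v h x.
Proof.
intros Hf Hh Ux. apply (Derive_minus (fun s : R => f (plus x (scal s v)))); eapply smooth_ex; eauto.
Qed.

Lemma dderiv_scal (a : R) f v x : dderiv v (fun y => a * f y) x = a * dderiv v f x.
Proof. apply (Derive_scal (fun s : R => f (plus x (scal s v)))). Qed.

Lemma smooth_sum3 U (F : ix -> E -> R) : open U -> (forall i, smooth_on U (F i)) ->
  smooth_on U (fun x => sum3 (fun i => F i x)).
Proof. intros oU H. unfold sum3. apply smooth_plus; [easy|apply smooth_plus; auto|auto]. Qed.

Lemma dderiv_sum3_on U (F : ix -> E -> R) v x : open U -> (forall i, smooth_on U (F i)) -> U x ->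
  dderiv v (fun y => sum3 (fun i => F i y)) x = sum3 (fun i => dderiv v (F i) x).
Proof.
intros oU H Ux. unfold sum3.
rewrite (dderiv_plus_on U (fun y => F I1 y + F I2 y)) by auto using smooth_plus.
now rewrite (dderiv_plus_on U) by auto.
Qed.

Lemma plane_continuous x v w (a b : R) :
  continuous (fun z : R * R => plus x (plus (scal (fst z) v) (scal (snd z) w))) (a, b).
Proof.
apply (continuous_plus (fun _ => x)); [apply continuous_const|].
apply (continuous_plus (fun z : R * R => scal (fst z) v)).
- apply (continuous_scal_l (fun z : R * R => fst z) v), continuous_fst.
- apply (continuous_scal_l (fun z : R * R => snd z) w), continuous_snd.
Qed.

(** Restricting [f] to the plane through [x] spanned by [v] and [w] reduces the claim to Schwarz's
    theorem in two real variables at the origin. *)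
Lemma dderiv_comm k U f v w x :
  open U -> Ck_on (S (S k)) U f -> U x -> dderiv v (dderiv w f) x = dderiv w (dderiv v f) x.
Proof.
intros oU Hf Ux.
set (P := fun a b : R => plus x (plus (scal a v) (scal b w))).
assert (Pv : forall a b, P a b = plus (plus x (scal b w)) (scal a v)).
{ intros a b; unfold P. rewrite <- plus_assoc. f_equal. apply plus_comm. }
assert (Pw : forall a b, P a b = plus (plus x (scal a v)) (scal b w)).
{ intros a b; unfold P. now rewrite plus_assoc. }
assert (P0 : P 0 0 = x) by now rewrite Pv, !line_zero.
assert (Hloc : locally_2d (fun a b => U (P a b)) 0 0).
{ apply locally_2d_locally. apply (plane_continuous x v w 0 0 U).
  change (locally (P 0 0) U). rewrite P0. now apply oU. }
destruct (proj2 Hf v) as [_ Hv]. destruct (proj2 Hf w) as [_ Hw].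
assert (Dv : forall h a b, Ck_on 1 U h -> U (P a b) ->
   is_derive (fun z : R => h (P z b)) a (dderiv v h (P a b))).
{ intros h a b Hh Uab. rewrite Pv in *.
  apply (is_derive_ext (fun z : R => h (plus (plus x (scal b w)) (scal z v)))).
  - intros t; now rewrite Pv.
  - now apply (is_derive_line 0 U). }
assert (Dw : forall h a b, Ck_on 1 U h -> U (P a b) ->
   is_derive (fun z : R => h (P a z)) b (dderiv w h (P a b))).
{ intros h a b Hh Uab. rewrite Pw in *.
  apply (is_derive_ext (fun z : R => h (plus (plus x (scal a v)) (scal z w)))).
  - intros t; now rewrite Pw.
  - now apply (is_derive_line 0 U). }
assert (C1 : forall h, Ck_on (S k) U h -> Ck_on 1 U h).
{ intros h; clear; induction k as [|j IH]; [easy|]. intros H; apply IH, Ck_S, H. }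
assert (Cf : Ck_on 1 U f) by (apply C1, Ck_S, Hf).
assert (Cv : Ck_on 1 U (dderiv v f)) by now apply C1.
assert (Cw : Ck_on 1 U (dderiv w f)) by now apply C1.
(* [Schwarz] is phrased with nested [Derive]. The inner one equals a [dderiv] only while the plane
   stays in [U], so it can be replaced only locally. *)
assert (Lvw : forall a b, locally_2d (fun a b => U (P a b)) a b ->
   locally b (fun z : R => Derive (fun t : R => f (P t z)) a = dderiv v f (P a z))).
{ intros a b [d Hd]. exists d. intros z Bz. apply is_derive_unique, Dv; [exact Cf|].
  apply Hd; [rewrite Rminus_diag, Rabs_R0; apply cond_pos|exact Bz]. }
assert (Lwv : forall a b, locally_2d (fun a b => U (P a b)) a b ->
   locally a (fun z : R => Derive (fun t : R => f (P z t)) b = dderiv w f (P z b))).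
{ intros a b [d Hd]. exists d. intros z Bz. apply is_derive_unique, Dw; [exact Cf|].
  apply Hd; [exact Bz|rewrite Rminus_diag, Rabs_R0; apply cond_pos]. }
assert (Mvw : locally_2d (fun a b => U (P a b) /\
   is_derive (fun z : R => Derive (fun t : R => f (P z t)) b) a (dderiv v (dderiv w f) (P a b)) /\
   is_derive (fun z : R => Derive (fun t : R => f (P t z)) a) b (dderiv w (dderiv v f) (P a b))) 0 0).
{ generalize Hloc; apply locally_2d_impl_strong, locally_2d_forall. intros a b Hab.
  pose proof (locally_2d_singleton _ _ _ Hab) as Uab. simpl in Uab.
  split; [exact Uab|split].
  - apply (is_derive_ext_loc (fun z : R => dderiv w f (P z b))).
    + generalize (Lwv _ _ Hab); apply filter_imp; intros; now symmetry.
    + now apply Dv.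
  - apply (is_derive_ext_loc (fun z : R => dderiv v f (P a z))).
    + generalize (Lvw _ _ Hab); apply filter_imp; intros; now symmetry.
    + now apply Dw. }
assert (cont : forall h, (forall y, U y -> continuous h y) ->
   continuity_2d_pt (fun a b => h (P a b)) 0 0).
{ intros h Hh. apply continuity_2d_pt_filterlim.
  apply (continuous_comp (fun z : R * R => P (fst z) (snd z)) h (0,0)).
  - apply plane_continuous.
  - simpl. rewrite P0. auto. }
assert (S := Schwarz (fun a b => f (P a b)) 0 0).
assert (HS : Derive (fun z : R => Derive (fun t : R => f (P z t)) 0) 0 =
   Derive (fun z : R => Derive (fun t : R => f (P t z)) 0) 0).
{ apply S.
  - generalize Mvw; apply locally_2d_impl, locally_2d_forall. intros a b (Uab & H1 & H2).
    repeat split.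
    + eexists; now apply Dv.
    + eexists; now apply Dw.
    + eexists; exact H1.
    + eexists; exact H2.
  - apply (continuity_2d_pt_ext_loc (fun a b => dderiv v (dderiv w f) (P a b))).
    + generalize Mvw; apply locally_2d_impl, locally_2d_forall. intros a b (_ & H1 & _).
      symmetry; now apply is_derive_unique.
    + apply cont. destruct (proj2 Cw v) as [_ Hc]. exact Hc.
  - apply (continuity_2d_pt_ext_loc (fun a b => dderiv w (dderiv v f) (P a b))).
    + generalize Mvw; apply locally_2d_impl, locally_2d_forall. intros a b (_ & _ & H2).
      symmetry; now apply is_derive_unique.
    + apply cont. destruct (proj2 Cv w) as [_ Hc]. exact Hc. }
destruct (locally_2d_singleton _ _ _ Mvw) as (_ & H1 & H2).
simpl in H1, H2. rewrite P0 in H1, H2.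
apply is_derive_unique in H1. apply is_derive_unique in H2.
etransitivity; [symmetry; exact H1|]. etransitivity; [exact HS|exact H2].
Qed.

Lemma smooth_comm U f v w x :
  open U -> smooth_on U f -> U x -> dderiv v (dderiv w f) x = dderiv w (dderiv v f) x.
Proof. intros oU H Ux. now apply (dderiv_comm 0 U). Qed.

End Calculus.

(** [A] carries the line through [x] in direction [v] to the line through [A x] in direction [l v],
    so derivatives pull back without a chain rule. Slices, projections and coordinate planes are all
    treated this way. *)
Lemma Ck_affine {E E' : NormedModule R_AbsRing} (A l : E -> E') k U (f : E' -> R) :
  (forall x s v, A (plus x (scal s v)) = plus (A x) (scal s (l v))) ->
  (forall x, continuous A x) ->
  Ck_on k U f -> Ck_on k (fun x => U (A x)) (fun x => f (A x)).
Proof.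
intros HA cA; revert f; induction k as [|k IH]; intros f H.
- intros x Ux. apply (continuous_comp A f); auto.
- destruct H as [Hc Hd]; split.
  + intros x Ux. apply (continuous_comp A f); auto.
  + intros v; destruct (Hd (l v)) as [He Hk]; split.
    * intros x Ux. apply (ex_derive_ext (fun s : R => f (plus (A x) (scal s (l v))))).
      -- intros s; now rewrite HA.
      -- now apply He.
    * replace (dderiv v (fun x => f (A x))) with (fun x => dderiv (l v) f (A x)); [now apply IH|].
      apply functional_extensionality; intros x. apply Derive_ext; intros s; now rewrite HA.
Qed.

Lemma Ck_linear {E : NormedModule R_AbsRing} (A : E -> R) k U :
  is_linear A -> Ck_on k U A.
Proof.
intros HA.
assert (cA : forall x, continuous A x) by (intros x; exact (linear_cont (V := R_NormedModule) A x HA)).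
assert (D : forall v x, is_derive (fun s : R => A (plus x (scal s v))) 0 (A v)).
{ intros v x. apply (is_derive_ext (fun s : R => A x + s * A v)).
  - intros s. rewrite (linear_plus _ HA), (linear_scal _ HA). reflexivity.
  - auto_derive; [easy|ring]. }
destruct k as [|k]; [intros x _; apply cA|split; [intros x _; apply cA|]].
intros v; split; [intros x _; eexists; apply D|].
replace (dderiv v A) with (fun _ : E => A v); [apply Ck_const|].
apply functional_extensionality; intros x; symmetry; apply dderiv_unique, D.
Qed.

Lemma dderiv_linear {E : NormedModule R_AbsRing} (A : E -> R) v x :
  is_linear A -> dderiv v A x = A v.
Proof.
intros HA. apply dderiv_unique. apply (is_derive_ext (fun s : R => A x + s * A v)).
- intros s. rewrite (linear_plus _ HA), (linear_scal _ HA). reflexivity.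
- auto_derive; [easy|ring].
Qed.

(** * Differentiability of functions with continuous partial derivatives *)

(* [ring] does not recognise [R] behind the carriers of Coquelicot's algebraic structures. *)
Ltac Req := match goal with |- @eq _ ?a ?b => change (@eq R a b) end.

Lemma mean_value (f df : R -> R) (a b : R) :
  (forall t, Rmin a b <= t <= Rmax a b -> is_derive f t (df t)) ->
  exists c, Rmin a b <= c <= Rmax a b /\ f b - f a = df c * (b - a).
Proof.
intros H. apply MVT_gen.
- intros t Ht. apply H; lra.
- intros t Ht. apply continuity_pt_filterlim, (ex_derive_continuous f). eexists; now apply H.
Qed.

Lemma between_abs (a b c : R) : Rmin a b <= c <= Rmax a b -> Rabs (c - a) <= Rabs (b - a).
Proof.
unfold Rmin, Rmax; destruct (Rle_dec a b); unfold Rabs; repeat destruct Rcase_abs; lra.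
Qed.

Lemma plus_scal_zero {F : NormedModule R_AbsRing} (a : F) (s : R) : plus a (scal s zero) = a.
Proof. change (plus a (@scal R_AbsRing _ s zero) = a). now rewrite scal_zero_r, plus_zero_r. Qed.

Lemma plus_scal_real (a b : R) : plus a (scal b 1) = a + b.
Proof. change (a + b * 1 = a + b). ring. Qed.

Lemma pair_line {E F : NormedModule R_AbsRing} (a v : E) (b w : F) (s : R) :
  plus (a, b) (scal s (v, w)) = (plus a (scal s v), plus b (scal s w)).
Proof. reflexivity. Qed.

Lemma is_derive_line_at {E : NormedModule R_AbsRing} k U (f : E -> R) x v (s : R) p :
  Ck_on (S k) U f -> p = plus x (scal s v) -> U p ->
  is_derive (fun s : R => f (plus x (scal s v))) s (dderiv v f p).
Proof. intros Hf -> Up. now apply (is_derive_line k U). Qed.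

(** Formulated as a property of the space, so that it can be proved for [R] and passed on to a
    product with [R]: the plane and [pt] are reached one coordinate at a time. *)
Definition C1_differentiable (E : NormedModule R_AbsRing) : Prop :=
  forall (U : E -> Prop) (f : E -> R) x, open U -> Ck_on 1 U f -> U x ->
    filterdiff f (locally x) (fun v => dderiv v f x).

Lemma filterdiff_pair {E F G : NormedModule R_AbsRing} (f : E -> F) (h : E -> G) x lf lh :
  filterdiff f (locally x) lf -> filterdiff h (locally x) lh ->
  filterdiff (fun y => (f y, h y)) (locally x) (fun v => (lf v, lh v)).
Proof.
intros Hf Hh. apply (filterdiff_comp'_2 f h (fun a b => (a, b))); auto.
apply filterdiff_linear. apply is_linear_prod; [apply is_linear_fst|apply is_linear_snd].
Qed.

Lemma filterdiff_derive_line {E : NormedModule R_AbsRing} (f : E -> R) x v l :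
  filterdiff f (locally x) l -> is_derive (fun s : R => f (plus x (scal s v))) 0 (l v).
Proof.
intros H. unfold is_derive.
apply (filterdiff_ext_lin _ (fun s : R => l (scal s v))).
- apply (filterdiff_comp' (fun s : R => plus x (scal s v)) f).
  + apply (filterdiff_ext_lin _ (fun s : R_AbsRing => scal s (plus zero v))).
    * apply (is_derive_plus (fun _ : R_AbsRing => x) (fun s : R_AbsRing => scal s v)).
      -- apply (is_derive_const x).
      -- apply (filterdiff_linear (fun s : R_AbsRing => scal s v)), is_linear_scal_l.
    * intros s; now rewrite plus_zero_l.
  + now rewrite line_zero.
- intros s. apply (linear_scal l (proj1 H)).
Qed.

(** Split [f (a, b)] as [f (a, y)] plus an increment in the real variable. The mean value theorem
    turns the increment into [b - y] times a value of [d] near [(x, y)], and continuity of [d]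
    bounds the error. *)
Lemma filterdiff_prod_r {E : NormedModule R_AbsRing} (f : E * R -> R) x (y : R) l (d : E * R -> R) :
  filterdiff (fun a => f (a, y)) (locally x) l ->
  locally (x, y) (fun z : E * R => is_derive (fun b => f (fst z, b)) (snd z) (d z)) ->
  continuous d (x, y) ->
  filterdiff f (locally (x, y)) (fun v : E * R => l (fst v) + snd v * d (x, y)).
Proof.
intros Hl Hd Hc.
apply (filterdiff_ext (fun z : E * R => f (fst z, y) + (f z - f (fst z, y)))).
{ intros z; Req; ring. }
apply (filterdiff_plus_fct (fun z : E * R => f (fst z, y)) (fun z : E * R => f z - f (fst z, y))
   (fun v => l (fst v)) (fun v => snd v * d (x, y))).
- apply (filterdiff_comp' (fun z : E * R => fst z) (fun a => f (a, y))); [|exact Hl].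
  apply filterdiff_linear, is_linear_fst.
- split.
  + apply (is_linear_comp (fun z : E * R => snd z) (fun s : R => s * d (x, y))).
    * apply is_linear_snd.
    * exact (is_linear_scal_l (V := R_NormedModule) (d (x, y))).
  + intros z Hz. 
    assert (ez := is_filter_lim_locally_unique
      (V := prod_NormedModule R_AbsRing E R_NormedModule) (x, y) z Hz). subst z.
    intros eps.
    pose proof (proj1 (filterlim_locally d (d (x, y))) Hc eps) as He.
    destruct (filter_and _ _ He Hd) as [rho Hrho].
    exists rho. intros [a b] [Ba Bb]. simpl in Ba, Bb |- *.
    change (Rabs (b - y) < rho) in Bb.
    destruct (mean_value (fun b => f (a, b)) (fun t => d (a, t)) y b) as (xi & Hxi & Heq).
    * intros t Ht. apply (Hrho (a, t)). split; [exact Ba|]. apply between_abs in Ht.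
      change (Rabs (t - y) < rho). lra.
    * apply between_abs in Hxi.
      assert (Hball : ball (d (x, y)) eps (d (a, xi))).
      { apply Hrho. split; [exact Ba|]. change (Rabs (xi - y) < rho). lra. }
      change (Rabs (d (a, xi) - d (x, y)) < eps) in Hball.
      unfold minus at 1 2. unfold norm at 1; simpl. unfold abs; simpl.
      unfold plus, opp; simpl.
      replace (_ + _) with ((d (a, xi) - d (x, y)) * (b - y)).
      -- rewrite Rabs_mult. apply Rmult_le_compat; try apply Rabs_pos; [lra|].
         eapply Rle_trans; [|apply norm_prod]. eapply Rle_trans; [|apply Rmax_r].
         apply Rle_refl.
      -- rewrite Rmult_minus_distr_r, <- Heq.
         change (f (a, b) - f (a, y) - d (x, y) * (b - y) =
           f (a, b) - f (a, y) + - (f (x, y) - f (x, y)) + - ((b + - y) * d (x, y))).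
         ring.
Qed.

(** The same with the real factor on the left, by exchanging the factors; it serves space-time
    [R * pt]. *)
Lemma filterdiff_prod_l {E : NormedModule R_AbsRing} (f : R * E -> R) (x : R) y l (d : R * E -> R) :
  filterdiff (fun b => f (x, b)) (locally y) l ->
  locally (x, y) (fun z : R * E => is_derive (fun a => f (a, snd z)) (fst z) (d z)) ->
  continuous d (x, y) ->
  filterdiff f (locally (x, y)) (fun v : R * E => fst v * d (x, y) + l (snd v)).
Proof.
intros Hl Hd Hc.
assert (swap_cont : continuous (fun z : E * R => (snd z, fst z)) (y, x)).
{ intros P [e He]. exists e. intros [a b] [B1 B2]. apply He. now split. }
apply (filterdiff_ext_lin _ (fun v : R * E => l (snd v) + fst v * d (x, y))); [|intros v; Req; ring].
apply (filterdiff_ext (fun z : R * E => f (fst z, snd z))); [now intros []|].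
apply (filterdiff_comp' (fun z : R * E => (snd z, fst z)) (fun z : E * R => f (snd z, fst z))
   (x, y) (fun v : R * E => (snd v, fst v)) (fun v : E * R => l (fst v) + snd v * d (x, y))).
- apply filterdiff_linear, is_linear_prod; [apply is_linear_snd|apply is_linear_fst].
- apply (filterdiff_prod_r (fun z : E * R => f (snd z, fst z)) y x l (fun z => d (snd z, fst z))).
  + exact Hl.
  + exact (swap_cont _ Hd).
  + now apply (continuous_comp (fun z : E * R => (snd z, fst z)) d).
Qed.

Lemma C1_differentiable_R : C1_differentiable R_NormedModule.
Proof.
intros U f x oU Hf Ux.
assert (H : is_derive f x (Derive f x)).
{ apply Derive_correct. destruct (proj2 Hf 1) as [He _]. specialize (He x Ux).
  apply (ex_derive_ext (fun t => f (x + ((t - x) * 1)))).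
  { intros t. f_equal. Req; ring. }
  apply (ex_derive_comp (fun s => f (x + s * 1)) (fun t => t - x)).
  - rewrite Rminus_diag. exact He.
  - auto_derive; easy. }
apply (filterdiff_ext_lin _ _ _ H).
intros v. symmetry. apply dderiv_unique. exact (filterdiff_derive_line f x v _ H).
Qed.

Lemma C1_differentiable_prod_r (E : NormedModule R_AbsRing) :
  C1_differentiable E -> C1_differentiable (prod_NormedModule R_AbsRing E R_NormedModule).
Proof.
intros HE U f [x y] oU Hf Uxy.
assert (line : forall (a : E) (b : R), plus (a, 0) (scal b (zero, 1)) = (a, b)).
{ intros a b. etransitivity; [apply (pair_line (E := E) (F := R_NormedModule))|]. f_equal; [apply (plus_scal_zero (F := E))|].
  rewrite plus_scal_real. apply Rplus_0_l. }
assert (H : exists l, filterdiff f (locally (x, y)) l).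
{ eexists. apply (filterdiff_prod_r f x y (fun v => dderiv v (fun a => f (a, y)) x) (dderiv (zero, 1) f)).
  - apply (HE (fun a => U (a, y))).
    + apply (open_comp (fun a => (a, y)) U); [|exact oU].
      intros a _ P [e He]. exists e. intros b Bb. apply He. split; [exact Bb|apply ball_center].
    + apply (Ck_affine (fun a => (a, y)) (fun v : E => (v, zero)) 1 U f); [| |exact Hf].
      * intros a s v. etransitivity; [|symmetry; apply (pair_line (E := E) (F := R_NormedModule))]. f_equal.
        symmetry; apply (plus_scal_zero (F := R_NormedModule)).
      * intros a P [e He]. exists e. intros b Bb. apply He. split; [exact Bb|apply ball_center].
    + exact Uxy.
  - destruct (oU _ Uxy) as [e He]. exists e. intros [a b] Bab; pose proof (He _ Bab) as Uab; simpl.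
    apply (is_derive_ext (fun s : R => f (plus (a, 0) (scal s (zero, 1))))).
    + intros t. now rewrite line.
    + apply (is_derive_line_at 0 U); [exact Hf|symmetry; apply line|exact Uab].
  - destruct (proj2 Hf (zero, 1)) as [_ Hc]. now apply Hc. }
destruct H as [l Hl].
apply (filterdiff_ext_lin _ _ _ Hl).
intros v. symmetry. apply dderiv_unique. exact (filterdiff_derive_line f (x, y) v _ Hl).
Qed.

Lemma dderiv_add {E : NormedModule R_AbsRing} (U : E -> Prop) f v w x :
  C1_differentiable E -> open U -> Ck_on 1 U f -> U x ->
  dderiv (plus v w) f x = dderiv v f x + dderiv w f x.
Proof.
intros HE oU Hf Ux. destruct (HE U f x oU Hf Ux) as [Hl _]. apply (linear_plus _ Hl).
Qed.

Lemma dderiv_smul {E : NormedModule R_AbsRing} (U : E -> Prop) f (a : R) v x :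
  C1_differentiable E -> open U -> Ck_on 1 U f -> U x ->
  dderiv (scal a v) f x = a * dderiv v f x.
Proof.
intros HE oU Hf Ux. destruct (HE U f x oU Hf Ux) as [Hl _]. apply (linear_scal _ Hl).
Qed.

Lemma C1_differentiable_plane : C1_differentiable plane_module.
Proof. apply C1_differentiable_prod_r, C1_differentiable_R. Qed.

Lemma C1_differentiable_pt :
  C1_differentiable pt_module.
Proof. apply C1_differentiable_prod_r, C1_differentiable_plane. Qed.

Lemma plane_line (x1 x2 v1 v2 s : R) :
  plus ((x1, x2) : R * R) (scal s ((v1, v2) : R * R)) = (x1 + s * v1, x2 + s * v2).
Proof. reflexivity. Qed.

Lemma dderiv_pt (U : pt -> Prop) f (v x : pt) :
  open U -> Ck_on 1 U f -> U x ->
  dderiv v f x = sum3 (fun i => coord i v * partial i f x).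
Proof.
intros oU Hf Ux. destruct v as [[v1 v2] v3].
assert (H : dderiv (plus (plus (scal v1 (basis I1)) (scal v2 (basis I2))) (scal v3 (basis I3)) : pt) f x
  = v1 * dderiv (basis I1) f x + v2 * dderiv (basis I2) f x + v3 * dderiv (basis I3) f x).
{ now rewrite !(dderiv_add U), !(dderiv_smul U) by auto using C1_differentiable_pt. }
assert (e : (plus (plus (scal v1 (basis I1)) (scal v2 (basis I2))) (scal v3 (basis I3)) : pt) = (v1, v2, v3)).
{ change ((v1 * 1 + v2 * 0 + v3 * 0, v1 * 0 + v2 * 1 + v3 * 0, v1 * 0 + v2 * 0 + v3 * 1) = (v1, v2, v3)).
  f_equal; [f_equal|]; ring. }
rewrite e in H. exact H.
Qed.

Lemma dderiv_plane (U : R * R -> Prop) f (v x : R * R) :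
  open U -> Ck_on 1 U f -> U x ->
  dderiv v f x = fst v * dderiv (1, 0) f x + snd v * dderiv (0, 1) f x.
Proof.
intros oU Hf Ux. destruct v as [v1 v2].
assert (H : dderiv (plus (scal v1 ((1, 0) : R * R)) (scal v2 ((0, 1) : R * R)) : R * R) f x
  = v1 * dderiv (1, 0) f x + v2 * dderiv (0, 1) f x).
{ now rewrite !(dderiv_add U), !(dderiv_smul U) by auto using C1_differentiable_plane. }
assert (e : (plus (scal v1 ((1, 0) : R * R)) (scal v2 ((0, 1) : R * R)) : R * R) = (v1, v2)).
{ change ((v1 * 1 + v2 * 0, v1 * 0 + v2 * 1) = (v1, v2)). f_equal; ring. }
rewrite e in H. exact H.
Qed.

Lemma chain_pt (U : pt -> Prop) f (c1 c2 c3 : R -> R) (s d1 d2 d3 : R) :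
  open U -> Ck_on 1 U f -> U (c1 s, c2 s, c3 s) ->
  is_derive c1 s d1 -> is_derive c2 s d2 -> is_derive c3 s d3 ->
  is_derive (fun s => f (c1 s, c2 s, c3 s)) s
    (d1 * partial I1 f (c1 s, c2 s, c3 s) + d2 * partial I2 f (c1 s, c2 s, c3 s)
     + d3 * partial I3 f (c1 s, c2 s, c3 s)).
Proof.
intros oU Hf Us H1 H2 H3.
pose proof (C1_differentiable_pt U f _ oU Hf Us) as Hd.
pose proof (filterdiff_comp' _ f s _ _
  (filterdiff_pair _ c3 s _ _ (filterdiff_pair c1 c2 s _ _ H1 H2) H3) Hd) as H.
apply (filterdiff_ext_lin _ _ _ H). intros y; simpl.
rewrite (dderiv_pt U) by auto. unfold sum3, coord, scal; simpl. unfold mult; simpl. Req. ring.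
Qed.

Lemma chain_plane (U : R * R -> Prop) f (c1 c2 : R -> R) (s d1 d2 : R) :
  open U -> Ck_on 1 U f -> U (c1 s, c2 s) ->
  is_derive c1 s d1 -> is_derive c2 s d2 ->
  is_derive (fun s => f (c1 s, c2 s)) s
    (d1 * dderiv (1, 0) f (c1 s, c2 s) + d2 * dderiv (0, 1) f (c1 s, c2 s)).
Proof.
intros oU Hf Us H1 H2.
pose proof (C1_differentiable_plane U f _ oU Hf Us) as Hd.
pose proof (filterdiff_comp' _ f s _ _ (filterdiff_pair c1 c2 s _ _ H1 H2) Hd) as H.
apply (filterdiff_ext_lin _ _ _ H). intros y; simpl.
rewrite (dderiv_plane U) by auto. unfold scal; simpl. unfold mult; simpl. Req. ring.
Qed.

Lemma is_linear_coord i : is_linear (V := R_NormedModule) (coord i).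
Proof.
assert (H1 := is_linear_comp (fun x : pt => fst x) (fun y : R * R => fst y)
  (is_linear_fst (K := R_AbsRing)) is_linear_fst).
assert (H2 := is_linear_comp (fun x : pt => fst x) (fun y : R * R => snd y)
  (is_linear_fst (K := R_AbsRing)) is_linear_snd).
assert (H3 := is_linear_snd (K := R_AbsRing)
  (U := plane_module) (V := R_NormedModule)).
destruct i.
- apply (is_linear_ext (V := R_NormedModule) (fun x : pt => fst (fst x)) (coord I1)); [now intros [[a b] c]|exact H1].
- apply (is_linear_ext (V := R_NormedModule) (fun x : pt => snd (fst x)) (coord I2)); [now intros [[a b] c]|exact H2].
- apply (is_linear_ext (V := R_NormedModule) (fun x : pt => snd x) (coord I3)); [now intros [[a b] c]|exact H3].
Qed.

Lemma smooth_coord i (U : pt -> Prop) : smooth_on U (coord i).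
Proof. intros k. apply Ck_linear, is_linear_coord. Qed.

Lemma dderiv_coord i (v x : pt) : dderiv v (coord i) x = coord i v.
Proof. apply dderiv_linear, is_linear_coord. Qed.

Lemma continuous_coord i (x : pt) : continuous (coord i) x.
Proof. exact (linear_cont (coord i : pt -> R_NormedModule) x (is_linear_coord i)). Qed.

Lemma continuous_pair {T U V : UniformSpace} (f : T -> U) (h : T -> V) x :
  continuous f x -> continuous h x -> continuous (fun y => (f y, h y)) x.
Proof.
intros Hf Hh. apply (continuous_comp_2 f h (fun a b => (a, b))); auto.
intros P [e He]. exists e. intros [a b] [B1 B2]. now apply He.
Qed.

(** * Chain rule for maps into three-space *)

Section Composition.
Context {E : NormedModule R_AbsRing} (V : E -> Prop) (U : pt -> Prop) (A B C : E -> R).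
Hypothesis (oV : open V) (oU : open U)
  (sA : smooth_on V A) (sB : smooth_on V B) (sC : smooth_on V C)
  (inU : forall x, V x -> U (A x, B x, C x)).

Lemma is_derive_comp_pt f v x : Ck_on 1 U f -> V x ->
  is_derive (fun s : R => f (A (plus x (scal s v)), B (plus x (scal s v)), C (plus x (scal s v)))) 0
    (dderiv v A x * partial I1 f (A x, B x, C x) + dderiv v B x * partial I2 f (A x, B x, C x)
     + dderiv v C x * partial I3 f (A x, B x, C x)).
Proof.
intros Hf Vx.
assert (H := fun F HF => Derive_correct _ _ (smooth_ex V F v x HF Vx)).
pose proof (chain_pt U f (fun s : R => A (plus x (scal s v))) (fun s : R => B (plus x (scal s v)))
  (fun s : R => C (plus x (scal s v))) 0 (dderiv v A x) (dderiv v B x) (dderiv v C x) oU Hf) as Hc.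
cbv beta in Hc. rewrite line_zero in Hc.
exact (Hc (inU x Vx) (H A sA) (H B sB) (H C sC)).
Qed.

Lemma dderiv_comp_pt f v x : Ck_on 1 U f -> V x ->
  dderiv v (fun y => f (A y, B y, C y)) x =
    dderiv v A x * partial I1 f (A x, B x, C x) + dderiv v B x * partial I2 f (A x, B x, C x)
     + dderiv v C x * partial I3 f (A x, B x, C x).
Proof. intros Hf Vx. apply dderiv_unique. now apply is_derive_comp_pt. Qed.

(** By the chain rule the derivative is a combination of derivatives of the smooth components with
    compositions of partial derivatives of [f], to which the induction hypothesis applies. *)
Lemma Ck_comp_pt k f : Ck_on k U f -> Ck_on k V (fun y => f (A y, B y, C y)).
Proof.
assert (C0 : forall f : pt -> R, (forall x, U x -> continuous f x) ->
   forall x : E, V x -> continuous (fun y => f (A y, B y, C y)) x).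
{ intros h Hh x Vx. apply (continuous_comp (fun y => (A y, B y, C y)) h).
  - apply continuous_pair; [apply continuous_pair|]; eapply smooth_continuous; eauto.
  - now apply Hh, inU. }
revert f; induction k as [|k IH]; intros f Hf; [exact (C0 f Hf)|].
split; [exact (C0 f (proj1 Hf))|]. intros v.
assert (H1 : Ck_on 1 U f).
{ clear -Hf. induction k as [|j IHj]; [exact Hf|]. apply IHj, Ck_S, Hf. }
split.
- intros x Vx. eexists. now apply is_derive_comp_pt.
- apply (Ck_ext k V (fun x => dderiv v A x * partial I1 f (A x, B x, C x)
     + dderiv v B x * partial I2 f (A x, B x, C x) + dderiv v C x * partial I3 f (A x, B x, C x)) _ oV).
  + intros x Vx. symmetry. now apply dderiv_comp_pt.
  + assert (HP : forall i, Ck_on k V (fun x => partial i f (A x, B x, C x))).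
    { intros i. apply IH. destruct (proj2 Hf (basis i)) as [_ Hk]. exact Hk. }
    repeat apply Ck_plus; auto; apply Ck_mult; auto; apply smooth_dderiv; auto.
Qed.

Lemma smooth_comp_pt f : smooth_on U f -> smooth_on V (fun y => f (A y, B y, C y)).
Proof. intros Hf k. now apply Ck_comp_pt. Qed.

End Composition.

Lemma smooth_R_ex_derive (I : R -> Prop) f x : smooth_on I f -> I x -> ex_derive f x.
Proof.
intros H Ix. pose proof (smooth_ex I f 1 x H Ix) as He.
apply (ex_derive_ext (fun t => f (x + ((t - x) * 1)))).
{ intros t. f_equal. Req; ring. }
apply (ex_derive_comp (fun s => f (x + s * 1)) (fun t => t - x)).
- rewrite Rminus_diag. exact He.
- auto_derive; easy.
Qed.

(** If [f x] were nonzero, [f] would stay away from 0 near [x]. This carries an identity from a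
    dense set to its closure. *)
Lemma continuous_locally_eq {T : UniformSpace} (f : T -> R) x :
  continuous f x -> (forall P : T -> Prop, locally x P -> exists y, P y /\ f y = 0) -> f x = 0.
Proof.
intros Hc Hd. apply NNPP. intros nz.
assert (He : 0 < Rabs (f x)) by now apply Rabs_pos_lt.
destruct (Hd _ (proj1 (filterlim_locally f (f x)) Hc (mkposreal _ He))) as (y & By & ey).
change (Rabs (f y - f x) < Rabs (f x)) in By. rewrite ey in By.
rewrite Rminus_0_l, Rabs_Ropp in By. lra.
Qed.

(** * Closed one-forms on star-shaped sets *)

Lemma is_derive_Rplus (f h : R -> R) (x a b : R) :
  is_derive f x a -> is_derive h x b -> is_derive (fun t => f t + h t) x (a + b).
Proof. exact (is_derive_plus f h x a b). Qed.

Lemma is_derive_Rmult (f h : R -> R) (x a b : R) :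
  is_derive f x a -> is_derive h x b -> is_derive (fun t => f t * h t) x (a * h x + f x * b).
Proof. intros Hf Hh. exact (is_derive_mult f h x a b Hf Hh Rmult_comm). Qed.

Lemma is_derive_Rscal_r (f : R -> R) (x a k : R) :
  is_derive f x a -> is_derive (fun t => f t * k) x (a * k).
Proof. exact (is_derive_scal_l f x a k). Qed.

Lemma continuous_Rplus {T : UniformSpace} (f h : T -> R) x :
  continuous f x -> continuous h x -> continuous (fun y => f y + h y) x.
Proof. exact (continuous_plus (V := R_NormedModule) f h x). Qed.

Lemma continuous_Rmult {T : UniformSpace} (f h : T -> R) x :
  continuous f x -> continuous h x -> continuous (fun y => f y * h y) x.
Proof. exact (continuous_mult (K := R_AbsRing) f h x). Qed.

Lemma is_derive_fst (V : R * R -> Prop) F (a b : R) :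
  smooth_on V F -> V (a, b) -> is_derive (fun z : R => F (z, b)) a (dderiv (1, 0) F (a, b)).
Proof.
intros HF Vab.
apply (is_derive_ext (fun s : R => F (plus ((0, b) : R * R) (scal s ((1, 0) : R * R))))).
- intros t. f_equal. rewrite plane_line. f_equal; Req; ring.
- apply (is_derive_line_at 0 V); [apply HF| |exact Vab].
  rewrite plane_line. f_equal; ring.
Qed.

Lemma continuous_slice (V : R * R -> Prop) F (a b : R) :
  smooth_on V F -> V (a, b) -> continuous (fun s : R => F (a, s)) b.
Proof.
intros HF Vab. apply (continuous_comp (fun s : R => (a, s)) F).
- apply continuous_pair; [apply continuous_const|apply continuous_id].
- now apply (smooth_continuous V).
Qed.

(** Differentiation under the integral sign; the third hypothesis keeps the vertical unit segments
    over all nearby parameters inside the domain of smoothness. *)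
Lemma is_derive_parametric_integral (V : R * R -> Prop) F (a : R) :
  open V -> smooth_on V F -> locally a (fun t : R => forall s, 0 <= s <= 1 -> V (t, s)) ->
  is_derive (fun t : R => RInt (fun s => F (t, s)) 0 1) a
    (RInt (fun s => dderiv (1, 0) F (a, s)) 0 1).
Proof.
intros oV HF Hl.
assert (E01 : forall t : R, Rmin 0 1 <= t <= Rmax 0 1 -> 0 <= t <= 1).
{ intros t. rewrite Rmin_left, Rmax_right by lra. easy. }
pose proof (locally_singleton _ _ Hl) as Va.
evar_last.
- apply (is_derive_RInt_param (fun t s => F (t, s)) 0 1 a).
  + revert Hl; apply filter_imp; intros t Ht s Hs. eexists. apply (is_derive_fst V); auto.
  + intros s Hs. apply (continuity_2d_pt_ext_loc (fun u v => dderiv (1, 0) F (u, v))).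
    * apply locally_2d_locally.
      apply (filter_imp V); [|apply oV; apply Va; auto].
      intros [u v] Vuv. symmetry. apply is_derive_unique. now apply (is_derive_fst V).
    * apply continuity_2d_pt_filterlim.
      apply (continuous_ext (dderiv (1, 0) F)); [now intros []|].
      apply (smooth_continuous V); [now apply smooth_dderiv|]. apply Va; auto.
  + revert Hl; apply filter_imp; intros t Ht.
    apply (ex_RInt_continuous (fun s => F (t, s))). intros s Hs. apply (continuous_slice V); auto.
- apply RInt_ext. intros s Hs. rewrite Rmin_left, Rmax_right in Hs by lra.
  apply is_derive_unique. apply (is_derive_fst V); [exact HF|]. apply Va; lra.
Qed.

Definition closed_form_on (M : pt -> Prop) (om : ix -> pt -> R) : Prop :=
  forall i j x, M x -> partial i (om j) x = partial j (om i) x.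

Definition pairing (om : ix -> pt -> R) (x v : pt) : R := sum3 (fun i => om i x * coord i v).

Definition segment (x y : pt) (s : R) : pt := plus x (scal s (minus y x)).

Definition segment_integral (om : ix -> pt -> R) (x y : pt) : R :=
  RInt (fun s => pairing om (segment x y s) (minus y x)) 0 1.

(** Stated along every direction rather than through partial derivatives, so that it applies along
    segments before anything else is known about the regularity of [P]. *)
Definition primitive_on (V : pt -> Prop) (om : ix -> pt -> R) (P : pt -> R) : Prop :=
  forall x v, V x -> is_derive (fun s : R => P (plus x (scal s v))) 0 (pairing om x v).

Lemma segment_coord i x y (s : R) : coord i (segment x y s) = coord i x + s * (coord i y - coord i x).
Proof. destruct x as [[x1 x2] x3], y as [[y1 y2] y3], i; reflexivity. Qed.

Lemma minus_coord i (x y : pt) : coord i (minus y x) = coord i y - coord i x.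
Proof. destruct x as [[x1 x2] x3], y as [[y1 y2] y3], i; reflexivity. Qed.

Lemma line_coord i (x v : pt) (s : R) : coord i (plus x (scal s v)) = coord i x + s * coord i v.
Proof. destruct x as [[x1 x2] x3], v as [[y1 y2] y3], i; reflexivity. Qed.

Lemma pt_coords (x : pt) : x = (coord I1 x, coord I2 x, coord I3 x).
Proof. now destruct x as [[a b] c]. Qed.

Lemma pt_eq (x y : pt) : (forall i, coord i x = coord i y) -> x = y.
Proof. intros H. rewrite (pt_coords x), (pt_coords y). now rewrite !H. Qed.

Lemma smooth_fst (V : R * R -> Prop) : smooth_on V (fun z => fst z).
Proof. intros k. apply Ck_linear, (is_linear_fst (U := R_NormedModule) (V := R_NormedModule)). Qed.

Lemma smooth_snd (V : R * R -> Prop) : smooth_on V (fun z => snd z).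
Proof. intros k. apply Ck_linear, (is_linear_snd (U := R_NormedModule) (V := R_NormedModule)). Qed.

Lemma continuous_segment x y s : continuous (segment x y) s.
Proof.
exact (line_continuous (E := pt_module) x (minus y x) s).
Qed.

Lemma segment_start x y : segment x y 0 = x.
Proof. apply pt_eq; intros i. rewrite segment_coord. ring. Qed.

Lemma segment_end x y : segment x y 1 = y.
Proof. apply pt_eq; intros i. rewrite segment_coord. ring. Qed.

Lemma pairing_line (M : pt -> Prop) (om : ix -> pt -> R) i x v :
  open M -> smooth_on M (om i) -> M x ->
  dderiv v (om i) x = sum3 (fun j => coord j v * partial j (om i) x).
Proof. intros oM Hom Mx. now apply (dderiv_pt M); [|apply Hom|]. Qed.

(** Varying the endpoint of the segment in direction [v] and differentiating under the integral
    gives an integrand which, by closedness, is the derivative in [s] of [s] times the form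
    evaluated on [v]. Only the boundary term at [s = 1] survives. *)
Lemma primitive_starshaped (V : pt -> Prop) (om : ix -> pt -> R) (c : pt) :
  open V -> (forall i, smooth_on V (om i)) -> closed_form_on V om ->
  (forall y s, V y -> 0 <= s <= 1 -> V (segment c y s)) ->
  primitive_on V om (segment_integral om c).
Proof.
intros oV Hom Hcl Hst y v Vy.
(* [fst z] moves the endpoint to $y + av$ and [snd z] is the parameter on the segment from [c] to
   it. *)
set (q := fun i (z : R * R) => coord i c + snd z * (coord i y + fst z * coord i v - coord i c)).
set (Q := fun z : R * R => (q I1 z, q I2 z, q I3 z) : pt).
assert (EQ : forall a b, Q (a, b) = segment c (plus y (scal a v)) b).
{ intros a b. apply pt_eq; intros i. rewrite segment_coord, line_coord. destruct i; reflexivity. }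
set (W := fun z => V (Q z)).
assert (oT : open (fun _ : R * R => True)) by (intros z _; apply filter_true).
assert (sq : forall i U, open U -> smooth_on U (q i)).
{ intros i U oU. unfold q. repeat first [apply smooth_plus|apply smooth_mult|apply smooth_minus
   |apply smooth_const|apply smooth_fst|apply smooth_snd|exact oU]. }
assert (oW : open W).
{ apply (open_comp Q V); [|exact oV]. intros z _.
  apply continuous_pair; [apply continuous_pair|];
  exact (smooth_continuous (fun _ : R * R => True) _ z (sq _ _ oT) I). }
set (F := fun z => pairing om (Q z) (minus (plus y (scal (fst z) v)) c)).
set (w := fun i (z : R * R) => coord i y + fst z * coord i v - coord i c).
assert (EF : forall z, F z = sum3 (fun i => om i (q I1 z, q I2 z, q I3 z) * w i z)).
{ intros z. unfold F, pairing, sum3. now rewrite !minus_coord, !line_coord. }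
assert (sw : forall i, smooth_on W (w i)).
{ intros i. unfold w. repeat first [apply smooth_plus|apply smooth_mult|apply smooth_minus
   |apply smooth_const|apply smooth_fst|apply smooth_snd|exact oW]. }
assert (so : forall i, smooth_on W (fun z => om i (q I1 z, q I2 z, q I3 z))).
{ intros i. apply (smooth_comp_pt W V); auto. }
assert (sF : smooth_on W F).
{ apply (smooth_ext W (fun z => sum3 (fun i => om i (q I1 z, q I2 z, q I3 z) * w i z))); [exact oW| |].
  - intros; symmetry; apply EF.
  - unfold sum3. repeat first [exact oW|apply so|apply sw|apply smooth_plus|apply smooth_mult]. }
assert (nearW : locally (0:R) (fun t : R => forall s, 0 <= s <= 1 -> W (t, s))).
{ apply (filter_imp (fun t : R => V (plus y (scal t v)))).
  - intros t Vt s Hs. unfold W. rewrite EQ. now apply Hst.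
  - apply (line_locally_0 V y v). now apply oV. }
pose proof (is_derive_parametric_integral W F 0 oW sF nearW) as HD.
apply (is_derive_ext (fun t : R => RInt (fun s => F (t, s)) 0 1)).
{ intros t. apply RInt_ext. intros s _. unfold F. now rewrite EQ. }
evar_last; [exact HD|].
apply is_RInt_unique.
assert (W0 : forall s, 0 <= s <= 1 -> W (0, s)) by exact (locally_singleton _ _ nearW).
assert (Q0 : forall s, Q (0, s) = segment c y s) by (intros s; rewrite EQ; f_equal; exact (line_zero (E := pt_module) y v)).
set (h := fun s : R => s * pairing om (segment c y s) v).
replace (pairing om y v) with (minus (h 1) (h 0)).
2:{ unfold h. rewrite segment_end. unfold minus, plus, opp; simpl. ring. }
apply (is_RInt_derive h (fun s => dderiv (1, 0) F (0, s))).
- rewrite Rmin_left, Rmax_right by lra. intros s Hs.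
  assert (Vs : V (segment c y s)) by now apply Hst.
  assert (Ws : W (0, s)) by now apply W0.
  assert (Dq : forall i, dderiv (1, 0) (q i) (0, s) = s * coord i v).
  { intros i. apply dderiv_unique.
    apply (is_derive_ext (fun r : R => coord i c + s * (coord i y + r * coord i v - coord i c))).
    - intros r. rewrite plane_line. unfold q; simpl. Req; ring.
    - auto_derive; [easy|ring]. }
  assert (Dw : forall i, dderiv (1, 0) (w i) (0, s) = coord i v).
  { intros i. apply dderiv_unique.
    apply (is_derive_ext (fun r : R => coord i y + r * coord i v - coord i c)).
    - intros r. rewrite plane_line. unfold w; simpl. Req; ring.
    - auto_derive; [easy|ring]. }
  assert (Do : forall i, dderiv (1, 0) (fun z => om i (q I1 z, q I2 z, q I3 z)) (0, s)
     = sum3 (fun j => s * coord j v * partial j (om i) (segment c y s))).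
  { intros i. rewrite (dderiv_comp_pt W V); auto; [|apply Hom].
    rewrite !Dq. change (q I1 (0, s), q I2 (0, s), q I3 (0, s)) with (Q (0, s)). now rewrite Q0. }
  assert (DF : dderiv (1, 0) F (0, s) = sum3 (fun i =>
     sum3 (fun j => s * coord j v * partial j (om i) (segment c y s)) * (coord i y - coord i c)
     + om i (segment c y s) * coord i v)).
  { rewrite (dderiv_ext W F (fun z => sum3 (fun i => om i (q I1 z, q I2 z, q I3 z) * w i z)));
      [|exact oW|exact Ws|intros; apply EF].
    unfold sum3 at 1.
    assert (sm : forall i, smooth_on W (fun z => om i (q I1 z, q I2 z, q I3 z) * w i z))
      by (intros i; apply smooth_mult; auto).
    rewrite (dderiv_plus_on W (fun z => om I1 (q I1 z, q I2 z, q I3 z) * w I1 z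
       + om I2 (q I1 z, q I2 z, q I3 z) * w I2 z)) by auto using smooth_plus.
    rewrite (dderiv_plus_on W) by auto.
    rewrite !(dderiv_mult_on W) by auto. rewrite !Do, !Dw.
    change (q I1 (0, s), q I2 (0, s), q I3 (0, s)) with (Q (0, s)). rewrite Q0.
    unfold w, sum3; simpl fst. ring. }
  rewrite DF.
  assert (Dom : forall i, is_derive (fun r : R => om i (segment c y r)) s
     (sum3 (fun j => (coord j y - coord j c) * partial j (om i) (segment c y s)))).
  { intros i. evar_last.
    - apply (is_derive_line_at 0 V); [apply Hom|reflexivity|exact Vs].
    - rewrite (pairing_line V); auto. unfold sum3. now rewrite !minus_coord. }
  pose proof (is_derive_Rmult (fun r => r) _ s 1 _ (is_derive_id (K := R_AbsRing) s)
    (is_derive_Rplus _ _ s _ _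
      (is_derive_Rplus _ _ s _ _ (is_derive_Rscal_r _ s _ (coord I1 v) (Dom I1))
        (is_derive_Rscal_r _ s _ (coord I2 v) (Dom I2)))
      (is_derive_Rscal_r _ s _ (coord I3 v) (Dom I3)))) as Dh.
  cbv beta in Dh.
  match type of Dh with is_derive _ _ ?d => replace (sum3 _) with d; [exact Dh|] end.
  unfold sum3.
  (* Closedness exchanges the two indices and identifies the variation of the integrand with the
     derivative of [h]. *)
  rewrite (Hcl I2 I1), (Hcl I3 I1), (Hcl I3 I2) by exact Vs. ring.
- rewrite Rmin_left, Rmax_right by lra. intros s Hs.
  apply (continuous_slice W); [now apply smooth_dderiv|now apply W0].
Qed.

Lemma segment_integral_primitive (V : pt -> Prop) (om : ix -> pt -> R) (P : pt -> R) (x y : pt) :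
  open V -> (forall i, smooth_on V (om i)) -> primitive_on V om P ->
  (forall s, 0 <= s <= 1 -> V (segment x y s)) ->
  segment_integral om x y = P y - P x.
Proof.
intros oV Hom HP Hs. apply is_RInt_unique.
replace (P y - P x) with (minus (P (segment x y 1)) (P (segment x y 0)))
  by now rewrite segment_start, segment_end.
apply (is_RInt_derive (fun s => P (segment x y s))); rewrite Rmin_left, Rmax_right by lra; intros s H01.
- specialize (HP (segment x y s) (minus y x) (Hs s H01)).
  apply (is_derive_ext (fun t : R => P (plus (segment x y s) (scal (t - s) (minus y x))))).
  + intros t. f_equal. apply pt_eq; intros i. rewrite line_coord, !segment_coord, minus_coord. Req; ring.
  + evar_last.
    * apply (is_derive_comp (fun r : R => P (plus (segment x y s) (scal r (minus y x)))) (fun t => t - s)).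
      -- rewrite Rminus_diag. exact HP.
      -- auto_derive; [easy|reflexivity].
    * apply (scal_one (pairing om (segment x y s) (minus y x))).
- unfold pairing, sum3.
  assert (H : forall i, continuous (fun t => om i (segment x y t) * coord i (minus y x)) s).
  { intros i. apply continuous_Rmult; [|apply continuous_const].
    apply (continuous_comp (segment x y) (om i)); [apply continuous_segment|].
    apply (smooth_continuous V); auto. }
  apply continuous_Rplus; [apply continuous_Rplus|]; apply H.
Qed.

(** * Monodromy and primitives on simply connected sets *)

(** Balls of the product uniform structure are open cubes; convexity and openness are therefore
    checked on each coordinate. *)
Lemma ball_coord (x y : pt) (e : R) :
  ball x e y <-> forall i, Rabs (coord i y - coord i x) < e.
Proof.
destruct x as [[x1 x2] x3], y as [[y1 y2] y3]. split.
- intros [[H1 H2] H3] []; assumption.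
- intros H. repeat split; [exact (H I1)|exact (H I2)|exact (H I3)].
Qed.

Lemma open_abs_lt (a e : R) : open (fun t : R => Rabs (t - a) < e).
Proof.
intros t Ht. assert (Hp : 0 < e - Rabs (t - a)) by lra. exists (mkposreal _ Hp).
intros u Bu. change (Rabs (u - t) < e - Rabs (t - a)) in Bu.
replace (u - a) with ((u - t) + (t - a)) by ring.
apply (Rle_lt_trans _ _ _ (Rabs_triang _ _)). lra.
Qed.

Lemma open_ball_pt (x : pt) (e : R) : open (fun y : pt => ball x e y).
Proof.
apply (open_ext (fun y : pt => Rabs (coord I1 y - coord I1 x) < e /\
  (Rabs (coord I2 y - coord I2 x) < e /\ Rabs (coord I3 y - coord I3 x) < e))).
{ intros y. rewrite ball_coord. split; [intros (H1 & H2 & H3) []; assumption|auto]. }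
assert (H : forall i, open (fun y : pt => Rabs (coord i y - coord i x) < e)).
{ intros i. apply (open_comp (coord i) (fun t => Rabs (t - coord i x) < e)).
  - intros y _. apply continuous_coord.
  - apply open_abs_lt. }
repeat apply open_and; apply H.
Qed.

Lemma abs_segment (a b c e s : R) :
  Rabs (b - a) < e -> Rabs (c - a) < e -> 0 <= s <= 1 -> Rabs (b + s * (c - b) - a) < e.
Proof.
intros Hb Hc Hs. apply Rabs_def2 in Hb, Hc.
assert (Hpos : forall p q, 0 < p -> 0 < q -> 0 < (1 - s) * p + s * q).
{ intros p q Hp Hq. destruct (Rle_dec s (1/2)); nra. }
pose proof (Hpos (e - (b - a)) (e - (c - a)) ltac:(lra) ltac:(lra)).
pose proof (Hpos (e + (b - a)) (e + (c - a)) ltac:(lra) ltac:(lra)).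
apply Rabs_def1; lra.
Qed.

Lemma ball_convex (x y z : pt) (e s : R) :
  ball x e y -> ball x e z -> 0 <= s <= 1 -> ball x e (segment y z s).
Proof.
rewrite !ball_coord. intros Hy Hz Hs i. rewrite segment_coord. now apply abs_segment.
Qed.

Section LocalPotential.
Context (M : pt -> Prop) (om : ix -> pt -> R).
Hypothesis (oM : open M) (Hom : forall i, smooth_on M (om i)) (Hcl : closed_form_on M om).

Definition ball_inside (x : pt) (e : R) : Prop := 0 < e /\ forall y, ball x e y -> M y.

Lemma ball_inside_exists x : M x -> exists e, ball_inside x e.
Proof. intros Mx. destruct (oM x Mx) as [e He]. exists e. split; [apply cond_pos|exact He]. Qed.

Lemma ball_primitive x e : ball_inside x e ->
  primitive_on (fun y => ball x e y) om (segment_integral om x).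
Proof.
intros [He Hin]. apply primitive_starshaped.
- apply open_ball_pt.
- intros i. now apply (smooth_subset M).
- intros i j y By. apply Hcl, Hin, By.
- intros y s By Hs. apply ball_convex; auto. apply (ball_center x (mkposreal e He)).
Qed.

(** Inside a cube contained in [M] segment integrals are differences of one function, hence additive
    along broken lines. This is the only form in which closedness enters the monodromy argument. *)
Lemma local_potential x e : ball_inside x e ->
  exists P : pt -> R, forall y z, ball x e y -> ball x e z -> segment_integral om y z = P z - P y.
Proof.
intros HB. exists (segment_integral om x). intros y z By Bz.
apply (segment_integral_primitive (fun y => ball x e y)).
- apply open_ball_pt.
- intros i. apply (smooth_subset M); [apply HB|apply Hom].
- now apply ball_primitive.
- intros s Hs. now apply ball_convex.
Qed.

Lemma segment_integral_refl x : M x -> segment_integral om x x = 0.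
Proof.
intros Mx. destruct (ball_inside_exists x Mx) as [e HB].
destruct (local_potential x e HB) as [P HP].
assert (Bx : ball x e x) by exact (ball_center x (mkposreal e (proj1 HB))).
rewrite (HP x x Bx Bx). ring.
Qed.

End LocalPotential.

(** * Connectedness of intervals and gluing of paths *)

Lemma clamp_lipschitz (a b s t : R) :
  a <= b -> Rabs (Rmax a (Rmin t b) - Rmax a (Rmin s b)) <= Rabs (t - s).
Proof.
intros ab. unfold Rmax, Rmin; repeat destruct Rle_dec; unfold Rabs; repeat destruct Rcase_abs; lra.
Qed.

Lemma clamp_in (a b s : R) : a <= b -> a <= Rmax a (Rmin s b) <= b.
Proof. intros ab. unfold Rmax, Rmin; repeat destruct Rle_dec; lra. Qed.

(** Composition with the 1-Lipschitz clamp onto the interval extends [f] to a function on the line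
    whose derivative vanishes everywhere. *)
Lemma locally_constant (f : R -> R) (a b : R) : a <= b ->
  (forall s, a <= s <= b -> exists d, 0 < d /\ forall s', a <= s' <= b -> Rabs (s' - s) < d -> f s' = f s) ->
  f b = f a.
Proof.
intros ab Hf.
set (g := fun s => f (Rmax a (Rmin s b))).
assert (Hg : forall s, is_derive g s 0).
{ intros s. destruct (Hf _ (clamp_in a b s ab)) as (d & Hd & Hc).
  apply (is_derive_ext_loc (fun _ => f (Rmax a (Rmin s b)))); [|exact (is_derive_const (V := R_NormedModule) _ s)].
  exists (mkposreal d Hd). intros t Bt. change (Rabs (t - s) < d) in Bt.
  symmetry. apply Hc; [now apply clamp_in|]. pose proof (clamp_lipschitz a b s t ab). lra. }
destruct (mean_value g (fun _ => 0) a b (fun t _ => Hg t)) as (c & _ & e).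
unfold g in e. rewrite (Rmin_left b b), (Rmin_left a b), (Rmax_right a b), (Rmax_left a a) in e by lra.
lra.
Qed.

(** The set [A] is relatively open and closed in [M], so its indicator along a path from [x0] is
    locally constant. *)
Lemma path_connected_ind (M A : pt -> Prop) (x0 : pt) :
  (forall x, M x -> exists gamma : R -> pt, path_in M gamma /\ gamma 0 = x0 /\ gamma 1 = x) ->
  (forall x, M x -> exists e, 0 < e /\ forall y, M y -> ball x e y -> (A x <-> A y)) ->
  A x0 -> forall x, M x -> A x.
Proof.
intros Hpath Hloc A0 x Mx. destruct (Hpath x Mx) as (gamma & [cg ig] & g0 & g1).
set (f := fun s => if excluded_middle_informative (A (gamma s)) then 1 else 0).
assert (Hf : f 1 = f 0).
{ apply locally_constant; [lra|]. intros s Hs. destruct (Hloc _ (ig s Hs)) as (e & He & HA).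
  destruct (proj1 (filterlim_locally gamma (gamma s)) (cg s) (mkposreal e He)) as [d Hd].
  exists d; split; [apply cond_pos|]. intros s' Hs' Bs'.
  specialize (HA (gamma s') (ig s' Hs') (Hd s' Bs')). unfold f.
  destruct (excluded_middle_informative (A (gamma s'))), (excluded_middle_informative (A (gamma s))); tauto. }
unfold f in Hf. rewrite g0, g1 in Hf.
destruct (excluded_middle_informative (A x)); [easy|].
destruct (excluded_middle_informative (A x0)); [lra|tauto].
Qed.

Definition glue {T : Type} (m : R) (f h : R -> T) (s : R) : T := if Rle_dec s m then f s else h s.

Lemma glue_continuous {T : UniformSpace} (m : R) (f h : R -> T) :
  (forall s, continuous f s) -> (forall s, continuous h s) -> f m = h m ->
  forall s, continuous (glue m f h) s.
Proof.
intros cf ch e s. unfold glue. destruct (Rtotal_order s m) as [H|[H|H]].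
- apply (continuous_ext_loc _ f); [|apply cf].
  apply (filter_imp (fun t => t < m)); [|now apply open_lt].
  intros t Ht. destruct (Rle_dec t m); [easy|lra].
- subst m. intros P HP. destruct (Rle_dec s s) as [_|]; [|lra].
  pose proof (cf s P HP) as H1. rewrite e in HP. pose proof (ch s P HP) as H2.
  destruct H1 as [d1 H1], H2 as [d2 H2].
  exists (mkposreal _ (Rmin_pos d1 d2 (cond_pos d1) (cond_pos d2))). intros t Bt.
  change (Rabs (t - s) < Rmin d1 d2) in Bt.
  destruct (Rle_dec t s); [apply H1|apply H2]; eapply Rlt_le_trans; [exact Bt| |exact Bt|];
    [apply Rmin_l|apply Rmin_r].
- apply (continuous_ext_loc _ h); [|apply ch].
  apply (filter_imp (fun t => m < t)); [|now apply open_gt].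
  intros t Ht. destruct (Rle_dec t m); [lra|easy].
Qed.

Section Monodromy.
Context (M : pt -> Prop) (om : ix -> pt -> R).
Hypothesis (oM : open M) (Hom : forall i, smooth_on M (om i)) (Hcl : closed_form_on M om).

(** [phi] is a primitive of the form along [gamma]: near each parameter its increments are integrals
    over straight segments between points of the path. This makes sense for a path that is only
    continuous. *)
Definition along (a b : R) (gamma : R -> pt) (phi : R -> R) : Prop :=
  forall s, a <= s <= b -> exists d, 0 < d /\ forall s', a <= s' <= b -> Rabs (s' - s) < d ->
    phi s' - phi s = segment_integral om (gamma s) (gamma s').

(** With a potential [P] of the cube, [phi - P (gamma _)] is locally constant. *)
Lemma along_in_ball c e a b gamma phi : a <= b -> ball_inside M c e ->
  (forall s, a <= s <= b -> ball c e (gamma s)) -> along a b gamma phi ->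
  phi b - phi a = segment_integral om (gamma a) (gamma b).
Proof.
intros ab HB Hg Hal. destruct (local_potential M om Hom Hcl c e HB) as [P HP].
rewrite (HP _ _ (Hg a ltac:(lra)) (Hg b ltac:(lra))).
assert (H : phi b - P (gamma b) = phi a - P (gamma a)); [|lra].
apply (locally_constant (fun s => phi s - P (gamma s)) a b ab). intros s Hs.
destruct (Hal s Hs) as (d & Hd & H). exists d. split; [exact Hd|]. intros s' Hs' Bs'.
specialize (H s' Hs' Bs'). rewrite (HP _ _ (Hg s Hs) (Hg s' Hs')) in H. lra.
Qed.

Lemma along_sub a b a' b' gamma phi : a <= a' -> b' <= b -> along a b gamma phi -> along a' b' gamma phi.
Proof.
intros Ha Hb H s Hs. destruct (H s ltac:(lra)) as (d & Hd & Hc). exists d. split; [exact Hd|].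
intros s' Hs'. apply Hc; lra.
Qed.

Lemma along_glue a m b g1 f1 g2 f2 : g1 m = g2 m -> f1 m = f2 m ->
  along a m g1 f1 -> along m b g2 f2 -> along a b (glue m g1 g2) (glue m f1 f2).
Proof.
intros eg ef H1 H2 s Hs. unfold glue. destruct (Rtotal_order s m) as [H|[H|H]].
- destruct (H1 s ltac:(lra)) as (d & Hd & Hc). exists (Rmin d (m - s)).
  split; [apply Rmin_pos; lra|]. intros s' Hs' Bs'.
  pose proof (Rmin_l d (m - s)). pose proof (Rmin_r d (m - s)).
  assert (s' < m) by (apply Rabs_def2 in Bs'; lra).
  destruct (Rle_dec s' m); [|lra]. destruct (Rle_dec s m); [|lra]. apply Hc; lra.
- subst s. destruct (H1 m ltac:(lra)) as (d & Hd & Hc). destruct (H2 m ltac:(lra)) as (d' & Hd' & Hc').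
  exists (Rmin d d'). split; [now apply Rmin_pos|]. intros s' Hs' Bs'.
  pose proof (Rmin_l d d'). pose proof (Rmin_r d d').
  destruct (Rle_dec m m); [|lra]. destruct (Rle_dec s' m); [apply Hc; lra|].
  rewrite eg, ef. apply Hc'; lra.
- destruct (H2 s ltac:(lra)) as (d & Hd & Hc). exists (Rmin d (s - m)).
  split; [apply Rmin_pos; lra|]. intros s' Hs' Bs'.
  pose proof (Rmin_l d (s - m)). pose proof (Rmin_r d (s - m)).
  assert (m < s') by (apply Rabs_def2 in Bs'; lra).
  destruct (Rle_dec s' m); [lra|]. destruct (Rle_dec s m); [lra|]. apply Hc; lra.
Qed.

(** The condition in [along] is two-sided in the parameter, so [k] may be negative, which reverses
    the path. The shift [w] makes the values of two pieces agree where they are glued. *)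
Lemma along_affine a b (k l w : R) gamma phi : k <> 0 ->
  (forall s, a <= s <= b -> 0 <= k * s + l <= 1) -> along 0 1 gamma phi ->
  along a b (fun s => gamma (k * s + l)) (fun s => phi (k * s + l) + w).
Proof.
intros Hk Hin H s Hs. destruct (H _ (Hin s Hs)) as (d & Hd & Hc).
assert (kp : 0 < Rabs k) by now apply Rabs_pos_lt.
exists (d / Rabs k). split; [now apply Rdiv_lt_0_compat|]. intros s' Hs' Bs'.
rewrite <- (Hc _ (Hin s' Hs')); [ring|].
replace (k * s' + l - (k * s + l)) with (k * (s' - s)) by ring. rewrite Rabs_mult.
apply (Rmult_lt_compat_l _ _ _ kp) in Bs'.
replace (Rabs k * (d / Rabs k)) with d in Bs' by (field; lra). exact Bs'.
Qed.

Fixpoint psum (f : nat -> R) (n : nat) : R := match n with O => 0 | S m => psum f m + f m end.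

(** The number [d] is a Lebesgue number for the cover of the square by preimages of cubes contained
    in [M]. *)
Lemma square_mesh (H : R * R -> pt) :
  (forall z, continuous H z) ->
  (forall a s, unit_interval a -> unit_interval s -> M (H (a, s))) ->
  exists d, 0 < d /\ forall a s, unit_interval a -> unit_interval s ->
    exists c e, ball_inside M c e /\
      forall a' s', Rabs (a' - a) < d -> Rabs (s' - s) < d -> ball c e (H (a', s')).
Proof.
intros cH iH.
set (good := fun a s (d : R) => exists c e, ball_inside M c e /\
      forall a' s', Rabs (a' - a) < d -> Rabs (s' - s) < d -> ball c e (H (a', s'))).
(* The factor 2 leaves room: a point within [d] of [(a, s)], which is itself within the radius of a
   chosen centre, is within twice that radius of the centre. *)
assert (Hgood : forall a s, exists d : posreal, unit_interval a -> unit_interval s -> good a s (2 * d)).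
{ intros a s. destruct (classic (unit_interval a /\ unit_interval s)) as [[Ha Hs]|Hn].
  - destruct (ball_inside_exists M oM _ (iH a s Ha Hs)) as [e He].
    destruct (proj1 (filterlim_locally H (H (a, s))) (cH (a, s)) (mkposreal e (proj1 He))) as [d Hd].
    assert (Hd2 : 0 < d / 2) by (pose proof (cond_pos d); lra).
    exists (mkposreal _ Hd2). intros _ _. exists (H (a, s)), e. split; [exact He|].
    simpl. intros a' s' Ba Bs. apply Hd. replace (2 * (d / 2)) with (d : R) in * by field. now split.
  (* An arbitrary radius outside the square, where nothing is claimed; [delta] must be total. *)
  - exists (mkposreal 1 Rlt_0_1). tauto. }
set (delta := fun a s => proj1_sig (constructive_indefinite_description _ (Hgood a s))).
destruct (compactness_value_2d 0 1 0 1 delta) as [d Hd].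
exists d. split; [apply cond_pos|]. intros a s Ha Hs.
(* [compactness_value_2d] provides the centre only under a double negation. *)
apply NNPP. intros Hno. apply (Hd a s Ha Hs). intros (u & v & Hu & Hv & Bu & Bv & Le).
apply Hno. unfold delta in Bu, Bv, Le.
destruct (constructive_indefinite_description _ (Hgood u v)) as [r Hr]; simpl in Bu, Bv, Le.
destruct (Hr Hu Hv) as (c & e & HB & Hin). exists c, e. split; [exact HB|].
intros a' s' Ba Bs. apply Hin.
- replace (a' - u) with ((a' - a) + (a - u)) by ring. eapply Rle_lt_trans; [apply Rabs_triang|]. lra.
- replace (s' - v) with ((s' - s) + (s - v)) by ring. eapply Rle_lt_trans; [apply Rabs_triang|]. lra.
Qed.

(* Subdivide the square so finely that the homotopy maps each cell into a ball, on which the form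
   has a primitive; the sums over two successive grid rows then agree. *)
Lemma contractible_loop (gamma : R -> pt) (phi : R -> R) (H : R * R -> pt) :
  (forall z, continuous H z) ->
  (forall a s, unit_interval a -> unit_interval s -> M (H (a, s))) ->
  (forall s, unit_interval s -> H (0, s) = gamma s /\ H (1, s) = gamma 0) ->
  (forall a, unit_interval a -> H (a, 0) = gamma 0 /\ H (a, 1) = gamma 0) ->
  along 0 1 gamma phi -> phi 1 = phi 0.
Proof.
intros cH iH Hs Ha Hal.
destruct (square_mesh H cH iH) as (d & Hd & Hmesh).
destruct (archimed_cor1 d Hd) as (N & HN & Npos).
assert (NR : 0 < INR N) by now apply lt_0_INR.
set (t := fun n => INR n / INR N).
assert (t0 : t 0%nat = 0) by (unfold t; simpl; field; lra).
assert (tN : t N = 1) by (unfold t; field; lra).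
assert (tS : forall n, t (S n) = t n + / INR N) by (intros n; unfold t; rewrite S_INR; field; lra).
assert (Ninv : 0 < / INR N) by now apply Rinv_0_lt_compat.
assert (tI : forall n, (n <= N)%nat -> unit_interval (t n)).
{ intros n Hn. apply le_INR in Hn. unfold unit_interval, t. split.
  - apply Rmult_le_pos; [apply pos_INR|lra].
  - apply (Rmult_le_reg_r (INR N)); [lra|]. unfold Rdiv. rewrite Rmult_assoc, Rinv_l; lra. }
set (z := fun i j => H (t i, t j)).
set (J := segment_integral om).
assert (cell : forall i j, (i < N)%nat -> (j < N)%nat ->
   exists P : pt -> R, forall a s a' s', t i <= a <= t (S i) -> t j <= s <= t (S j) ->
     t i <= a' <= t (S i) -> t j <= s' <= t (S j) -> J (H (a, s)) (H (a', s')) = P (H (a', s')) - P (H (a, s))).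
{ intros i j Hi Hj. destruct (Hmesh (t i) (t j)) as (c & e & HB & Hin); try (apply tI; lia).
  destruct (local_potential M om Hom Hcl c e HB) as [P HP]. exists P.
  rewrite !tS. intros a s a' s' h1 h2 h3 h4.
  apply HP; apply Hin; apply Rabs_def1; lra. }
assert (base : M (gamma 0)).
{ rewrite <- (proj1 (Ha 0 ltac:(unfold unit_interval; lra))). apply iH; unfold unit_interval; lra. }
assert (refl0 : J (gamma 0) (gamma 0) = 0) by exact (segment_integral_refl M om oM Hom Hcl _ base).
assert (zl : forall i, (i <= N)%nat -> z i 0%nat = gamma 0).
{ intros i Hi. unfold z. rewrite t0. now apply Ha, tI. }
assert (zr : forall i, (i <= N)%nat -> z i N = gamma 0).
{ intros i Hi. unfold z. rewrite tN. now apply Ha, tI. }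
assert (zt : forall j, (j <= N)%nat -> z N j = gamma 0).
{ intros i Hi. unfold z. rewrite tN. now apply Hs, tI. }
assert (zb : forall j, (j <= N)%nat -> z 0%nat j = gamma (t j)).
{ intros i Hi. unfold z. rewrite t0. now apply Hs, tI. }
(* In each cell both ways from the lower left to the upper right corner have the same integral, so
   passing to the next row costs one vertical edge at the current column. The edges at the left and
   right ends are trivial since the homotopy fixes the base point. *)
assert (row : forall i n, (i < N)%nat -> (n <= N)%nat ->
  psum (fun j => J (z i j) (z i (S j))) n + J (z i n) (z (S i) n)
  = psum (fun j => J (z (S i) j) (z (S i) (S j))) n).
{ intros i n Hi. induction n as [|n IH]; intros Hn.
  - simpl. rewrite !zl by lia. rewrite refl0. ring.
  - simpl. rewrite <- IH by lia. destruct (cell i n Hi ltac:(lia)) as [P HP].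
    unfold z. pose proof (tS i). pose proof (tS n).
    rewrite !HP by lra. ring. }
assert (rows : forall i, (i <= N)%nat ->
  psum (fun j => J (z 0%nat j) (z 0%nat (S j))) N = psum (fun j => J (z i j) (z i (S j))) N).
{ intros i. induction i as [|i IH]; intros Hi; [easy|]. rewrite (IH ltac:(lia)).
  rewrite <- (row i N) by lia. rewrite !zr by lia. rewrite refl0. ring. }
assert (last : forall n, (n <= N)%nat -> psum (fun j => J (z N j) (z N (S j))) n = 0).
{ intros n. induction n as [|n IH]; intros Hn; [easy|]. simpl. rewrite IH by lia.
  rewrite !zt by lia. rewrite refl0. ring. }
(* The bottom row is the loop itself, where the segment integrals are the increments of [phi]. *)
assert (first : forall n, (n <= N)%nat -> psum (fun j => J (z 0%nat j) (z 0%nat (S j))) n = phi (t n) - phi 0).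
{ intros n. induction n as [|n IH]; intros Hn; [simpl; rewrite t0; ring|].
  simpl. rewrite IH by lia. rewrite !zb by lia.
  pose proof (tS n). pose proof (tI n ltac:(lia)) as [In0 In1]. pose proof (tI (S n) Hn) as [Jn0 Jn1].
  destruct (Hmesh 0 (t n)) as (c & e & HB & Hin); [unfold unit_interval; lra|apply tI; lia|].
  unfold J. rewrite <- (along_in_ball c e (t n) (t (S n)) gamma phi); [ring|lra|exact HB| |].
  - intros s Hts. rewrite <- (proj1 (Hs s ltac:(unfold unit_interval; lra))).
    apply Hin; apply Rabs_def1; lra.
  - apply (along_sub 0 1); [lra|lra|exact Hal]. }
specialize (first N (le_n N)). rewrite (rows N (le_n N)), (last N (le_n N)), tN in first. lra.
Qed.

Hypothesis (hM : simply_connected M).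
Context (x0 : pt).
Hypothesis (Mx0 : M x0).

(** The candidates for the value at [x] of the primitive that vanishes at [x0]. *)
Definition reaches (x : pt) (c : R) : Prop :=
  exists gamma phi, path_in M gamma /\ gamma 0 = x0 /\ gamma 1 = x /\ phi 0 = 0 /\ phi 1 = c /\
    along 0 1 gamma phi.

Lemma continuous_affine {T : UniformSpace} (f : R -> T) (k l : R) :
  (forall s, continuous f s) -> forall s, continuous (fun s : R => f (k * s + l)) s.
Proof.
intros cf s. apply (continuous_comp (fun s : R => k * s + l) f); [|apply cf].
apply (ex_derive_continuous (fun s : R => k * s + l)). auto_derive; easy.
Qed.

(** Follow the first path forwards and the second one backwards. The result is a loop at [x0], and
    the total increment along it is the difference of the two values. *)
Lemma reaches_unique x c c' : reaches x c -> reaches x c' -> c = c'.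
Proof.
intros (g & f & [cg ig] & g0 & g1 & f0 & f1 & al) (g' & f' & [cg' ig'] & g0' & g1' & f0' & f1' & al').
set (G := glue (1/2) (fun s => g (2 * s + 0)) (fun s => g' ((-2) * s + 2))).
(* The shift [c - c'] makes both halves equal to [c] at the junction; the value at the end is then
   [c - c'], against 0 at the start. *)
set (F := glue (1/2) (fun s => f (2 * s + 0) + 0) (fun s => f' ((-2) * s + 2) + (c - c'))).
assert (h1 : 2 * (1/2) + 0 = 1) by field. assert (h2 : -2 * (1/2) + 2 = 1) by field.
assert (alG : along 0 1 G F).
{ apply along_glue.
  - now rewrite h1, h2, g1, g1'.
  - rewrite h1, h2, f1, f1'. ring.
  - apply along_affine; [lra| |exact al]. intros s Hs; lra.
  - apply along_affine; [lra| |exact al']. intros s Hs; lra. }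
assert (G0 : G 0 = x0).
{ unfold G, glue. destruct (Rle_dec 0 (1/2)); [|lra]. now replace (2 * 0 + 0) with 0 by ring. }
assert (G1 : G 1 = x0).
{ unfold G, glue. destruct (Rle_dec 1 (1/2)); [lra|]. now replace (-2 * 1 + 2) with 0 by ring. }
assert (HG : path_in M G).
{ split.
  - apply glue_continuous; [now apply continuous_affine|now apply continuous_affine|].
    now rewrite h1, h2, g1, g1'.
  - intros s Hs. unfold G, glue. unfold unit_interval in *.
    destruct (Rle_dec s (1/2)); [apply ig|apply ig']; unfold unit_interval; lra. }
destruct (proj2 hM G HG) as (H & cH & iH & Hs & Ha); [now rewrite G0, G1|].
pose proof (contractible_loop G F H cH iH Hs Ha alG) as e.
unfold F, glue in e. destruct (Rle_dec 1 (1/2)); [lra|]. destruct (Rle_dec 0 (1/2)); [|lra].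
replace (-2 * 1 + 2) with 0 in e by ring. replace (2 * 0 + 0) with 0 in e by ring.
rewrite f0, f0' in e. lra.
Qed.

(** Append the straight segment to the path, with the partial segment integrals as primitive along
    it. *)
Lemma reaches_extend x c e y : ball_inside M x e -> ball x e y ->
  reaches x c -> reaches y (c + segment_integral om x y).
Proof.
intros HB By (g & f & [cg ig] & g0 & g1 & f0 & f1 & al).
assert (Bx : ball x e x) by exact (ball_center x (mkposreal e (proj1 HB))).
assert (Bs : forall s, 0 <= s <= 1 -> ball x e (segment x y s)) by (intros s Hs; now apply ball_convex).
assert (h1 : 2 * (1/2) + 0 = 1) by field. assert (h2 : 2 * (1/2) + -1 = 0) by field.
assert (Mx : M x) by now apply HB.
set (h := fun s => segment_integral om x (segment x y s)).
assert (alh : along 0 1 (segment x y) h).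
{ intros s Hs. exists 1. split; [lra|]. intros s' Hs' _. unfold h.
  destruct (local_potential M om Hom Hcl x e HB) as [P HP].
  rewrite (HP x _ Bx (Bs s Hs)), (HP x _ Bx (Bs s' Hs')), (HP _ _ (Bs s Hs) (Bs s' Hs')). ring. }
exists (glue (1/2) (fun s => g (2 * s + 0)) (fun s => segment x y (2 * s + -1))).
exists (glue (1/2) (fun s => f (2 * s + 0) + 0) (fun s => h (2 * s + -1) + c)).
assert (eg : g (2 * (1 / 2) + 0) = segment x y (2 * (1/2) + -1)) by now rewrite h1, h2, g1, segment_start.
repeat split.
- apply glue_continuous; [now apply continuous_affine| |exact eg].
  apply continuous_affine. intros s. apply continuous_segment.
- intros s Hs. unfold unit_interval in Hs. unfold glue.
  destruct (Rle_dec s (1/2)); [apply ig; unfold unit_interval; lra|]. apply HB, Bs; lra.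
- unfold glue. destruct (Rle_dec 0 (1/2)); [|lra]. now replace (2 * 0 + 0) with 0 by ring.
- unfold glue. destruct (Rle_dec 1 (1/2)); [lra|]. replace (2 * 1 + -1) with 1 by ring. apply segment_end.
- unfold glue. destruct (Rle_dec 0 (1/2)); [|lra]. replace (2 * 0 + 0) with 0 by ring. rewrite f0; ring.
- unfold glue. destruct (Rle_dec 1 (1/2)); [lra|]. replace (2 * 1 + -1) with 1 by ring.
  unfold h. rewrite segment_end. ring.
- apply along_glue; [exact eg| | |].
  + rewrite h1, h2, f1. unfold h. rewrite segment_start.
    rewrite (segment_integral_refl M om oM Hom Hcl x Mx). ring.
  + apply along_affine; [lra| |exact al]. intros s Hs; lra.
  + apply along_affine; [lra| |exact alh]. intros s Hs; lra.
Qed.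

Lemma reaches_start : reaches x0 0.
Proof.
exists (fun _ => x0), (fun _ => 0). repeat split.
- intros s. apply continuous_const.
- intros s _. exact Mx0.
- intros s Hs. exists 1. split; [lra|]. intros s' _ _.
  rewrite (segment_integral_refl M om oM Hom Hcl x0 Mx0). ring.
Qed.

(** Halving the radius makes the relation symmetric: each of the two points then has a cube inside
    [M] that contains the other, so [reaches] can be propagated both ways. *)
Lemma ball_inside_half x e y : ball_inside M x e -> ball x (e / 2) y ->
  ball x e y /\ ball_inside M y (e / 2) /\ ball y (e / 2) x.
Proof.
intros [He HB] By. assert (0 < e / 2) by lra. split; [|split; [split; [lra|]|]].
- rewrite ball_coord in *. intros i. specialize (By i). lra.
- intros z Bz. apply HB. rewrite ball_coord in *. intros i. specialize (By i). specialize (Bz i).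
  replace (coord i z - coord i x) with ((coord i z - coord i y) + (coord i y - coord i x)) by ring.
  eapply Rle_lt_trans; [apply Rabs_triang|]. lra.
- rewrite ball_coord in *. intros i. rewrite Rabs_minus_sym. apply By.
Qed.

Lemma reaches_total x : M x -> exists c, reaches x c.
Proof.
apply (path_connected_ind M (fun x => exists c, reaches x c) x0).
- intros y My. exact (proj1 hM x0 y Mx0 My).
- intros y My. destruct (ball_inside_exists M oM y My) as [e He].
  exists (e / 2). split; [destruct He; lra|]. intros w Mw Bw.
  destruct (ball_inside_half y e w He Bw) as (B1 & B2 & B3). split; intros [c Hc].
  + eexists. now apply (reaches_extend y c e w).
  + eexists. now apply (reaches_extend w c (e / 2) y).
- exists 0. apply reaches_start.
Qed.

(** The last clause expresses the primitive near any point by segment integrals. The dependence on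
    time is later read off from these, since the choice by [epsilon] says nothing about it. *)
Lemma poincare : exists p : pt -> R, p x0 = 0 /\ primitive_on M om p /\
  forall x e y, ball_inside M x e -> ball x e y -> p y = p x + segment_integral om x y.
Proof.
set (p := fun x => epsilon (inhabits 0) (reaches x)).
assert (Hp : forall x, M x -> reaches x (p x)).
{ intros x Mx. apply epsilon_spec. now apply reaches_total. }
assert (Hext : forall x e y, ball_inside M x e -> ball x e y -> p y = p x + segment_integral om x y).
{ intros x e y HB By.
  assert (Bx : ball x e x) by exact (ball_center x (mkposreal e (proj1 HB))).
  apply (reaches_unique y); [apply Hp, HB, By|].
  apply (reaches_extend x (p x) e y HB By). apply Hp, HB, Bx. }
exists p. split; [|split; [|exact Hext]].
- apply (reaches_unique x0); [now apply Hp|apply reaches_start].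
- intros x v Mx. destruct (ball_inside_exists M oM x Mx) as [e He].
  assert (Bx : ball x e x) by exact (ball_center x (mkposreal e (proj1 He))).
  apply (is_derive_ext_loc (fun s : R => p x + segment_integral om x (plus x (scal s v)))).
  + apply (filter_imp (fun s : R => ball x e (plus x (scal s v)))).
    * intros s Bs. symmetry. now apply (Hext x e).
    * apply (line_locally_0 (fun y => ball x e y) x v). apply open_ball_pt. exact Bx.
  + evar_last.
    * apply (is_derive_plus (fun _ => p x)); [apply is_derive_const|].
      exact (ball_primitive M om Hom Hcl x e He x v Bx).
    * apply (plus_zero_l (G := R_AbelianGroup)).
Qed.

End Monodromy.

(** * Primitives depending smoothly on time *)

Section Spacetime.
Context (T : R -> Prop) (M : pt -> Prop).
Hypothesis (oT : open T) (oM : open M).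

Let U (z : R * pt) : Prop := T (fst z) /\ M (snd z).

Definition time_derive (f : R -> pt -> R) (t : R) (x : pt) : R := Derive (fun s => f s x) t.

Lemma spacetime_open : open U.
Proof.
apply open_and.
- apply (open_comp (fun z : R * pt => fst z) T); [|exact oT]. intros z _. apply continuous_fst.
- apply (open_comp (fun z : R * pt => snd z) M); [|exact oM]. intros z _. apply continuous_snd.
Qed.

Lemma spacetime_line (t a : R) (x v : pt) (s : R) :
  plus ((t, x) : R * pt) (scal s ((a, v) : R * pt)) = (t + s * a, plus x (scal s v)).
Proof. reflexivity. Qed.

Lemma continuous_at_time (t : R) (x : pt) : continuous (fun y : pt => (t, y) : R * pt) x.
Proof. intros P [e He]. exists e. intros y By. apply He. split; [apply ball_center|exact By]. Qed.

Lemma spacetime_slice f t : spacetime_smooth T M f -> T t -> smooth_on M (f t).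
Proof.
intros Hf Tt k. apply (Ck_subset k (fun x : pt => U (t, x))); [now split|].
apply (Ck_affine (fun x : pt => (t, x) : R * pt) (fun v : pt => (0, v) : R * pt) k U
  (fun z => f (fst z) (snd z))); [| |apply Hf].
- intros x s v. rewrite spacetime_line. f_equal. Req; ring.
- intros x. apply continuous_at_time.
Qed.

Lemma spacetime_dderiv f t x v :
  dderiv ((0, v) : R * pt) (fun z => f (fst z) (snd z)) (t, x) = dderiv v (f t) x.
Proof.
apply Derive_ext. intros s. rewrite spacetime_line. simpl. f_equal. Req; ring.
Qed.

Lemma spacetime_is_derive f t x : spacetime_smooth T M f -> T t -> M x ->
  is_derive (fun s => f s x) t (dderiv ((1, zero) : R * pt) (fun z => f (fst z) (snd z)) (t, x)).
Proof.
intros Hf Tt Mx.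
assert (line : forall s : R, plus ((0, x) : R * pt) (scal s ((1, zero) : R * pt)) = (s, x)).
{ intros s. rewrite spacetime_line. f_equal; [ring|].
  apply pt_eq; intros i. rewrite line_coord.
  replace (coord i zero) with 0 by now destruct i. ring. }
apply (is_derive_ext (fun s : R => (fun z : R * pt => f (fst z) (snd z))
   (plus ((0, x) : R * pt) (scal s ((1, zero) : R * pt))))).
- intros s. now rewrite line.
- exact (is_derive_line_at 0 U (fun z : R * pt => f (fst z) (snd z)) (0, x) (1, zero) t (t, x)
    (Hf 1%nat) (eq_sym (line t)) (conj Tt Mx)).
Qed.

Lemma spacetime_ex_derive f t x : spacetime_smooth T M f -> T t -> M x -> ex_derive (fun s => f s x) t.
Proof. intros Hf Tt Mx. eexists. now apply spacetime_is_derive. Qed.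

Lemma spacetime_partial f i : spacetime_smooth T M f -> spacetime_smooth T M (fun t => partial i (f t)).
Proof.
intros Hf. apply (smooth_ext U (dderiv ((0, basis i) : R * pt) (fun z => f (fst z) (snd z)))).
- exact spacetime_open.
- intros [t x] _. apply spacetime_dderiv.
- apply smooth_dderiv, Hf.
Qed.

Lemma spacetime_time_derive f : spacetime_smooth T M f -> spacetime_smooth T M (time_derive f).
Proof.
intros Hf. apply (smooth_ext U (dderiv ((1, zero) : R * pt) (fun z => f (fst z) (snd z)))).
- exact spacetime_open.
- intros [t x] [Tt Mx]. symmetry. apply is_derive_unique. now apply spacetime_is_derive.
- apply smooth_dderiv, Hf.
Qed.

Lemma spacetime_ext f h : (forall t x, T t -> M x -> f t x = h t x) ->
  spacetime_smooth T M f -> spacetime_smooth T M h.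
Proof.
intros e. apply smooth_ext; [exact spacetime_open|]. intros [t x] [Tt Mx]. now apply e.
Qed.

Lemma spacetime_comm f i t x : spacetime_smooth T M f -> T t -> M x ->
  Derive (fun s => partial i (f s) x) t = partial i (time_derive f t) x.
Proof.
intros Hf Tt Mx.
pose proof (smooth_comm U (fun z => f (fst z) (snd z)) (1, zero) (0, basis i) (t, x)
  spacetime_open Hf (conj Tt Mx)) as H.
pose proof (spacetime_is_derive _ t x (spacetime_partial f i Hf) Tt Mx) as D1.
apply is_derive_unique in D1.
etransitivity; [exact D1|]. etransitivity; [|etransitivity; [exact H|]].
- apply (dderiv_ext U); [exact spacetime_open|now split|].
  intros [t' x'] _. symmetry. apply spacetime_dderiv.
- etransitivity; [|apply (spacetime_dderiv (time_derive f))].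
  apply (dderiv_ext U); [exact spacetime_open|now split|].
  intros [t' x'] [Tt' Mx']. symmetry. apply is_derive_unique. now apply spacetime_is_derive.
Qed.

Lemma spacetime_plus f h : spacetime_smooth T M f -> spacetime_smooth T M h ->
  spacetime_smooth T M (fun t x => f t x + h t x).
Proof. apply smooth_plus, spacetime_open. Qed.

Lemma spacetime_minus f h : spacetime_smooth T M f -> spacetime_smooth T M h ->
  spacetime_smooth T M (fun t x => f t x - h t x).
Proof. apply smooth_minus, spacetime_open. Qed.

Lemma spacetime_mult f h : spacetime_smooth T M f -> spacetime_smooth T M h ->
  spacetime_smooth T M (fun t x => f t x * h t x).
Proof. apply smooth_mult, spacetime_open. Qed.

Lemma spacetime_opp f : spacetime_smooth T M f -> spacetime_smooth T M (fun t x => - f t x).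
Proof. apply smooth_opp, spacetime_open. Qed.

Lemma spacetime_stationary h : smooth_on M h -> spacetime_smooth T M (fun _ => h).
Proof.
intros Hh k. apply (Ck_subset k (fun z : R * pt => M (snd z))); [now intros z []|].
apply (Ck_affine (fun z : R * pt => snd z) (fun v : R * pt => snd v) k M h); [| |apply Hh].
- now intros [t x] s [a v].
- intros z P [e He]. exists e. intros y [_ By]. now apply He.
Qed.

Lemma spacetime_sum3 (F : ix -> R -> pt -> R) : (forall i, spacetime_smooth T M (F i)) ->
  spacetime_smooth T M (fun t x => sum3 (fun i => F i t x)).
Proof. intros H. unfold sum3. repeat apply spacetime_plus; apply H. Qed.

Section Primitive.
Hypothesis (hM : simply_connected M).
Context (x0 : pt).
Hypothesis (Mx0 : M x0).

Let slice (om : ix -> R -> pt -> R) (t : R) : ix -> pt -> R := fun i => om i t.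

(** The primitives at different times are chosen independently. The value 0 at [x0] removes the free
    additive constant, which could otherwise vary with time in an arbitrary way. *)
Let normalized_primitive (om : ix -> R -> pt -> R) (p : R -> pt -> R) : Prop :=
  forall t, T t -> p t x0 = 0 /\ primitive_on M (slice om t) (p t) /\
    forall x e y, ball_inside M x e -> ball x e y ->
      p t y = p t x + segment_integral (slice om t) x y.

Lemma normalized_primitive_exists om :
  (forall i, spacetime_smooth T M (om i)) -> (forall t, T t -> closed_form_on M (slice om t)) ->
  exists p, normalized_primitive om p.
Proof.
intros Hom Hcl.
set (Q := fun t p => p x0 = 0 /\ primitive_on M (slice om t) p /\
    forall x e y, ball_inside M x e -> ball x e y -> p y = p x + segment_integral (slice om t) x y).
exists (fun t => epsilon (inhabits (fun _ : pt => 0)) (Q t)). intros t Tt.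
apply (epsilon_spec (inhabits (fun _ : pt => 0)) (Q t)).
destruct (poincare M (slice om t) oM (fun i => spacetime_slice _ _ (Hom i) Tt) (Hcl t Tt) hM x0 Mx0)
  as (p & H). now exists p.
Qed.

Lemma segment_integral_time om x e y t :
  (forall i, spacetime_smooth T M (om i)) -> ball_inside M x e -> ball x e y -> T t ->
  is_derive (fun s => segment_integral (slice om s) x y) t
    (segment_integral (slice (fun i => time_derive (om i)) t) x y).
Proof.
intros Hom HB By Tt.
assert (Bx : ball x e x) by exact (ball_center x (mkposreal e (proj1 HB))).
set (A := fun z : R * R => (fst z, segment x y (snd z)) : R * pt).
set (W := fun z => U (A z)).
assert (cA : forall z, continuous A z).
{ intros z. apply continuous_pair; [apply continuous_fst|].
  apply (continuous_comp (fun z : R * R => snd z) (segment x y)); [apply continuous_snd|apply continuous_segment]. }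
assert (oW : open W) by (apply (open_comp A U); [intros z _; apply cA|exact spacetime_open]).
assert (sm : forall h, spacetime_smooth T M h -> smooth_on W (fun z => h (fst z) (segment x y (snd z)))).
{ intros h Hh k. apply (Ck_affine A (fun v : R * R => (fst v, scal (snd v) (minus y x)) : R * pt) k U
    (fun z => h (fst z) (snd z))); [|exact cA|apply Hh].
  intros [a b] s [v w]. unfold A. rewrite plane_line, spacetime_line. simpl. f_equal.
  apply pt_eq; intros i. rewrite line_coord, !segment_coord.
  replace (coord i (scal w (minus y x))) with (w * (coord i y - coord i x)).
  - Req; ring.
  - rewrite <- minus_coord. destruct i, (minus y x) as [[? ?] ?]; reflexivity. }
set (F := fun z : R * R => pairing (slice om (fst z)) (segment x y (snd z)) (minus y x)).
assert (sF : smooth_on W F).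
{ unfold F, pairing, sum3, slice.
  repeat apply smooth_plus; try exact oW; (apply smooth_mult; [exact oW| |apply smooth_const]); apply sm, Hom. }
assert (HW : forall s r, T s -> 0 <= r <= 1 -> W (s, r)).
{ intros s r Ts Hr. split; [exact Ts|]. simpl. apply HB. now apply ball_convex. }
evar_last.
- apply (is_derive_parametric_integral W F t oW sF).
  apply (filter_imp T); [|now apply oT]. intros s Ts r Hr. now apply HW.
- apply RInt_ext. rewrite Rmin_left, Rmax_right by lra. intros r Hr.
  assert (Wr : W (t, r)) by (apply HW; [exact Tt|lra]).
  assert (D : forall i, is_derive (fun s => om i s (segment x y r)) t
      (time_derive (om i) t (segment x y r))).
  { intros i. apply Derive_correct. apply spacetime_ex_derive; [apply Hom|exact Tt|apply Wr]. }
  transitivity (Derive (fun s => F (s, r)) t).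
  { symmetry. apply is_derive_unique. now apply (is_derive_fst W). }
  apply is_derive_unique. unfold F, pairing, sum3, slice; simpl fst; simpl snd.
  exact (is_derive_Rplus _ _ t _ _
      (is_derive_Rplus _ _ t _ _ (is_derive_Rscal_r _ t _ _ (D I1)) (is_derive_Rscal_r _ t _ _ (D I2)))
      (is_derive_Rscal_r _ t _ _ (D I3))).
Qed.

(** At [x0] both sides vanish. Nearby points differ by a segment integral, which can be
    differentiated in time, so the identity spreads over [M] along paths. *)
Lemma normalized_primitive_time om p p' :
  (forall i, spacetime_smooth T M (om i)) -> normalized_primitive om p ->
  normalized_primitive (fun i => time_derive (om i)) p' ->
  forall x, M x -> forall t, T t -> is_derive (fun s => p s x) t (p' t x).
Proof.
intros Hom Hp Hp'.
apply (path_connected_ind M (fun x => forall t, T t -> is_derive (fun s => p s x) t (p' t x)) x0).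
- intros x Mx. exact (proj1 hM x0 x Mx0 Mx).
- intros x Mx. destruct (ball_inside_exists M oM x Mx) as [e He].
  exists e. split; [apply He|]. intros y My By.
  pose proof (fun t Tt => segment_integral_time om x e y t Hom He By Tt) as HJ.
  split; intros H t Tt.
  + apply (is_derive_ext_loc (fun s => p s x + segment_integral (slice om s) x y)).
    * apply (filter_imp T); [|now apply oT]. intros s Ts. symmetry. now apply (proj2 (proj2 (Hp s Ts))) with e.
    * rewrite (proj2 (proj2 (Hp' t Tt)) x e y He By). now apply is_derive_Rplus; [apply H|apply HJ].
  + apply (is_derive_ext_loc (fun s => p s y + segment_integral (slice om s) x y * (-1))).
    * apply (filter_imp T); [|now apply oT]. intros s Ts.
      rewrite (proj2 (proj2 (Hp s Ts)) x e y He By). Req; ring.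
    * replace (p' t x) with (p' t y + segment_integral (slice (fun i => time_derive (om i)) t) x y * (-1)).
      -- apply is_derive_Rplus; [now apply H|]. now apply is_derive_Rscal_r, HJ.
      -- rewrite (proj2 (proj2 (Hp' t Tt)) x e y He By). ring.
- intros t Tt. rewrite (proj1 (Hp' t Tt)).
  apply (is_derive_ext_loc (fun _ => 0)); [|exact (is_derive_const (V := R_NormedModule) 0 t)].
  apply (filter_imp T); [|now apply oT]. intros s Ts. symmetry. apply (Hp s Ts).
Qed.

(** Compare [(t, x)] first with [(t, x1)], by the mean value theorem in space with bounds on the
    form that are uniform in time, and then with [(t0, x1)], by differentiability in time at the
    fixed point [x1]. *)
Lemma normalized_primitive_continuous om p p' :
  (forall i, spacetime_smooth T M (om i)) -> normalized_primitive om p ->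
  normalized_primitive (fun i => time_derive (om i)) p' ->
  forall z, U z -> continuous (fun z => p (fst z) (snd z)) z.
Proof.
intros Hom Hp Hp' [t0 x1] [Tt Mx]. simpl in Tt, Mx.
assert (ct : continuous (fun s => p s x1) t0).
{ apply (ex_derive_continuous (fun s => p s x1)). eexists. now apply (normalized_primitive_time om p p'). }
(* A common bound for the three components near [(t0, x1)]; the added 1 covers their variation. *)
set (B := 1 + sum3 (fun i => Rabs (om i t0 x1))).
assert (HB : locally ((t0, x1) : R * pt) (fun z : R * pt => U z /\ forall i, Rabs (om i (fst z) (snd z)) <= B)).
{ assert (Hi : forall i, locally ((t0, x1) : R * pt)
      (fun z : R * pt => Rabs (om i (fst z) (snd z) - om i t0 x1) < 1)).
  { intros i. exact (proj1 (filterlim_locally _ _)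
      (smooth_continuous U _ (t0, x1) (Hom i) (conj Tt Mx)) (mkposreal 1 Rlt_0_1)). }
  assert (Hb : forall i (a : R), Rabs (a - om i t0 x1) < 1 -> Rabs a <= B).
  { intros i a Ha. replace a with ((a - om i t0 x1) + om i t0 x1) by ring.
    eapply Rle_trans; [apply Rabs_triang|].
    assert (Rabs (om i t0 x1) <= sum3 (fun i => Rabs (om i t0 x1))); [|unfold B; lra].
    unfold sum3. pose proof (Rabs_pos (om I1 t0 x1)). pose proof (Rabs_pos (om I2 t0 x1)).
    pose proof (Rabs_pos (om I3 t0 x1)). destruct i; lra. }
  destruct (spacetime_open (t0, x1) (conj Tt Mx)) as [d0 H0].
  destruct (Hi I1) as [d1 H1], (Hi I2) as [d2 H2], (Hi I3) as [d3 H3].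
  set (d := Rmin (Rmin d0 d1) (Rmin d2 d3)).
  assert (Hd : 0 < d) by (unfold d; repeat apply Rmin_pos; apply cond_pos).
  exists (mkposreal d Hd). intros z Bz.
  assert (Bw : forall d', d <= d' -> ball ((t0, x1) : R * pt) d' z).
  { intros d' Hdd. exact (ball_le _ _ _ Hdd z Bz). }
  assert (L0 : d <= d0) by (eapply Rle_trans; [apply Rmin_l|apply Rmin_l]).
  assert (L1 : d <= d1) by (eapply Rle_trans; [apply Rmin_l|apply Rmin_r]).
  assert (L2 : d <= d2) by (eapply Rle_trans; [apply Rmin_r|apply Rmin_l]).
  assert (L3 : d <= d3) by (eapply Rle_trans; [apply Rmin_r|apply Rmin_r]).
  split; [now apply H0, Bw|]. intros []; eapply Hb; [now apply H1, Bw|now apply H2, Bw|now apply H3, Bw]. }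
destruct HB as [d0 HB].
assert (B1 : 1 <= B).
{ unfold B, sum3. pose proof (Rabs_pos (om I1 t0 x1)). pose proof (Rabs_pos (om I2 t0 x1)).
  pose proof (Rabs_pos (om I3 t0 x1)). lra. }
apply filterlim_locally. intros eps.
destruct (proj1 (filterlim_locally _ _) ct (pos_div_2 eps)) as [d1 H1].
assert (Hr : 0 < eps / (2 * (3 * B))) by (apply Rdiv_lt_0_compat; [apply cond_pos|lra]).
(* Each component contributes at most [B * d] to the increment in space; the factor 3 counts
   components and the factor 2 leaves half of [eps] for time. *)
set (d := Rmin (Rmin d0 d1) (eps / (2 * (3 * B)))).
assert (Hd : 0 < d) by (unfold d; repeat apply Rmin_pos; try apply cond_pos; exact Hr).
exists (mkposreal d Hd). intros [t x] [Bt Bx].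
assert (L0 : d <= d0) by (eapply Rle_trans; [apply Rmin_l|apply Rmin_l]).
assert (L1 : d <= d1) by (eapply Rle_trans; [apply Rmin_l|apply Rmin_r]).
assert (L2 : d <= eps / (2 * (3 * B))) by apply Rmin_r.
simpl in Bt, Bx |- *.
assert (Bt' : ball t0 d0 t) by exact (ball_le _ _ _ L0 t Bt).
assert (Hseg : forall s, 0 <= s <= 1 -> U (t, segment x1 x s) /\ forall i, Rabs (om i t (segment x1 x s)) <= B).
{ intros s Hs. apply (HB (t, segment x1 x s)). split; [exact Bt'|]. simpl.
  apply (ball_le _ _ _ L0). apply ball_convex; [exact (ball_center x1 (mkposreal d Hd))|exact Bx|exact Hs]. }
assert (Ut : T t) by exact (proj1 (proj1 (Hseg 0 ltac:(lra)))).
destruct (mean_value (fun s => p t (segment x1 x s))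
  (fun s => pairing (slice om t) (segment x1 x s) (minus x x1)) 0 1) as (c & Hc & e).
{ rewrite Rmin_left, Rmax_right by lra. intros s Hs.
  destruct (Hseg s Hs) as [[_ Ms] _].
  pose proof (proj1 (proj2 (Hp t Ut)) (segment x1 x s) (minus x x1) Ms) as D.
  apply (is_derive_ext (fun r : R => p t (plus (segment x1 x s) (scal (r - s) (minus x x1))))).
  - intros r. f_equal. apply pt_eq; intros i. rewrite line_coord, !segment_coord, minus_coord. Req; ring.
  - evar_last.
    + apply (is_derive_comp (fun r : R => p t (plus (segment x1 x s) (scal r (minus x x1)))) (fun r => r - s)).
      * rewrite Rminus_diag. exact D.
      * auto_derive; [easy|reflexivity].
    + apply (scal_one (pairing (slice om t) (segment x1 x s) (minus x x1))). }
rewrite Rmin_left, Rmax_right in Hc by lra. rewrite segment_start, segment_end in e.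
destruct (Hseg c Hc) as [_ Hom_c].
rewrite ball_coord in Bx.
assert (Hprod : forall i, Rabs (om i t (segment x1 x c) * (coord i x - coord i x1)) <= B * d).
{ intros i. rewrite Rabs_mult. apply Rmult_le_compat; try apply Rabs_pos; [apply Hom_c|].
  specialize (Bx i). lra. }
assert (H3 : Rabs (p t x - p t x1) <= 3 * (B * d)).
{ rewrite e. unfold pairing, sum3, slice. rewrite !minus_coord, Rminus_0_r, Rmult_1_r.
  eapply Rle_trans; [apply Rabs_triang|]. pose proof (Hprod I3).
  eapply Rle_trans; [apply Rplus_le_compat_r, Rabs_triang|]. pose proof (Hprod I1). pose proof (Hprod I2). lra. }
assert (H4 : 3 * (B * d) <= eps / 2).
{ replace (eps / 2) with (3 * (B * (eps / (2 * (3 * B))))) by (field; lra).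
  apply Rmult_le_compat_l; [lra|]. apply Rmult_le_compat_l; lra. }
specialize (H1 t (ball_le _ _ _ L1 t Bt)). change (Rabs (p t x1 - p t0 x1) < eps / 2) in H1.
change (Rabs (p t x - p t0 x1) < eps).
replace (p t x - p t0 x1) with ((p t x - p t x1) + (p t x1 - p t0 x1)) by ring.
eapply Rle_lt_trans; [apply Rabs_triang|]. lra.
Qed.

Lemma time_derive_closed om t : (forall i, spacetime_smooth T M (om i)) ->
  (forall t, T t -> closed_form_on M (slice om t)) -> T t ->
  closed_form_on M (slice (fun i => time_derive (om i)) t).
Proof.
intros Hom Hcl Tt i j x Mx. unfold slice.
rewrite <- !(spacetime_comm _ _ t x) by auto.
apply Derive_ext_loc. apply (filter_imp T); [|now apply oT]. intros s Ts. now apply (Hcl s Ts i j x Mx).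
Qed.

(* The time derivative of the primitive is the primitive of the time derivative, so smoothness
   follows by induction from joint continuity alone. *)
Lemma normalized_primitive_Ck k : forall om p,
  (forall i, spacetime_smooth T M (om i)) -> (forall t, T t -> closed_form_on M (slice om t)) ->
  normalized_primitive om p -> Ck_on k U (fun z => p (fst z) (snd z)).
Proof.
induction k as [|k IH]; intros om p Hom Hcl Hp.
all: assert (Hom' : forall i, spacetime_smooth T M (time_derive (om i)))
  by (intros i; now apply spacetime_time_derive).
all: pose proof (fun t Tt => time_derive_closed om t Hom Hcl Tt) as Hcl'.
all: destruct (normalized_primitive_exists _ Hom' Hcl') as [p' Hp'].
all: pose proof (normalized_primitive_continuous om p p' Hom Hp Hp') as cp.
- exact cp.
- split; [exact cp|].
  (* [p'] is again a normalized primitive, so its continuity is obtained from a normalized primitive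
     of the second time derivative. *)
  assert (cp' : forall z, U z -> continuous (fun z => p' (fst z) (snd z)) z).
  { destruct (normalized_primitive_exists (fun i => time_derive (time_derive (om i)))) as [p'' Hp''].
    - intros i. now apply spacetime_time_derive.
    - intros t Tt. now apply (time_derive_closed (fun i => time_derive (om i))).
    - now apply (normalized_primitive_continuous _ p' p'' Hom'). }
  (* Joint differentiability comes from differentiability in space at fixed time together with a
     jointly continuous time derivative. *)
  assert (Fd : forall t x, T t -> M x -> filterdiff (fun z : R * pt => p (fst z) (snd z))
     (locally (t, x)) (fun v : R * pt => fst v * p' t x + dderiv (snd v) (p t) x)).
  { intros t x Tt Mx.
    apply (filterdiff_prod_l (fun z : R * pt => p (fst z) (snd z)) t x (fun v : pt => dderiv v (p t) x)
      (fun z => p' (fst z) (snd z))).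
    - apply (C1_differentiable_pt M (p t) x oM); [|exact Mx].
      split.
      + intros y My. apply (continuous_comp (fun y : pt => (t, y)) (fun z : R * pt => p (fst z) (snd z))).
        * apply continuous_at_time.
        * now apply cp.
      + intros v. pose proof (proj1 (proj2 (Hp t Tt))) as HP. split.
        * intros y My. eexists. now apply HP.
        * intros y My. apply (continuous_ext_loc _ (fun y => pairing (slice om t) y v)).
          -- apply (filter_imp M); [|now apply oM]. intros w Mw. symmetry. now apply dderiv_unique, HP.
          -- unfold pairing, sum3. repeat apply continuous_Rplus; apply continuous_Rmult;
               try apply continuous_const; apply (smooth_continuous M); auto; apply spacetime_slice; auto.
    - destruct (spacetime_open (t, x) (conj Tt Mx)) as [d Hd]. exists d. intros z Bz.
      destruct (Hd z Bz) as [Ts Ms]. now apply (normalized_primitive_time om p p').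
    - now apply cp'. }
  assert (De : forall a v t x, T t -> M x -> is_derive
     (fun s : R => (fun z : R * pt => p (fst z) (snd z)) (plus ((t, x) : R * pt) (scal s ((a, v) : R * pt)))) 0
     (a * p' t x + pairing (slice om t) x v)).
  { intros a v t x Tt Mx. evar_last.
    - apply (filterdiff_derive_line _ (t, x) (a, v) _ (Fd t x Tt Mx)).
    - simpl. do 2 f_equal. apply dderiv_unique, (proj1 (proj2 (Hp t Tt))), Mx. }
  intros [a v]. split.
  + intros [t x] [Tt Mx]. eexists. now apply De.
  + apply (Ck_ext k U (fun z => a * p' (fst z) (snd z)
      + sum3 (fun i => om i (fst z) (snd z) * coord i v))); [exact spacetime_open| |].
    * intros [t x] [Tt Mx]. symmetry. now apply dderiv_unique, De.
    * unfold sum3. repeat apply Ck_plus; try exact spacetime_open; apply Ck_mult; try exact spacetime_open;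
        try apply Ck_const; try apply Hom. now apply (IH (fun i => time_derive (om i))).
Qed.

End Primitive.

Lemma spacetime_primitive (om : ix -> R -> pt -> R) : simply_connected M ->
  (forall i, spacetime_smooth T M (om i)) ->
  (forall t, T t -> closed_form_on M (fun i => om i t)) ->
  exists p, spacetime_smooth T M p /\ forall t i x, T t -> M x -> partial i (p t) x = om i t x.
Proof.
intros hM Hom Hcl. destruct (classic (exists x, M x)) as [[x0 Mx0]|Hno].
- destruct (normalized_primitive_exists hM x0 Mx0 om Hom Hcl) as [p Hp].
  exists p. split.
  + intros k. now apply (normalized_primitive_Ck hM x0 Mx0 k om).
  + intros t i x Tt Mx. apply dderiv_unique. evar_last.
    * apply (proj1 (proj2 (Hp t Tt))), Mx.
    * unfold pairing, sum3. destruct i; simpl; ring.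
(* [M] is empty and offers no base point; any function will do. *)
- exists (fun _ _ => 0). split; [exact (smooth_const U 0)|].
  intros t i x _ Mx. elim Hno. now exists x.
Qed.

End Spacetime.

(** * Even functions and their lifts to the rotational manifold *)

(** By the mean value theorem a continuous function whose derivative off [x] extends continuously to
    [x] is differentiable there. It is applied on the axis $r = 0$. *)
Lemma is_derive_from_limit (f g : R -> R) (x : R) :
  continuous f x -> continuous g x -> locally x (fun y => y <> x -> is_derive f y (g y)) ->
  is_derive f x (g x).
Proof.
intros cf cg [d Hd].
split; [exact (is_linear_scal_l (V := R_NormedModule) (g x))|].
intros z Hz. pose proof (is_filter_lim_locally_unique (V := R_NormedModule) x z Hz). subst z.
intros eps.
destruct (proj1 (filterlim_locally g (g x)) cg eps) as [d' Hd'].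
exists (mkposreal _ (Rmin_pos d d' (cond_pos d) (cond_pos d'))). intros y By.
change (Rabs (y - x) < Rmin d d') in By.
assert (Ld : Rabs (y - x) < d) by (eapply Rlt_le_trans; [exact By|apply Rmin_l]).
assert (Ld' : Rabs (y - x) < d') by (eapply Rlt_le_trans; [exact By|apply Rmin_r]).
destruct (MVT_gen f x y g) as (c & Hc & e).
- intros t Ht. assert (Ht' : Rabs (t - x) <= Rabs (y - x)) by (apply between_abs; lra).
  apply Hd; [change (Rabs (t - x) < d); lra|].
  intros ->. unfold Rmin, Rmax in Ht. destruct (Rle_dec x y); lra.
- intros t Ht. apply continuity_pt_filterlim. destruct (Req_dec t x) as [->|nt]; [exact cf|].
  apply (ex_derive_continuous f). exists (g t). pose proof (between_abs _ _ _ Ht).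
  apply Hd; [change (Rabs (t - x) < d); lra|exact nt].
- apply between_abs in Hc.
  assert (B : Rabs (g c - g x) < eps) by (apply Hd'; change (Rabs (c - x) < d'); lra).
  change (Rabs (f y - f x - (y - x) * g x) <= eps * Rabs (y - x)).
  rewrite e. replace (g c * (y - x) - (y - x) * g x) with ((g c - g x) * (y - x)) by ring.
  rewrite Rabs_mult. apply Rmult_le_compat_r; [apply Rabs_pos|lra].
Qed.

(** * Division of smooth functions by powers of $r$ *)

Section Quotient.
Context (Omega : R * R -> Prop).
Hypothesis (oO : open Omega).

Let Dr (H : R * R -> R) : R * R -> R := dderiv ((1, 0) : R * R) H.
Let Dp (H : R * R -> R) : R * R -> R := dderiv ((0, 1) : R * R) H.

Fixpoint radial_derive (n : nat) (H : R * R -> R) : R * R -> R :=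
  match n with O => H | S m => radial_derive m (dderiv ((1, 0) : R * R) H) end.

Lemma is_derive_first H (a b : R) : smooth_on Omega H -> Omega (a, b) ->
  is_derive (fun z : R => H (z, b)) a (Dr H (a, b)).
Proof. apply is_derive_fst. Qed.

Lemma is_derive_second H (a b : R) : smooth_on Omega H -> Omega (a, b) ->
  is_derive (fun z : R => H (a, z)) b (Dp H (a, b)).
Proof.
intros HH Oab.
apply (is_derive_ext (fun s : R => H (plus ((a, 0) : R * R) (scal s ((0, 1) : R * R))))).
- intros t. f_equal. rewrite plane_line. f_equal; Req; ring.
- apply (is_derive_line_at 0 Omega H (a, 0) (0, 1) b (a, b)); [apply HH| |exact Oab].
  rewrite plane_line. f_equal; ring.
Qed.

Lemma radial_derive_smooth n : forall H, smooth_on Omega H -> smooth_on Omega (radial_derive n H).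
Proof. induction n as [|n IH]; intros H HH; [exact HH|]. now apply IH, smooth_dderiv. Qed.

Lemma radial_derive_ext n : forall H K, (forall z, Omega z -> H z = K z) ->
  forall z, Omega z -> radial_derive n H z = radial_derive n K z.
Proof.
induction n as [|n IH]; intros H K e; [exact e|]. apply IH. intros z Oz. now apply (dderiv_ext Omega).
Qed.

Lemma radial_derive_comm n : forall H z, smooth_on Omega H -> Omega z ->
  Dp (radial_derive n H) z = radial_derive n (Dp H) z.
Proof.
induction n as [|n IH]; intros H z HH Oz; [easy|]. simpl.
rewrite IH by (try apply smooth_dderiv; auto).
apply radial_derive_ext; [|exact Oz]. intros w Ow. now apply (smooth_comm Omega).
Qed.

(** Vanishing to order [m] along the axis: the Taylor expansion in $r$ begins with $r^m$. *)
Definition vanishes (m : nat) (H : R * R -> R) : Prop :=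
  forall j psi, (j < m)%nat -> Omega (0, psi) -> radial_derive j H (0, psi) = 0.

(** By Euler's identity this is zero on functions homogeneous of degree [a] in $r$. With [a = m] it
    is the numerator of the radial derivative of $H/r^m$ over $r^{m+1}$. *)
Definition euler_defect (a : R) (H : R * R -> R) (z : R * R) : R := fst z * Dr H z - a * H z.

Lemma euler_defect_smooth a H : smooth_on Omega H -> smooth_on Omega (euler_defect a H).
Proof.
intros HH. unfold euler_defect. apply smooth_minus; [exact oO| |].
- apply smooth_mult; [exact oO|apply smooth_fst|now apply smooth_dderiv].
- apply smooth_mult; [exact oO|apply smooth_const|exact HH].
Qed.

Lemma euler_defect_radial n : forall a H z, smooth_on Omega H -> Omega z ->
  radial_derive n (euler_defect a H) z = euler_defect (a - INR n) (radial_derive n H) z.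
Proof.
induction n as [|n IH]; intros a H z HH Oz.
- simpl. unfold euler_defect. ring.
- simpl radial_derive. replace (a - INR (S n)) with (a - 1 - INR n) by (rewrite S_INR; ring).
  rewrite <- IH; [|now apply smooth_dderiv|exact Oz].
  apply radial_derive_ext; [|exact Oz]. intros w Ow. unfold euler_defect.
  assert (H1 : smooth_on Omega (Dr H)) by now apply smooth_dderiv.
  rewrite (dderiv_minus_on Omega); [|apply smooth_mult; auto; apply smooth_fst
    |apply smooth_mult; auto; apply smooth_const|exact Ow].
  rewrite (dderiv_mult_on Omega); [|apply smooth_fst|exact H1|exact Ow].
  rewrite dderiv_scal.
  rewrite (dderiv_linear (fun z : R * R => fst z)
    _ w (is_linear_fst (U := R_NormedModule) (V := R_NormedModule))).
  unfold Dr; simpl. ring.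
Qed.

(** On the axis the [j]-th radial derivative of the defect is $-(m-j)$ times that of [H]. It
    vanishes by assumption for $j < m$ and through the coefficient for $j = m$, which is exactly the
    extra order needed to divide by $r^{m+1}$. *)
Lemma vanishes_euler_defect m H : smooth_on Omega H -> vanishes m H ->
  vanishes (S m) (euler_defect (INR m) H).
Proof.
intros HH Hv j psi Hj O0. rewrite euler_defect_radial by auto. unfold euler_defect. simpl fst.
destruct (Nat.eq_dec j m) as [->|ne]; [ring|].
rewrite (Hv j psi) by (auto; lia). ring.
Qed.

Lemma vanishes_angular m H : smooth_on Omega H -> vanishes m H -> vanishes m (Dp H).
Proof.
intros HH Hv j psi Hj O0. rewrite <- radial_derive_comm by auto.
apply dderiv_unique.
apply (is_derive_ext_loc (fun _ => 0)); [|exact (is_derive_const (V := R_NormedModule) 0 _)].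
pose proof (line_locally_0 (E := plane_module)
  Omega (0, psi) (0, 1) (oO _ O0)) as HL.
revert HL. apply filter_imp. intros s Os. rewrite plane_line in Os |- *.
replace (0 + s * 0) with 0 in * by ring. symmetry. now apply Hv.
Qed.

(** The value on the axis is the Taylor coefficient, the limit of the quotient. *)
Definition radial_quotient (m : nat) (H : R * R -> R) (z : R * R) : R :=
  if Req_EM_T (fst z) 0 then radial_derive m H (0, snd z) / INR (fact m) else H z / fst z ^ m.

(** Taylor's formula by induction: the bound for the radial derivative is integrated by the mean
    value theorem, starting from the value 0 on the axis. The crude constant [eps], without division
    by a factorial, is enough for continuity. *)
Lemma taylor_bound m : forall H psi rho c eps, smooth_on Omega H -> vanishes m H ->
  (forall r, Rabs r <= rho -> Omega (r, psi)) ->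
  (forall r, Rabs r <= rho -> Rabs (radial_derive m H (r, psi) - c) <= eps) ->
  forall r, Rabs r <= rho -> Rabs (H (r, psi) - c * r ^ m / INR (fact m)) <= eps * Rabs r ^ m.
Proof.
induction m as [|m IH]; intros H psi rho c eps HH Hv HO Hb r Hr.
- simpl in *. replace (c * 1 / 1) with c by field. rewrite Rmult_1_r. now apply Hb.
- assert (HD : forall s, Rabs s <= rho ->
     Rabs (Dr H (s, psi) - c * s ^ m / INR (fact m)) <= eps * Rabs s ^ m).
  { apply (IH (Dr H)); [now apply smooth_dderiv| |exact HO|exact Hb].
    intros j psi' Hj O0. apply (Hv (S j)); [lia|exact O0]. }
  assert (H0 : H (0, psi) = 0).
  { apply (Hv 0%nat psi); [lia|]. apply HO. rewrite Rabs_R0. pose proof (Rabs_pos r). lra. }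
  assert (Fm : INR (fact m) <> 0) by apply INR_fact_neq_0.
  assert (Fs : INR (fact (S m)) = INR (S m) * INR (fact m)) by (simpl fact; now rewrite <- mult_INR).
  assert (Sm : INR (S m) <> 0) by (apply not_0_INR; lia).
  destruct (mean_value (fun s => H (s, psi) - c * s ^ S m / INR (fact (S m)))
    (fun s => Dr H (s, psi) - c * s ^ m / INR (fact m)) 0 r) as (xi & Hxi & e).
  { intros s Hs. apply between_abs in Hs. rewrite !Rminus_0_r in Hs.
    apply (is_derive_minus (fun s => H (s, psi)) (fun s => c * s ^ S m / INR (fact (S m)))).
    - apply is_derive_first; [exact HH|]. apply HO; lra.
    - rewrite Fs. auto_derive; [easy|].
      change (match m with O => 1 | S _ => INR m + 1 end) with (INR (S m)). simpl pred.
      field. now split. }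
  apply between_abs in Hxi. rewrite !Rminus_0_r in Hxi.
  replace (H (r, psi) - c * r ^ S m / INR (fact (S m)))
    with (H (r, psi) - c * r ^ S m / INR (fact (S m)) - (H (0, psi) - c * 0 ^ S m / INR (fact (S m)))).
  2:{ rewrite H0, pow_i by lia. field. rewrite Fs. now apply Rmult_integral_contrapositive. }
  rewrite e, Rminus_0_r, Rabs_mult. simpl pow.
  replace (eps * (Rabs r * Rabs r ^ m)) with (eps * Rabs r ^ m * Rabs r) by ring.
  apply Rmult_le_compat_r; [apply Rabs_pos|].
  eapply Rle_trans; [apply HD; lra|].
  assert (0 <= eps).
  { eapply Rle_trans; [apply Rabs_pos|apply (Hb r Hr)]. }
  apply Rmult_le_compat_l; [easy|]. apply pow_incr. split; [apply Rabs_pos|exact Hxi].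
Qed.

Lemma open_nonzero : open (fun z : R * R => fst z <> 0).
Proof.
apply (open_comp (fun z : R * R => fst z) (fun t => t <> 0)); [intros z _; apply continuous_fst|].
apply open_neq.
Qed.

Lemma radial_quotient_nonzero m H (z : R * R) : fst z <> 0 -> radial_quotient m H z = H z / fst z ^ m.
Proof. intros nz. unfold radial_quotient. now destruct (Req_EM_T (fst z) 0). Qed.

Lemma radial_quotient_zero m H (psi : R) :
  radial_quotient m H (0, psi) = radial_derive m H (0, psi) / INR (fact m).
Proof. unfold radial_quotient; simpl. destruct (Req_EM_T 0 0); [easy|lra]. Qed.

Lemma radial_quotient_continuous m H z : smooth_on Omega H -> vanishes m H -> Omega z ->
  continuous (radial_quotient m H) z.
Proof.
intros HH Hv Oz. destruct (Req_dec (fst z) 0) as [z0|nz].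
- destruct z as [r0 psi0]. simpl in z0. subst r0.
  set (c := radial_derive m H (0, psi0)).
  apply filterlim_locally. intros eps.
  destruct (oO _ Oz) as [d1 H1].
  assert (Heps2 : 0 < eps / 2) by (pose proof (cond_pos eps); lra).
  destruct (proj1 (filterlim_locally _ _) (smooth_continuous Omega _ (0, psi0)
    (radial_derive_smooth m H HH) Oz) (mkposreal _ Heps2)) as [d2 H2].
  exists (mkposreal _ (Rmin_pos d1 d2 (cond_pos d1) (cond_pos d2))). intros [r psi] [Br Bp].
  change (Rabs (r - 0) < Rmin d1 d2) in Br. change (Rabs (psi - psi0) < Rmin d1 d2) in Bp.
  rewrite Rminus_0_r in Br.
  assert (L1 : Rmin d1 d2 <= d1) by apply Rmin_l. assert (L2 : Rmin d1 d2 <= d2) by apply Rmin_r.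
  assert (HO : forall s, Rabs s <= Rabs r -> Omega (s, psi)).
  { intros s Hs. apply H1. split; [change (Rabs (s - 0) < d1)|change (Rabs (psi - psi0) < d1)];
      rewrite ?Rminus_0_r; lra. }
  assert (Hb : forall s, Rabs s <= Rabs r -> Rabs (radial_derive m H (s, psi) - c) <= eps / 2).
  { intros s Hs. apply Rlt_le. apply (H2 (s, psi)).
    split; [change (Rabs (s - 0) < d2)|change (Rabs (psi - psi0) < d2)]; rewrite ?Rminus_0_r; lra. }
  rewrite radial_quotient_zero. fold c.
  change (Rabs (radial_quotient m H (r, psi) - c / INR (fact m)) < eps).
  (* Dividing by the factorial therefore does not enlarge the difference of the Taylor
     coefficients. *)
  assert (F1 : 1 <= INR (fact m)).
  { apply (le_INR 1). apply lt_O_fact. }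
  destruct (Req_dec r 0) as [->|nr].
  + rewrite radial_quotient_zero.
    change (Rabs (radial_derive m H (0, psi) / INR (fact m) - c / INR (fact m)) < eps).
    replace (radial_derive m H (0, psi) / INR (fact m) - c / INR (fact m))
      with ((radial_derive m H (0, psi) - c) / INR (fact m)) by (field; lra).
    unfold Rdiv. rewrite Rabs_mult, (Rabs_pos_eq (/ INR (fact m))).
    2:{ left. apply Rinv_0_lt_compat. lra. }
    specialize (Hb 0 (Rle_refl _)).
    assert (/ INR (fact m) <= 1) by (rewrite <- Rinv_1; apply Rinv_le_contravar; lra).
    assert (0 < / INR (fact m)) by (apply Rinv_0_lt_compat; lra).
    pose proof (Rabs_pos (radial_derive m H (0, psi) - c)). nra.
  + rewrite radial_quotient_nonzero by exact nr. simpl fst.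
    assert (rm : r ^ m <> 0) by now apply pow_nonzero.
    pose proof (taylor_bound m H psi (Rabs r) c (eps / 2) HH Hv HO Hb r (Rle_refl _)) as Ht.
    change (Rabs (H (r, psi) / r ^ m - c / INR (fact m)) < eps).
    replace (H (r, psi) / r ^ m - c / INR (fact m))
      with ((H (r, psi) - c * r ^ m / INR (fact m)) * / r ^ m) by (field; lra).
    rewrite Rabs_mult, Rabs_inv, <- RPow_abs.
    assert (P : 0 < Rabs r ^ m) by (apply pow_lt, Rabs_pos_lt, nr).
    apply Rle_lt_trans with (eps / 2); [|lra].
    apply (Rmult_le_reg_r (Rabs r ^ m)); [exact P|].
    rewrite Rmult_assoc, Rinv_l by lra. rewrite Rmult_1_r. exact Ht.
- apply (continuous_ext_loc _ (fun z => H z / fst z ^ m)).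
  + destruct (open_nonzero z nz) as [d Hd]. exists d. intros w Bw.
    symmetry. now apply radial_quotient_nonzero, Hd.
  + apply continuous_Rmult; [now apply (smooth_continuous Omega)|].
    apply (continuous_inv (fun z : R * R => fst z ^ m)).
    * apply (smooth_continuous (fun _ => True)); [|easy].
      apply smooth_pow; [intros ? _; apply filter_true|apply smooth_fst].
    * now apply pow_nonzero.
Qed.

Lemma radial_quotient_derive_second m H (a b : R) : smooth_on Omega H -> vanishes m H -> Omega (a, b) ->
  is_derive (fun s : R => radial_quotient m H (a, s)) b (radial_quotient m (Dp H) (a, b)).
Proof.
intros HH Hv Oab. destruct (Req_dec a 0) as [->|na].
- apply (is_derive_ext (fun s => radial_derive m H (0, s) * / INR (fact m))).
  { intros s. now rewrite radial_quotient_zero. }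
  rewrite radial_quotient_zero, <- radial_derive_comm by auto.
  apply is_derive_Rscal_r, is_derive_second; [now apply radial_derive_smooth|exact Oab].
- apply (is_derive_ext (fun s => H (a, s) * / a ^ m)).
  { intros s. now rewrite radial_quotient_nonzero. }
  rewrite radial_quotient_nonzero by exact na.
  now apply is_derive_Rscal_r, is_derive_second.
Qed.

(** Off the axis this is the quotient rule. On the axis the derivative is the limit of the nearby
    ones, which exists because the defect vanishes to one order more. *)
Lemma radial_quotient_derive_first m H (a b : R) : smooth_on Omega H -> vanishes m H -> Omega (a, b) ->
  is_derive (fun s : R => radial_quotient m H (s, b)) a
    (radial_quotient (S m) (euler_defect (INR m) H) (a, b)).
Proof.
intros HH Hv.
assert (Hnz : forall a, a <> 0 -> Omega (a, b) -> is_derive (fun s : R => radial_quotient m H (s, b)) a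
    (radial_quotient (S m) (euler_defect (INR m) H) (a, b))).
{ intros r nr Or.
  apply (is_derive_ext_loc (fun s => H (s, b) * / s ^ m)).
  { apply (filter_imp (fun s => s <> 0)); [|now apply open_neq]. intros s ns.
    now rewrite radial_quotient_nonzero. }
  rewrite radial_quotient_nonzero by exact nr.
  evar_last.
  - apply (is_derive_Rmult (fun s => H (s, b)) (fun s => / s ^ m)).
    + now apply is_derive_first.
    + apply (is_derive_inv (fun s => s ^ m)); [|now apply pow_nonzero].
      apply (is_derive_pow (fun s => s) m), (is_derive_id (K := R_AbsRing)).
  - unfold euler_defect; simpl. unfold one; simpl.
    destruct m as [|m].
    { change (Dr H (r, b) * / 1 + H (r, b) * (- (0 * 1 * 1) / (1 * (1 * 1)))
        = (r * Dr H (r, b) - 0 * H (r, b)) / (r * 1)). field. exact nr. }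
    change (Dr H (r, b) * / r ^ S m + H (r, b) * (- (INR (S m) * 1 * r ^ m) / (r ^ S m * (r ^ S m * 1)))
      = (r * Dr H (r, b) - INR (S m) * H (r, b)) / (r * r ^ S m)).
    generalize (INR (S m)) (Dr H (r, b)) (H (r, b)). intros u v w. simpl pow.
    field. split; [now apply pow_nonzero|exact nr]. }
intros Oab. destruct (Req_dec a 0) as [->|na]; [|now apply Hnz].
apply (is_derive_from_limit (fun s => radial_quotient m H (s, b))
  (fun s => radial_quotient (S m) (euler_defect (INR m) H) (s, b))).
- apply (continuous_comp (fun s : R => (s, b)) (radial_quotient m H)).
  + apply continuous_pair; [apply continuous_id|apply continuous_const].
  + now apply radial_quotient_continuous.
- apply (continuous_comp (fun s : R => (s, b)) (radial_quotient (S m) (euler_defect (INR m) H))).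
  + apply continuous_pair; [apply continuous_id|apply continuous_const].
  + apply radial_quotient_continuous; [now apply euler_defect_smooth|now apply vanishes_euler_defect|exact Oab].
- destruct (oO _ Oab) as [d Hd]. exists d. intros s Bs ns. apply Hnz; [exact ns|].
  apply Hd. split; [exact Bs|apply ball_center].
Qed.

Lemma radial_quotient_derive m H z v : smooth_on Omega H -> vanishes m H -> Omega z ->
  is_derive (fun s : R => radial_quotient m H (plus z (scal s v))) 0
    (fst v * radial_quotient (S m) (euler_defect (INR m) H) z + snd v * radial_quotient m (Dp H) z).
Proof.
intros HH Hv Oz. destruct z as [a b].
apply (filterdiff_derive_line (E := plane_module)
  (radial_quotient m H) (a, b) v
  (fun v : R * R => fst v * radial_quotient (S m) (euler_defect (INR m) H) (a, b)
     + snd v * radial_quotient m (Dp H) (a, b))).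
apply (filterdiff_prod_r (radial_quotient m H) a b
  (fun t : R => t * radial_quotient (S m) (euler_defect (INR m) H) (a, b)) (radial_quotient m (Dp H))).
- now apply radial_quotient_derive_first.
- destruct (oO _ Oz) as [d Hd]. exists d. intros [a' b'] B. simpl.
  apply radial_quotient_derive_second; [exact HH|exact Hv|]. now apply Hd.
- apply radial_quotient_continuous; [now apply smooth_dderiv|now apply vanishes_angular|exact Oz].
Qed.

(* The radial derivative of [H / r^m] is again of this form, [(r H_r - m H) / r^(m+1)]. *)
Lemma radial_quotient_Ck k : forall m H, smooth_on Omega H -> vanishes m H ->
  Ck_on k Omega (radial_quotient m H).
Proof.
induction k as [|k IH]; intros m H HH Hv.
- intros z Oz. now apply radial_quotient_continuous.
- split; [intros z Oz; now apply radial_quotient_continuous|].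
  intros v. split.
  + intros z Oz. eexists. now apply radial_quotient_derive.
  + apply (Ck_ext k Omega (fun z => fst v * radial_quotient (S m) (euler_defect (INR m) H) z
       + snd v * radial_quotient m (Dp H) z)); [exact oO| |].
    * intros z Oz. symmetry. now apply dderiv_unique, radial_quotient_derive.
    * apply Ck_plus; [exact oO| |]; (apply Ck_mult; [exact oO|apply Ck_const|]); apply IH.
      -- now apply euler_defect_smooth.
      -- now apply vanishes_euler_defect.
      -- now apply smooth_dderiv.
      -- now apply vanishes_angular.
Qed.

End Quotient.

(** * Functions of the distance to the axis *)

Definition axis_dist (x : pt) : R := sqrt (coord I1 x ^ 2 + coord I3 x ^ 2).

Definition lift (F : R * R -> R) (x : pt) : R := F (axis_dist x, coord I2 x).

Lemma manifold_rotational Omega x : manifold Rotational Omega x = Omega (axis_dist x, coord I2 x).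
Proof. now destruct x as [[x1 x2] x3]. Qed.

Lemma continuous_axis_dist x : continuous axis_dist x.
Proof.
unfold axis_dist.
apply (continuous_comp (fun x : pt => coord I1 x ^ 2 + coord I3 x ^ 2) sqrt).
- assert (oT : open (fun _ : pt => True)) by (intros z _; apply filter_true).
  apply (smooth_continuous (fun _ : pt => True)); [|easy].
  apply smooth_plus; [exact oT| |]; apply smooth_pow; try exact oT; apply smooth_coord.
- apply continuous_sqrt.
Qed.

Lemma continuous_axis_pair x : continuous (fun x : pt => (axis_dist x, coord I2 x)) x.
Proof. apply continuous_pair; [apply continuous_axis_dist|apply continuous_coord]. Qed.

Lemma axis_dist_nonneg x : 0 <= axis_dist x.
Proof. apply sqrt_pos. Qed.

Lemma axis_dist_sqr x : axis_dist x ^ 2 = coord I1 x ^ 2 + coord I3 x ^ 2.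
Proof. unfold axis_dist. rewrite pow2_sqrt; [easy|]. nra. Qed.

Lemma sqrt_pow2_abs (r : R) : sqrt (r ^ 2) = Rabs r.
Proof. rewrite <- pow2_abs. apply sqrt_pow2, Rabs_pos. Qed.

Section Lift.
Context (Omega : R * R -> Prop).
Hypothesis (hO : range_ok Rotational Omega).
Let oO : open Omega := proj1 hO.
Let sO : forall r psi, Omega (r, psi) -> Omega (- r, psi) := proj2 hO eq_refl.

Lemma open_manifold_rotational : open (manifold Rotational Omega).
Proof.
apply (open_ext (fun x : pt => Omega (axis_dist x, coord I2 x))).
- intros x. now rewrite manifold_rotational.
- apply (open_comp (fun x : pt => (axis_dist x, coord I2 x)) Omega); [|exact oO].
  intros x _. apply continuous_axis_pair.
Qed.

Lemma profile_radial_odd F r psi : profile Rotational Omega F -> Omega (r, psi) ->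
  dderiv ((1, 0) : R * R) F (- r, psi) = - dderiv ((1, 0) : R * R) F (r, psi).
Proof.
intros [sF eF] Or. specialize (eF eq_refl).
assert (D : is_derive (fun s => F (- s, psi)) r (dderiv ((1, 0) : R * R) F (r, psi))).
{ apply (is_derive_ext_loc (fun s => F (s, psi))); [|now apply (is_derive_fst Omega)].
  destruct (oO _ Or) as [d Hd]. exists d. intros s Bs. symmetry. apply eF, Hd.
  split; [exact Bs|apply ball_center]. }
assert (D' : is_derive (fun s => F (- s, psi)) r (- dderiv ((1, 0) : R * R) F (- r, psi))).
{ evar_last.
  - apply (is_derive_comp (fun z => F (z, psi)) (fun s => - s)).
    + apply (is_derive_fst Omega); [exact sF|now apply sO].
    + auto_derive; easy.
  - change (- (1) * dderiv ((1, 0) : R * R) F (- r, psi) = - dderiv ((1, 0) : R * R) F (- r, psi)). ring. }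
apply is_derive_unique in D. apply is_derive_unique in D'. rewrite D in D'. lra.
Qed.

Lemma profile_radial_vanishes F : profile Rotational Omega F ->
  vanishes Omega 1 (dderiv ((1, 0) : R * R) F).
Proof.
intros HF j psi Hj O0. replace j with 0%nat by lia. simpl.
pose proof (profile_radial_odd F 0 psi HF O0) as H. rewrite Ropp_0 in H. lra.
Qed.

Lemma profile_angular F : profile Rotational Omega F -> profile Rotational Omega (dderiv ((0, 1) : R * R) F).
Proof.
intros [sF eF]. split; [now apply smooth_dderiv|]. intros _ r psi Or. specialize (eF eq_refl).
apply Derive_ext_loc.
pose proof (line_locally_0 (E := plane_module)
  Omega (r, psi) (0, 1) (oO _ Or)) as HL.
revert HL. apply filter_imp. intros s Os. rewrite plane_line in Os. rewrite !plane_line.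
replace (r + s * 0) with r in * by ring. replace (- r + s * 0) with (- r) by ring. now apply eF.
Qed.

Lemma profile_radial_quotient F : profile Rotational Omega F ->
  profile Rotational Omega (radial_quotient 1 (dderiv ((1, 0) : R * R) F)).
Proof.
intros HF. split.
- intros k. apply radial_quotient_Ck; [exact oO|apply smooth_dderiv, HF|now apply profile_radial_vanishes].
- intros _ r psi Or. destruct (Req_dec r 0) as [->|nr]; [now rewrite Ropp_0|].
  rewrite !radial_quotient_nonzero by (simpl; lra). rewrite profile_radial_odd by auto.
  simpl. field. exact nr.
Qed.

(** Off the axis the chain rule produces $F_r$ divided by the distance, which is the quotient
    function. On the axis $F_r$ vanishes, so only the psi direction contributes. *)
Lemma lift_is_derive F x v : profile Rotational Omega F -> manifold Rotational Omega x ->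
  is_derive (fun s : R => lift F (plus x (scal s v))) 0
    ((coord I1 v * coord I1 x + coord I3 v * coord I3 x)
       * lift (radial_quotient 1 (dderiv ((1, 0) : R * R) F)) x
     + coord I2 v * lift (dderiv ((0, 1) : R * R) F) x).
Proof.
intros HF Mx. rewrite manifold_rotational in Mx. pose proof (proj1 HF) as sF.
set (x1 := coord I1 x) in *. set (x2 := coord I2 x) in *. set (x3 := coord I3 x) in *.
set (v1 := coord I1 v). set (v2 := coord I2 v). set (v3 := coord I3 v).
assert (Hl : forall s, lift F (plus x (scal s v))
   = F (sqrt ((x1 + s * v1) ^ 2 + (x3 + s * v3) ^ 2), x2 + s * v2)).
{ intros s. unfold lift, axis_dist. now rewrite !line_coord. }
destruct (Req_dec (axis_dist x) 0) as [e|ne].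
- assert (Hx : x1 = 0 /\ x3 = 0).
  { pose proof (axis_dist_sqr x) as H. rewrite e in H. fold x1 x3 in H. nra. }
  destruct Hx as [e1 e3]. rewrite e in Mx.
  (* A line leaving an axis point has distance $|s|w$ from the axis. Since [F] is even, $|s|w$ may
     be replaced by the smooth argument $sw$. *)
  set (w := sqrt (v1 ^ 2 + v3 ^ 2)).
  assert (D : is_derive (fun s => F (s * w, x2 + s * v2)) 0
    (w * dderiv ((1, 0) : R * R) F (0 * w, x2 + 0 * v2) + v2 * dderiv ((0, 1) : R * R) F (0 * w, x2 + 0 * v2))).
  { apply (chain_plane Omega F (fun s => s * w) (fun s => x2 + s * v2) 0 w v2 oO (sF 1%nat)).
    - replace (0 * w, x2 + 0 * v2) with (0, x2) by (f_equal; ring). exact Mx.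
    - auto_derive; [easy|ring].
    - auto_derive; [easy|ring]. }
  apply (is_derive_ext_loc (fun s => F (s * w, x2 + s * v2))).
  + pose proof (line_locally_0 (E := plane_module)
      Omega (0, x2) (w, v2) (oO _ Mx)) as HL.
    revert HL. apply filter_imp. intros s Os. rewrite plane_line in Os.
    rewrite Hl, e1, e3.
    replace ((0 + s * v1) ^ 2 + (0 + s * v3) ^ 2) with (s ^ 2 * (v1 ^ 2 + v3 ^ 2)) by ring.
    rewrite sqrt_mult by nra. fold w. rewrite sqrt_pow2_abs.
    unfold Rabs. destruct (Rcase_abs s); [|easy].
    replace (- s * w) with (- (s * w)) by ring. symmetry. apply (proj2 HF eq_refl).
    now replace (s * w) with (0 + s * w) by ring.
  + replace (0 * w, x2 + 0 * v2) with (0, x2) in D by (f_equal; ring).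
    pose proof (profile_radial_vanishes F HF 0%nat x2 (Nat.lt_0_succ 0) Mx) as V. simpl in V.
    rewrite V in D. rewrite e1, e3. unfold lift. rewrite e. fold x2.
    replace ((v1 * 0 + v3 * 0) * radial_quotient 1 (dderiv ((1, 0) : R * R) F) (0, x2)
      + v2 * dderiv ((0, 1) : R * R) F (0, x2)) with (w * 0 + v2 * dderiv ((0, 1) : R * R) F (0, x2)) by ring.
    exact D.
- assert (pos : 0 < axis_dist x) by (pose proof (axis_dist_nonneg x); lra).
  assert (pos2 : 0 < x1 ^ 2 + x3 ^ 2) by (unfold x1, x3; rewrite <- axis_dist_sqr; nra).
  apply (is_derive_ext (fun s => F (sqrt ((x1 + s * v1) ^ 2 + (x3 + s * v3) ^ 2), x2 + s * v2))).
  { intros s. symmetry. apply Hl. }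
  assert (e0 : sqrt ((x1 + 0 * v1) ^ 2 + (x3 + 0 * v3) ^ 2) = axis_dist x).
  { unfold axis_dist. fold x1 x3. f_equal. ring. }
  assert (e2 : x2 + 0 * v2 = x2) by ring.
  evar_last.
  + apply (chain_plane Omega F (fun s => sqrt ((x1 + s * v1) ^ 2 + (x3 + s * v3) ^ 2))
      (fun s => x2 + s * v2) 0 ((x1 * v1 + x3 * v3) / axis_dist x) v2 oO (sF 1%nat)).
    * rewrite e0, e2. exact Mx.
    * auto_derive.
      -- replace ((x1 + 0 * v1) * ((x1 + 0 * v1) * 1) + (x3 + 0 * v3) * ((x3 + 0 * v3) * 1))
           with (x1 ^ 2 + x3 ^ 2) by ring. exact pos2.
      -- unfold axis_dist. fold x1 x3.
         replace ((x1 + 0 * v1) * ((x1 + 0 * v1) * 1) + (x3 + 0 * v3) * ((x3 + 0 * v3) * 1))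
           with (x1 ^ 2 + x3 ^ 2) by ring.
         field. apply Rgt_not_eq, sqrt_lt_R0, pos2.
    * auto_derive; [easy|ring].
  + rewrite e0, e2. unfold lift. fold x2. rewrite radial_quotient_nonzero by (simpl; lra).
    simpl fst. Req. field. exact ne.
Qed.

Lemma lift_Ck k : forall F, profile Rotational Omega F -> Ck_on k (manifold Rotational Omega) (lift F).
Proof.
assert (cont : forall F, profile Rotational Omega F ->
   forall x, manifold Rotational Omega x -> continuous (lift F) x).
{ intros F HF x Mx. rewrite manifold_rotational in Mx.
  apply (continuous_comp (fun x : pt => (axis_dist x, coord I2 x)) F); [apply continuous_axis_pair|].
  now apply (smooth_continuous Omega F _ (proj1 HF)). }
pose proof open_manifold_rotational as oM.
induction k as [|k IH]; intros F HF; [exact (cont F HF)|]. split; [exact (cont F HF)|]. intros v. split.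
- intros x Mx. eexists. now apply lift_is_derive.
- apply (Ck_ext k (manifold Rotational Omega) (fun x => (coord I1 v * coord I1 x + coord I3 v * coord I3 x)
       * lift (radial_quotient 1 (dderiv ((1, 0) : R * R) F)) x
     + coord I2 v * lift (dderiv ((0, 1) : R * R) F) x)); [exact oM| |].
  + intros x Mx. symmetry. now apply dderiv_unique, lift_is_derive.
  + apply Ck_plus; [exact oM| |]; apply Ck_mult; try exact oM; try apply Ck_const.
    * apply Ck_plus; try exact oM; apply Ck_mult; try exact oM; try apply Ck_const; apply smooth_coord.
    * now apply IH, profile_radial_quotient.
    * now apply IH, profile_angular.
Qed.

End Lift.

(** * The chart and its jacobian *)

Definition delta (i j : ix) : R :=
  match i, j with I1, I1 | I2, I2 | I3, I3 => 1 | _, _ => 0 end.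

Lemma inv3_left (A : ix -> ix -> R) i k : det3 A <> 0 ->
  sum3 (fun j => inv3 A i j * A j k) = delta i k.
Proof.
intros nz. unfold inv3. unfold det3, sum3, cofactor in *; simpl in *.
destruct i, k; simpl; field; exact nz.
Qed.

Lemma inv3_right (A : ix -> ix -> R) i k : det3 A <> 0 ->
  sum3 (fun j => A i j * inv3 A j k) = delta i k.
Proof.
intros nz. unfold inv3. unfold det3, sum3, cofactor in *; simpl in *.
destruct i, k; simpl; field; exact nz.
Qed.

Lemma sum3_delta (F : ix -> R) i : sum3 (fun j => delta i j * F j) = F i.
Proof. destruct i; unfold sum3; simpl; ring. Qed.

Lemma sum3_ext (F G : ix -> R) : (forall i, F i = G i) -> sum3 F = sum3 G.
Proof. intros H. unfold sum3. now rewrite !H. Qed.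

Lemma inv3_solve (A : ix -> ix -> R) (v w : ix -> R) i : det3 A <> 0 ->
  (forall j, sum3 (fun k => A j k * v k) = w j) -> v i = sum3 (fun j => inv3 A i j * w j).
Proof.
intros nz H. rewrite <- (sum3_delta v i).
transitivity (sum3 (fun j => inv3 A i j * sum3 (fun k => A j k * v k))).
- transitivity (sum3 (fun k => sum3 (fun j => inv3 A i j * A j k) * v k)).
  + apply sum3_ext; intros k. now rewrite inv3_left.
  + unfold sum3. ring.
- apply sum3_ext; intros j. now rewrite H.
Qed.

Lemma inv3_apply (A : ix -> ix -> R) (w : ix -> R) i : det3 A <> 0 ->
  sum3 (fun k => A i k * sum3 (fun j => inv3 A k j * w j)) = w i.
Proof.
intros nz. rewrite <- (sum3_delta w i).
transitivity (sum3 (fun j => sum3 (fun k => A i k * inv3 A k j) * w j)).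
- unfold sum3. ring.
- apply sum3_ext; intros j. now rewrite inv3_right.
Qed.

(* Evaluate the form on the last column of the adjugate. *)
Lemma posdef_det (A : ix -> ix -> R) : (forall i j, A i j = A j i) ->
  (forall v : ix -> R, (exists i, v i <> 0) -> 0 < sum3 (fun i => sum3 (fun j => A i j * v i * v j))) ->
  0 < det3 A.
Proof.
intros sym pos.
assert (p1 : 0 < A I1 I1).
{ specialize (pos (delta I1) (ex_intro _ I1 R1_neq_R0)). unfold sum3 in pos; simpl in pos. lra. }
assert (p2 : 0 < A I1 I1 * A I2 I2 - A I1 I2 * A I1 I2).
{ specialize (pos (fun i => match i with I1 => - A I1 I2 | I2 => A I1 I1 | I3 => 0 end)
    (ex_intro _ I2 (Rgt_not_eq _ _ p1))).
  unfold sum3 in pos; simpl in pos. rewrite (sym I2 I1) in pos.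
  apply (Rmult_lt_reg_l (A I1 I1)); [exact p1|]. nra. }
set (w := fun i => match i with I1 => A I1 I2 * A I2 I3 - A I1 I3 * A I2 I2
   | I2 => A I1 I3 * A I1 I2 - A I1 I1 * A I2 I3 | I3 => A I1 I1 * A I2 I2 - A I1 I2 * A I1 I2 end).
specialize (pos w (ex_intro _ I3 (Rgt_not_eq _ _ p2))).
apply (Rmult_lt_reg_l (w I3)); [exact p2|].
replace (w I3 * det3 A) with (sum3 (fun i => sum3 (fun j => A i j * w i * w j))); [lra|].
unfold det3, sum3, cofactor; simpl. rewrite (sym I2 I1), (sym I3 I1), (sym I3 I2). ring.
Qed.

(** The determinant form pulled back by [J] is multiplied by [det3 J], here with one slot left open.
    It yields the cross product in chart components. *)
Lemma det3_eps (mu : R) (J : ix -> ix -> R) (X Y : ix -> R) a :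
  sum3 (fun l => J l a * sum3 (fun i => sum3 (fun j => mu * eps l i j *
     sum3 (fun b => J i b * X b) * sum3 (fun b => J j b * Y b))))
  = mu * det3 J * sum3 (fun b => sum3 (fun d => eps a b d * X b * Y d)).
Proof. destruct a; unfold det3, sum3, cofactor; simpl; ring. Qed.

(** * Derivative of the chart *)

Definition chart_jacobian (c : symmetry) (q : pt) (i a : ix) : R :=
  match c with
  | Translational => delta i a
  | Rotational =>
      match i, a with
      | I1, I1 => cos (coord I3 q) | I1, I3 => - (coord I1 q * sin (coord I3 q))
      | I2, I2 => 1
      | I3, I1 => sin (coord I3 q) | I3, I3 => coord I1 q * cos (coord I3 q)
      | _, _ => 0
      end
  end.

Definition chart_det (c : symmetry) (q : pt) : R :=
  match c with Rotational => coord I1 q | Translational => 1 end.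

(* [chart_det] times the inverse of [chart_jacobian]. *)
Definition chart_adjugate (c : symmetry) (q : pt) (a i : ix) : R :=
  match c with
  | Translational => delta a i
  | Rotational =>
      match a, i with
      | I1, I1 => coord I1 q * cos (coord I3 q) | I1, I3 => coord I1 q * sin (coord I3 q)
      | I2, I2 => coord I1 q
      | I3, I1 => - sin (coord I3 q) | I3, I3 => cos (coord I3 q)
      | _, _ => 0
      end
  end.

(** Oriented so that [ring] can use it to eliminate squares of the cosine. *)
Lemma cos_sqr_sin (t : R) : cos t * cos t = 1 - sin t * sin t.
Proof. pose proof (sin2_cos2 t) as H. unfold Rsqr in H. lra. Qed.

Lemma chart_adjugate_left c q a b :
  sum3 (fun i => chart_adjugate c q a i * chart_jacobian c q i b) = chart_det c q * delta a b.
Proof.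
pose proof (cos_sqr_sin (coord I3 q)) as trig.
destruct c, a, b; unfold sum3, chart_adjugate, chart_jacobian, chart_det, delta; ring [trig].
Qed.

Lemma chart_adjugate_right c q i j :
  sum3 (fun a => chart_jacobian c q i a * chart_adjugate c q a j) = chart_det c q * delta i j.
Proof.
pose proof (cos_sqr_sin (coord I3 q)) as trig.
destruct c, i, j; unfold sum3, chart_adjugate, chart_jacobian, chart_det, delta; ring [trig].
Qed.

Lemma chart_det3 c q : det3 (chart_jacobian c q) = chart_det c q.
Proof.
pose proof (cos_sqr_sin (coord I3 q)) as trig.
destruct c; unfold det3, sum3, cofactor, chart_jacobian, chart_det, delta; simpl; ring [trig].
Qed.

Definition chart_coord (c : symmetry) (i : ix) (q : pt) : R := coord i (chart c q).

Lemma is_derive_chart_coord c i q v :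
  is_derive (fun s : R => chart_coord c i (plus q (scal s v))) 0
    (sum3 (fun a => coord a v * chart_jacobian c q i a)).
Proof.
destruct q as [[r psi] theta], v as [[v1 v2] v3].
destruct c, i; unfold chart_coord, sum3, chart_jacobian, delta; simpl;
  unfold plus, scal; simpl; unfold prod_plus, prod_scal, plus, scal; simpl;
  unfold prod_plus, prod_scal, plus, scal, mult; simpl; unfold mult; simpl;
  (auto_derive; [easy|rewrite ?Rmult_0_l, ?Rplus_0_r; ring]).
Qed.

Lemma chart_jacobian_eq c q i a : jacobian (chart c) q i a = chart_jacobian c q i a.
Proof.
apply dderiv_unique. evar_last; [apply is_derive_chart_coord|].
destruct a; unfold sum3; simpl; ring.
Qed.

(** Sine and cosine are treated together because each is the derivative of the other up to sign. *)
Lemma trig_Ck k (U : pt -> Prop) : open U ->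
  Ck_on k U (fun q => cos (coord I3 q)) /\ Ck_on k U (fun q => sin (coord I3 q)).
Proof.
intros oU.
assert (Dc : forall q v : pt, is_derive (fun s : R => cos (coord I3 (plus q (scal s v)))) 0
    (- (sin (coord I3 q) * coord I3 v))).
{ intros q v. apply (is_derive_ext (fun s => cos (coord I3 q + s * coord I3 v))).
  - intros s. now rewrite line_coord.
  - auto_derive; [easy|]. rewrite Rmult_0_l, Rplus_0_r. ring. }
assert (Ds : forall q v : pt, is_derive (fun s : R => sin (coord I3 (plus q (scal s v)))) 0
    (cos (coord I3 q) * coord I3 v)).
{ intros q v. apply (is_derive_ext (fun s => sin (coord I3 q + s * coord I3 v))).
  - intros s. now rewrite line_coord.
  - auto_derive; [easy|]. rewrite Rmult_0_l, Rplus_0_r. ring. }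
assert (cc : forall q : pt, continuous (fun q => cos (coord I3 q)) q).
{ intros q. apply (continuous_comp (coord I3) cos); [apply continuous_coord|apply continuous_cos]. }
assert (cs : forall q : pt, continuous (fun q => sin (coord I3 q)) q).
{ intros q. apply (continuous_comp (coord I3) sin); [apply continuous_coord|apply continuous_sin]. }
induction k as [|k [IHc IHs]]; [split; intros q _; auto|].
split; (split; [auto|]); intros v; (split; [intros q _; eexists; auto|]).
- apply (Ck_ext k U (fun q => - (sin (coord I3 q) * coord I3 v))); [exact oU| |].
  + intros q _. symmetry. apply dderiv_unique, Dc.
  + apply Ck_opp, Ck_mult; auto using Ck_const.
- apply (Ck_ext k U (fun q => cos (coord I3 q) * coord I3 v)); [exact oU| |].
  + intros q _. symmetry. apply dderiv_unique, Ds.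
  + apply Ck_mult; auto using Ck_const.
Qed.

Lemma chart_coord_smooth c i (U : pt -> Prop) : open U -> smooth_on U (chart_coord c i).
Proof.
intros oU.
assert (sc : smooth_on U (fun q => cos (coord I3 q))) by (intros k; now apply trig_Ck).
assert (ss : smooth_on U (fun q => sin (coord I3 q))) by (intros k; now apply trig_Ck).
assert (H := fun j => smooth_coord j U).
destruct c, i.
- apply (smooth_ext U (fun q => coord I1 q * cos (coord I3 q))); [easy|now intros [[? ?] ?]|].
  now apply smooth_mult.
- apply (smooth_ext U (coord I2)); [easy|now intros [[? ?] ?]|easy].
- apply (smooth_ext U (fun q => coord I1 q * sin (coord I3 q))); [easy|now intros [[? ?] ?]|].
  now apply smooth_mult.
- apply (smooth_ext U (coord I1)); [easy|now intros [[? ?] ?]|easy].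
- apply (smooth_ext U (coord I2)); [easy|now intros [[? ?] ?]|easy].
- apply (smooth_ext U (coord I3)); [easy|now intros [[? ?] ?]|easy].
Qed.

Lemma in_chart_smooth c (D V : pt -> Prop) f : open D -> open V ->
  (forall q, D q -> V (chart c q)) -> smooth_on V f -> smooth_on D (in_chart c f).
Proof.
intros oD oV DV sf.
apply (smooth_ext D (fun q => f (chart_coord c I1 q, chart_coord c I2 q, chart_coord c I3 q)));
  [exact oD| |].
- intros q _. unfold in_chart, chart_coord. now rewrite <- pt_coords.
- apply (smooth_comp_pt D V); auto using chart_coord_smooth.
  intros q Dq. unfold chart_coord. rewrite <- pt_coords. now apply DV.
Qed.

Lemma in_chart_partial c (D V : pt -> Prop) f q a : open D -> open V ->
  (forall q, D q -> V (chart c q)) -> smooth_on V f -> D q ->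
  partial a (in_chart c f) q = sum3 (fun i => chart_jacobian c q i a * partial i f (chart c q)).
Proof.
intros oD oV DV sf Dq. unfold partial at 1.
rewrite (dderiv_ext D (in_chart c f)
  (fun q => f (chart_coord c I1 q, chart_coord c I2 q, chart_coord c I3 q))); [|exact oD|exact Dq|].
2:{ intros q' _. unfold in_chart, chart_coord. now rewrite <- pt_coords. }
assert (inV : forall q, D q -> V (chart_coord c I1 q, chart_coord c I2 q, chart_coord c I3 q)).
{ intros q' Dq'. unfold chart_coord. rewrite <- pt_coords. now apply DV. }
pose proof (fun i => chart_coord_smooth c i D oD) as sc.
rewrite (dderiv_comp_pt D V _ _ _ oV (sc I1) (sc I2) (sc I3) inV f _ q (sf 1%nat) Dq).
assert (e : (chart_coord c I1 q, chart_coord c I2 q, chart_coord c I3 q) = chart c q)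
  by (unfold chart_coord; now rewrite <- pt_coords).
rewrite e.
assert (H : forall i, dderiv (basis a) (chart_coord c i) q = chart_jacobian c q i a).
{ intros i. apply chart_jacobian_eq. }
now rewrite !H.
Qed.

(** * Geometry of the warped metric *)

(** The field $\partial_\theta$ in Cartesian coordinates, in a form that is smooth across the
    axis. *)
Definition rotation_field (c : symmetry) (x : pt) (i : ix) : R :=
  match c, i with
  | Rotational, I1 => - coord I3 x | Rotational, I3 => coord I1 x
  | Translational, I3 => 1 | _, _ => 0
  end.

Definition off_axis (c : symmetry) (x : pt) : Prop := c = Rotational -> axis_dist x <> 0.

Lemma polar_angle (a b : R) : exists t, a = sqrt (a ^ 2 + b ^ 2) * cos t /\ b = sqrt (a ^ 2 + b ^ 2) * sin t.
Proof.
set (r := sqrt (a ^ 2 + b ^ 2)).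
assert (r2 : r ^ 2 = a ^ 2 + b ^ 2) by (apply pow2_sqrt; nra).
assert (r0 : 0 <= r) by apply sqrt_pos.
destruct (Req_dec r 0) as [e|ne].
- exists 0. rewrite e in *. split; nra.
- assert (rp : 0 < r) by lra.
  assert (Hu : -1 <= a / r <= 1).
  { split; apply (Rmult_le_reg_r r); try lra; unfold Rdiv; rewrite Rmult_assoc, Rinv_l by lra; nra. }
  assert (Hs : sqrt (1 - (a / r)²) = Rabs b / r).
  { replace (1 - (a / r)²) with ((b / r) ^ 2).
    - rewrite sqrt_pow2_abs. unfold Rdiv. rewrite Rabs_mult, (Rabs_pos_eq (/ r)); [easy|].
      left; now apply Rinv_0_lt_compat.
    - unfold Rsqr. apply (Rmult_eq_reg_r (r ^ 2)); [|nra]. field_simplify; [|lra|lra]. lra. }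
  destruct (Rle_dec 0 b) as [Hb|Hb].
  (* [acos] covers the upper half turn; the sign of [b] decides between the angle and its
     opposite. *)
  + exists (acos (a / r)). rewrite cos_acos, sin_acos by lra. rewrite Hs, Rabs_pos_eq by lra. split; field; lra.
  + exists (- acos (a / r)). rewrite cos_neg, sin_neg, cos_acos, sin_acos by lra.
    rewrite Hs, Rabs_left by lra. split; field; lra.
Qed.

Lemma continuous_meridian x : continuous (fun x : pt => (coord I1 x, coord I2 x)) x.
Proof. apply continuous_pair; apply continuous_coord. Qed.

Section Geometry.
Context (c : symmetry) (Omega : R * R -> Prop) (alpha beta : R -> R)
    (g : tensor2) (mu : pt -> R) (K : vfield).
Hypothesis (hOmega : range_ok c Omega)
    (hwarp : warping_ok c Omega alpha beta)
    (hg : riemannian_metric_on (manifold c Omega) g)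
    (hchart : forall q, chart_domain c Omega q -> forall a b,
        pullback_metric (chart c) g q a b = warped_metric alpha beta q a b)
    (hmu : volume_form_on (manifold c Omega) g mu)
    (horient : forall q, chart_domain c Omega q ->
        pullback_volume (chart c) mu q = alpha (coord I1 q) * beta (coord I1 q))
    (hK : forall q, closed_chart_domain c Omega q -> forall i,
        K (chart c q) i = jacobian (chart c) q i I3).

Notation M := (manifold c Omega).
Notation M0 := (nonzero_set (manifold c Omega) g K).
Notation D := (chart_domain c Omega).
Notation J := (chart_jacobian c).

Lemma open_plane_preimage : open (fun q : pt => Omega (coord I1 q, coord I2 q)).
Proof.
apply (open_comp (fun q : pt => (coord I1 q, coord I2 q)) Omega); [|apply hOmega].
intros q _. apply continuous_meridian.
Qed.

Lemma open_chart_domain : open D.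
Proof.
apply (open_ext (fun q : pt => Omega (coord I1 q, coord I2 q) /\ (c = Rotational -> 0 < coord I1 q))).
{ now intros [[a b] d]. }
apply open_and; [exact open_plane_preimage|]. destruct c.
- apply (open_ext (fun q : pt => 0 < coord I1 q)); [intros q; tauto|].
  apply (open_comp (coord I1) (fun t => 0 < t)); [intros q _; apply continuous_coord|apply open_gt].
- apply (open_ext (fun _ : pt => True)); [easy|]. intros q _. apply filter_true.
Qed.

Lemma open_manifold : open M.
Proof.
pose proof hOmega as hO. pose proof open_plane_preimage as oP. destruct c.
- now apply open_manifold_rotational.
- apply (open_ext (fun q : pt => Omega (coord I1 q, coord I2 q))); [now intros [[a b] d]|].
  exact oP.
Qed.

Lemma axis_dist_chart q : c = Rotational -> axis_dist (chart c q) = Rabs (coord I1 q).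
Proof.
intros ec. rewrite ec. destruct q as [[r psi] theta]. unfold axis_dist; simpl coord.
pose proof (cos_sqr_sin theta) as trig.
replace ((r * cos theta) ^ 2 + (r * sin theta) ^ 2) with (r ^ 2) by ring [trig]. apply sqrt_pow2_abs.
Qed.

Lemma chart_in_manifold q : Omega (coord I1 q, coord I2 q) -> M (chart c q).
Proof.
intros Oq. pose proof hOmega as hO. pose proof (axis_dist_chart q) as ha. destruct c.
- rewrite manifold_rotational, ha by reflexivity.
  destruct q as [[r psi] theta]. simpl in *. unfold Rabs. destruct (Rcase_abs r); [|exact Oq].
  now apply hO.
- now destruct q as [[r psi] theta].
Qed.

Lemma domain_omega q : D q -> Omega (coord I1 q, coord I2 q).
Proof. now destruct q as [[r psi] theta]; intros []. Qed.

Lemma domain_in_manifold q : D q -> M (chart c q).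
Proof. intros Dq. now apply chart_in_manifold, domain_omega. Qed.

Lemma domain_det q : D q -> 0 < chart_det c q.
Proof. destruct q as [[r psi] theta]. intros [_ H]. unfold chart_det. destruct c; [now apply H|lra]. Qed.

Lemma manifold_chart x : M x -> exists q, closed_chart_domain c Omega q /\ chart c q = x /\
  (off_axis c x -> D q).
Proof.
pose proof hOmega as hO. unfold off_axis. destruct c; intros Mx.
- destruct x as [[x1 x2] x3]. destruct (polar_angle x1 x3) as (t & e1 & e3).
  exists (sqrt (x1 ^ 2 + x3 ^ 2), x2, t). split; [|split].
  + split; [exact Mx|]. intros _. apply sqrt_pos.
  + unfold chart. now rewrite <- e1, <- e3.
  + intros H. split; [exact Mx|]. intros _. specialize (H eq_refl). unfold axis_dist in H; simpl coord in H.
    pose proof (sqrt_pos (x1 ^ 2 + x3 ^ 2)). lra.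
- destruct x as [[x1 x2] x3]. exists (x1, x2, x3). split; [|split]; [|reflexivity|].
  + split; [exact Mx|]. easy.
  + intros _. split; [exact Mx|]. easy.
Qed.

Lemma rotation_field_chart q i : rotation_field c (chart c q) i = J q i I3.
Proof. destruct q as [[r psi] theta]. destruct c, i; simpl; ring. Qed.

Lemma killing_field_eq x i : M x -> K x i = rotation_field c x i.
Proof.
intros Mx. destruct (manifold_chart x Mx) as (q & Cq & <- & _).
rewrite hK by exact Cq. now rewrite chart_jacobian_eq, rotation_field_chart.
Qed.

Lemma metric_det_pos x : M x -> 0 < det3 (g x).
Proof.
intros Mx. destruct hg as (_ & sym & pos). apply posdef_det; [now apply sym|].
intros v Hv. now apply pos.
Qed.

Lemma metric_det_nonzero x : M x -> det3 (g x) <> 0.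
Proof. intros Mx. now apply Rgt_not_eq, metric_det_pos. Qed.

Lemma volume_nonzero x : M x -> mu x <> 0.
Proof.
intros Mx e. pose proof (metric_det_pos x Mx) as H. rewrite <- (proj2 hmu x Mx), e in H. lra.
Qed.

(** By positive definiteness $|K|^2$ vanishes only where [K] does, and the rotation field vanishes
    exactly on the axis. *)
Lemma nonzero_set_iff x : M0 x <-> M x /\ off_axis c x.
Proof.
unfold nonzero_set. split; intros [Mx H]; (split; [exact Mx|]).
- intros ec e. apply H. unfold inner, sum3. rewrite !killing_field_eq by exact Mx. rewrite ec.
  pose proof (axis_dist_sqr x) as Hx. rewrite e in Hx. unfold rotation_field.
  assert (e1 : coord I1 x = 0) by nra. assert (e3 : coord I3 x = 0) by nra. rewrite e1, e3. ring.
- apply Rgt_not_eq. destruct hg as (_ & _ & pos). apply pos; [exact Mx|].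
  unfold off_axis in H. apply NNPP. intros Hno.
  assert (Hz : forall i, rotation_field c x i = 0).
  { intros i. apply NNPP. intros nz. apply Hno. exists i. now rewrite killing_field_eq. }
  destruct c.
  + apply H; [reflexivity|]. unfold axis_dist. pose proof (Hz I1) as h1. pose proof (Hz I3) as h3.
    simpl in h1, h3. replace (coord I3 x) with 0 by lra. rewrite h3.
    replace (0 ^ 2 + 0 ^ 2) with 0 by ring. apply sqrt_0.
  + specialize (Hz I3). simpl in Hz. lra.
Qed.

Lemma nonzero_chart x : M0 x -> exists q, D q /\ chart c q = x.
Proof.
rewrite nonzero_set_iff. intros [Mx H]. destruct (manifold_chart x Mx) as (q & _ & e & Dq).
exists q. auto.
Qed.

Lemma domain_nonzero q : D q -> M0 (chart c q).
Proof.
intros Dq. rewrite nonzero_set_iff. split; [now apply domain_in_manifold|].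
intros ec. rewrite axis_dist_chart by exact ec. apply Rabs_no_R0.
destruct q as [[r psi] theta]. destruct Dq as [_ H]. specialize (H ec). simpl. lra.
Qed.

Lemma metric_smooth i j : smooth_on M (fun x => g x i j).
Proof. apply hg. Qed.

Lemma volume_smooth : smooth_on M mu.
Proof. apply hmu. Qed.

Lemma killing_smooth i : smooth_on M (fun x => K x i).
Proof.
pose proof open_manifold as oM.
apply (smooth_ext M (fun x => rotation_field c x i)); [exact oM| |].
- intros x Mx. symmetry. now apply killing_field_eq.
- unfold rotation_field. destruct c, i; try apply smooth_const; try apply smooth_coord.
  apply smooth_opp; [exact oM|apply smooth_coord].
Qed.

Lemma inner_smooth X Y : (forall i, smooth_on M (fun x => X x i)) -> (forall i, smooth_on M (fun x => Y x i)) ->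
  smooth_on M (inner g X Y).
Proof.
pose proof open_manifold as oM. intros HX HY. unfold inner, sum3.
repeat (apply smooth_plus; [exact oM| |]); (apply smooth_mult; [exact oM| |apply HY]);
  (apply smooth_mult; [exact oM|apply metric_smooth|apply HX]).
Qed.

Lemma open_nonzero_set : open M0.
Proof.
pose proof open_manifold as oM. intros x [Mx nz].
assert (cI : continuous (inner g K K) x).
{ apply (smooth_continuous M); [|exact Mx]. apply inner_smooth; apply killing_smooth. }
pose proof (cI _ (open_neq 0 _ nz)) as H1. pose proof (oM x Mx) as H2.
destruct H1 as [d1 H1], H2 as [d2 H2].
exists (mkposreal _ (Rmin_pos d1 d2 (cond_pos d1) (cond_pos d2))). intros y By. split.
- apply H2. eapply ball_le; [|exact By]. apply Rmin_r.
- apply H1. eapply ball_le; [|exact By]. apply Rmin_l.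
Qed.

Lemma inv3_smooth i j : smooth_on M (fun x => inv3 (g x) i j).
Proof.
pose proof open_manifold as oM. unfold inv3.
assert (sc : forall i j, smooth_on M (fun x => cofactor (g x) i j)).
{ intros. unfold cofactor. apply smooth_minus; try exact oM; apply smooth_mult; try exact oM; apply metric_smooth. }
apply smooth_div; [exact oM|exact metric_det_nonzero|apply sc|].
unfold det3, sum3.
repeat (apply smooth_plus; [exact oM| |]); (apply smooth_mult; [exact oM|apply metric_smooth|apply sc]).
Qed.

(* [Xc] are the components of [X] in the coordinates [(r, psi, theta)]. *)
Definition pushes (q : pt) (X Xc : ix -> R) : Prop := forall i, X i = sum3 (fun a => J q i a * Xc a).

Definition weight (q : pt) (a : ix) : R :=
  match a with I1 => 1 | I2 => alpha (coord I1 q) ^ 2 | I3 => beta (coord I1 q) ^ 2 end.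

Lemma metric_pullback q a b : D q ->
  sum3 (fun i => sum3 (fun j => g (chart c q) i j * J q i a * J q j b)) = delta a b * weight q a.
Proof.
intros Dq. transitivity (pullback_metric (chart c) g q a b).
- unfold pullback_metric. apply sum3_ext; intros i. apply sum3_ext; intros j.
  now rewrite !chart_jacobian_eq.
- rewrite hchart by exact Dq. unfold warped_metric, delta, weight. destruct a, b; ring.
Qed.

Lemma volume_pullback q : D q -> mu (chart c q) * chart_det c q = alpha (coord I1 q) * beta (coord I1 q).
Proof.
intros Dq. rewrite <- horient by exact Dq. unfold pullback_volume. f_equal. rewrite <- chart_det3.
unfold det3, cofactor, sum3. now rewrite !chart_jacobian_eq.
Qed.

(** The weight is the squared length of a column of the jacobian, and that column is nonzero because
    the jacobian is invertible. The nonvanishing of [alpha] and [beta] on the chart is drawn from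
    this. *)
Lemma weight_pos q a : D q -> 0 < weight q a.
Proof.
intros Dq. pose proof (metric_pullback q a a Dq) as H.
replace (delta a a) with 1 in H by (destruct a; reflexivity). rewrite Rmult_1_l in H. rewrite <- H.
destruct hg as (_ & _ & pos). apply (pos (chart c q) (domain_in_manifold q Dq) (fun i => J q i a)).
apply NNPP. intros Hno.
pose proof (chart_adjugate_left c q a a) as Ha.
assert (Hz : forall i, J q i a = 0) by (intros i; apply NNPP; intros nz; apply Hno; now exists i).
unfold sum3 in Ha. rewrite !Hz in Ha. pose proof (domain_det q Dq).
replace (delta a a) with 1 in Ha by (destruct a; reflexivity). lra.
Qed.

Lemma alpha_nonzero q : D q -> alpha (coord I1 q) <> 0.
Proof. intros Dq e. pose proof (weight_pos q I2 Dq) as H. simpl in H. rewrite e in H. lra. Qed.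

Lemma beta_nonzero q : D q -> beta (coord I1 q) <> 0.
Proof. intros Dq e. pose proof (weight_pos q I3 Dq) as H. simpl in H. rewrite e in H. lra. Qed.

Lemma inner_pushes q X Y Xc Yc : D q -> pushes q (X (chart c q)) Xc -> pushes q (Y (chart c q)) Yc ->
  inner g X Y (chart c q) = sum3 (fun a => weight q a * Xc a * Yc a).
Proof.
intros Dq HX HY. unfold inner.
transitivity (sum3 (fun a => sum3 (fun b => sum3 (fun i => sum3 (fun j =>
    g (chart c q) i j * J q i a * J q j b)) * Xc a * Yc b))).
- unfold pushes, sum3 in *. rewrite !HX, !HY. ring.
- transitivity (sum3 (fun a => sum3 (fun b => delta a b * weight q a * Xc a * Yc b))).
  + apply sum3_ext; intros a. apply sum3_ext; intros b. now rewrite metric_pullback.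
  + unfold sum3; simpl. ring.
Qed.

(** Multiplying by the adjugate recovers the covector up to the nonzero factor [chart_det].
    Covectors may thus be compared by their chart components. *)
Lemma covector_injective q (v w : ix -> R) : D q ->
  (forall a, sum3 (fun i => J q i a * v i) = sum3 (fun i => J q i a * w i)) -> forall i, v i = w i.
Proof.
intros Dq H i. pose proof (domain_det q Dq) as Hd.
assert (E : forall v : ix -> R,
  sum3 (fun a => chart_adjugate c q a i * sum3 (fun k => J q k a * v k)) = chart_det c q * v i).
{ intros u. transitivity (sum3 (fun k => sum3 (fun a => J q k a * chart_adjugate c q a i) * u k)).
  - unfold sum3; ring.
  - rewrite <- (sum3_delta u i).
    transitivity (sum3 (fun k => chart_det c q * delta k i * u k)).
    + apply sum3_ext; intros k. now rewrite chart_adjugate_right.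
    + destruct i; unfold sum3; simpl; ring. }
apply (Rmult_eq_reg_l (chart_det c q)); [|lra].
rewrite <- !E. apply sum3_ext; intros a. now rewrite H.
Qed.

(** Raising an index with [g] becomes division by the diagonal weights in the chart. The proposed
    vector is verified by lowering it again and contracting with the columns of the jacobian. *)
Lemma raise_pushes q (v lc : ix -> R) (w : ix -> R) : D q ->
  (forall a, sum3 (fun i => J q i a * w i) = lc a) ->
  (forall i, v i = sum3 (fun j => inv3 (g (chart c q)) i j * w j)) ->
  pushes q v (fun a => lc a / weight q a).
Proof.
intros Dq Hw Hv i. rewrite Hv. symmetry.
apply (inv3_solve (g (chart c q)) (fun i => sum3 (fun a => J q i a * (lc a / weight q a))) w i).
{ now apply metric_det_nonzero, domain_in_manifold. }
apply (covector_injective q _ _ Dq). intros b. rewrite Hw.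
transitivity (sum3 (fun a => sum3 (fun j => sum3 (fun k => g (chart c q) j k * J q j b * J q k a))
   * (lc a / weight q a))).
{ unfold sum3; ring. }
transitivity (sum3 (fun a => delta b a * weight q b * (lc a / weight q a))).
{ apply sum3_ext; intros a. now rewrite metric_pullback. }
pose proof (fun a => Rgt_not_eq _ _ (weight_pos q a Dq)) as nz.
pose proof (nz I1). pose proof (nz I2). pose proof (nz I3).
destruct b; unfold sum3; simpl delta; field; auto.
Qed.

Lemma killing_pushes q : D q -> pushes q (K (chart c q)) (delta I3).
Proof.
intros Dq i. rewrite killing_field_eq by now apply domain_in_manifold.
rewrite rotation_field_chart. unfold sum3; simpl; ring.
Qed.

Lemma killing_norm q : D q -> inner g K K (chart c q) = beta (coord I1 q) ^ 2.
Proof.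
intros Dq. rewrite (inner_pushes q K K (delta I3) (delta I3)) by auto using killing_pushes.
unfold sum3; simpl; ring.
Qed.

(** * Gradient, bracket and Laplacian in the chart *)

Section Functions.
Context (f : pt -> R).
Hypothesis (sf : smooth_on M0 f).

Lemma partial_in_chart q a : D q ->
  partial a (in_chart c f) q = sum3 (fun i => J q i a * partial i f (chart c q)).
Proof.
intros Dq. apply (in_chart_partial c D M0); auto using open_chart_domain, open_nonzero_set, domain_nonzero.
Qed.

Lemma smooth_in_chart : smooth_on D (in_chart c f).
Proof. apply (in_chart_smooth c D M0); auto using open_chart_domain, open_nonzero_set, domain_nonzero. Qed.

Lemma grad_pushes q : D q ->
  pushes q (grad g f (chart c q)) (fun a => partial a (in_chart c f) q / weight q a).
Proof.
intros Dq. apply (raise_pushes q _ (fun a => partial a (in_chart c f) q)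
  (fun j => partial j f (chart c q)) Dq); [|easy].
intros a. symmetry. now apply partial_in_chart.
Qed.

Lemma deriv_along_pushes q X Xc : D q -> pushes q (X (chart c q)) Xc ->
  deriv_along X f (chart c q) = sum3 (fun a => Xc a * partial a (in_chart c f) q).
Proof.
intros Dq HX. unfold deriv_along, sum3. rewrite !HX, !partial_in_chart by exact Dq.
unfold sum3; ring.
Qed.

Lemma cross_pushes q X Y Xc Yc : D q -> pushes q (X (chart c q)) Xc -> pushes q (Y (chart c q)) Yc ->
  pushes q (cross g mu X Y (chart c q)) (fun a => alpha (coord I1 q) * beta (coord I1 q)
    * sum3 (fun b => sum3 (fun d => eps a b d * Xc b * Yc d)) / weight q a).
Proof.
intros Dq HX HY.
apply (raise_pushes q _ _ (fun l => sum3 (fun i => sum3 (fun j =>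
  mu (chart c q) * eps l i j * X (chart c q) i * Y (chart c q) j))) Dq); [|easy].
intros a. rewrite <- (volume_pullback q Dq), <- chart_det3, <- det3_eps.
apply sum3_ext; intros l. f_equal. apply sum3_ext; intros i. apply sum3_ext; intros j.
now rewrite HX, HY.
Qed.

Lemma grad_perp_pushes q : D q ->
  pushes q (grad_perp g mu K f (chart c q)) (fun a => match a with
    | I1 => - partial I2 (in_chart c f) q / (alpha (coord I1 q) * beta (coord I1 q))
    | I2 => partial I1 (in_chart c f) q / (alpha (coord I1 q) * beta (coord I1 q))
    | I3 => 0 end).
Proof.
intros Dq i. unfold grad_perp.
rewrite (cross_pushes q K (grad g f) _ _ Dq (killing_pushes q Dq) (grad_pushes q Dq) i).
rewrite killing_norm by exact Dq.
pose proof (alpha_nonzero q Dq). pose proof (beta_nonzero q Dq).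
unfold sum3; simpl. field. split; assumption.
Qed.

Lemma grad_smooth i : smooth_on M0 (fun x => grad g f x i).
Proof.
pose proof open_nonzero_set as oM0. unfold grad, sum3.
assert (H : forall j, smooth_on M0 (fun x => inv3 (g x) i j * partial j f x)).
{ intros j. apply smooth_mult; [exact oM0| |now apply smooth_dderiv].
  apply (smooth_subset M); [now intros x []|apply inv3_smooth]. }
repeat (apply smooth_plus; [exact oM0| |]); apply H.
Qed.

Lemma invariant_partial : invariant_on M0 K f -> forall q, D q -> partial I3 (in_chart c f) q = 0.
Proof.
intros Hf q Dq. rewrite <- (Hf _ (domain_nonzero q Dq)).
rewrite (deriv_along_pushes q K (delta I3) Dq (killing_pushes q Dq)). unfold sum3; simpl; ring.
Qed.

End Functions.

Lemma poisson_chart f h q : smooth_on M0 f -> smooth_on M0 h -> D q -> poisson g mu K f h (chart c q)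
  = 1 / (alpha (coord I1 q) * beta (coord I1 q)) *
    (partial I1 (in_chart c f) q * partial I2 (in_chart c h) q
     - partial I2 (in_chart c f) q * partial I1 (in_chart c h) q).
Proof.
intros sf sh Dq. unfold poisson.
rewrite (inner_pushes q _ _ _ _ Dq (grad_perp_pushes f sf q Dq) (grad_pushes h sh q Dq)).
pose proof (alpha_nonzero q Dq). pose proof (beta_nonzero q Dq).
unfold sum3; simpl. field. split; assumption.
Qed.

Lemma chart_adjugate_smooth a i : smooth_on D (fun q => chart_adjugate c q a i).
Proof.
pose proof open_chart_domain as oD.
assert (sc : smooth_on D (fun q => cos (coord I3 q))) by (intros k; now apply trig_Ck).
assert (ss : smooth_on D (fun q => sin (coord I3 q))) by (intros k; now apply trig_Ck).
pose proof (smooth_coord I1 D) as s1. revert oD sc ss s1. generalize D. clear.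
intros D oD sc ss s1.
destruct c, a, i; unfold chart_adjugate, delta; auto using smooth_const, smooth_mult, smooth_opp.
Qed.

Lemma chart_adjugate_partial a i q : partial a (fun q => chart_adjugate c q a i) q
  = match c, a, i with
    | Rotational, I1, I1 => cos (coord I3 q) | Rotational, I1, I3 => sin (coord I3 q)
    | Rotational, I3, I1 => - cos (coord I3 q) | Rotational, I3, I3 => - sin (coord I3 q)
    | _, _, _ => 0 end.
Proof.
clear. apply dderiv_unique. destruct q as [[r psi] theta].
destruct c, a, i; unfold chart_adjugate, delta; simpl;
  unfold plus, scal; simpl; unfold prod_plus, prod_scal, plus, scal; simpl;
  unfold prod_plus, prod_scal, plus, scal, mult; simpl; unfold mult; simpl;
  try exact (is_derive_const (V := R_NormedModule) _ _);
  (auto_derive; [easy|rewrite ?Rmult_0_l, ?Rmult_1_r, ?Rmult_0_r, ?Rplus_0_r; ring]).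
Qed.

(** The Piola identity. The adjugate satisfies $\sum_a \partial_a \mathrm{adj}_{ai} = 0$, so no
    derivative of the jacobian survives, and what remains collapses to [chart_det] times the
    Cartesian divergence. *)
Lemma divergence_chart (Y : pt -> ix -> R) q : (forall i, smooth_on M0 (fun x => Y x i)) -> D q ->
  sum3 (fun a => partial a (fun q => sum3 (fun i => chart_adjugate c q a i * Y (chart c q) i)) q)
  = chart_det c q * sum3 (fun i => partial i (fun x => Y x i) (chart c q)).
Proof.
intros sY Dq. pose proof open_chart_domain as oD.
assert (sm : forall a i, smooth_on D (fun q => chart_adjugate c q a i * Y (chart c q) i)).
{ intros a i. apply smooth_mult; [exact oD|apply chart_adjugate_smooth|].
  exact (smooth_in_chart (fun x => Y x i) (sY i)). }
assert (Hp : forall a, partial a (fun q => sum3 (fun i => chart_adjugate c q a i * Y (chart c q) i)) q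
  = sum3 (fun i => partial a (fun q => chart_adjugate c q a i) q * Y (chart c q) i
      + chart_adjugate c q a i * sum3 (fun j => J q j a * partial j (fun x => Y x i) (chart c q)))).
{ intros a. unfold sum3 at 1, partial at 1.
  rewrite (dderiv_plus_on D (fun q => chart_adjugate c q a I1 * Y (chart c q) I1
     + chart_adjugate c q a I2 * Y (chart c q) I2)) by auto using smooth_plus.
  rewrite (dderiv_plus_on D) by auto.
  assert (Hm : forall i, dderiv (basis a) (fun q => chart_adjugate c q a i * Y (chart c q) i) q
     = partial a (fun q => chart_adjugate c q a i) q * Y (chart c q) i
      + chart_adjugate c q a i * sum3 (fun j => J q j a * partial j (fun x => Y x i) (chart c q))).
  { intros i. rewrite <- (partial_in_chart (fun x => Y x i) (sY i)) by exact Dq.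
    apply (dderiv_mult_on D (fun q => chart_adjugate c q a i) (in_chart c (fun x => Y x i)));
      [apply chart_adjugate_smooth|now apply smooth_in_chart|exact Dq]. }
  now rewrite !Hm. }
unfold sum3 at 1. rewrite !Hp. unfold sum3. rewrite !chart_adjugate_partial.
pose proof (cos_sqr_sin (coord I3 q)) as trig.
unfold chart_adjugate, chart_jacobian, chart_det, delta. clear -trig. destruct c; ring [trig].
Qed.

Lemma radial_smooth (w : R -> R) : smooth_on (r_range Omega) w -> smooth_on D (fun q => w (coord I1 q)).
Proof.
intros Hw k. apply (Ck_subset k (fun q : pt => r_range Omega (coord I1 q))).
- intros [[r psi] theta] [O _]. now exists psi.
- apply (Ck_affine (coord I1) (coord I1) k (r_range Omega) w); [| |apply Hw].
  + intros x s v. apply line_coord.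
  + apply continuous_coord.
Qed.

Lemma beta_smooth : smooth_on D (fun q => beta (coord I1 q)).
Proof. apply radial_smooth, hwarp. Qed.

Lemma laplacian_chart f q : smooth_on M0 f -> invariant_on M0 K f -> D q ->
  laplacianK g mu K f (chart c q)
  = 1 / (alpha (coord I1 q) * beta (coord I1 q)) *
      partial I1 (fun y => alpha (coord I1 y) / beta (coord I1 y) * partial I1 (in_chart c f) y) q
    + 1 / (alpha (coord I1 q) ^ 2 * beta (coord I1 q) ^ 2) * partial I2 (partial I2 (in_chart c f)) q.
Proof.
intros sf If Dq. pose proof open_chart_domain as oD. pose proof open_nonzero_set as oM0.
(* The density whose Cartesian divergence, divided by [mu], is the Laplacian. *)
set (Y := fun (y : pt) (i : ix) => mu y * (grad g f y i / inner g K K y)).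
assert (sY : forall i, smooth_on M0 (fun x => Y x i)).
{ intros i. unfold Y. apply smooth_mult; [exact oM0|apply (smooth_subset M); [now intros x []|apply volume_smooth]|].
  apply smooth_div; [exact oM0|now intros x []|now apply grad_smooth|].
  apply (smooth_subset M); [now intros x []|]. apply inner_smooth; apply killing_smooth. }
(* The factor is [mu] times [chart_det], that is $\alpha\beta$, divided by $\beta^2$; the weight
   comes from the gradient. *)
assert (EY : forall a q, D q -> sum3 (fun i => chart_adjugate c q a i * Y (chart c q) i)
   = alpha (coord I1 q) / beta (coord I1 q) * partial a (in_chart c f) q / weight q a).
{ intros a q' Dq'. unfold Y. rewrite killing_norm by exact Dq'.
  assert (HX := grad_pushes f sf q' Dq').
  transitivity (mu (chart c q') / beta (coord I1 q') ^ 2 *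
    sum3 (fun b => sum3 (fun i => chart_adjugate c q' a i * J q' i b)
      * (partial b (in_chart c f) q' / weight q' b))).
  - unfold sum3. rewrite !HX. unfold sum3, Rdiv. ring.
  - transitivity (mu (chart c q') / beta (coord I1 q') ^ 2 * (chart_det c q' *
      (partial a (in_chart c f) q' / weight q' a))).
    + f_equal. transitivity (sum3 (fun b => chart_det c q' * delta a b
        * (partial b (in_chart c f) q' / weight q' b))).
      * apply sum3_ext; intros b. now rewrite chart_adjugate_left.
      * destruct a; unfold sum3; simpl delta; ring.
    + pose proof (beta_nonzero q' Dq'). pose proof (Rgt_not_eq _ _ (weight_pos q' a Dq')).
      transitivity (mu (chart c q') * chart_det c q' / beta (coord I1 q') ^ 2 *
        (partial a (in_chart c f) q' / weight q' a)); [field; auto|].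
      rewrite volume_pullback by exact Dq'. field; auto. }
pose proof (divergence_chart Y q sY Dq) as Hdiv.
assert (Hw : weight q I1 = 1) by reflexivity.
pose proof (alpha_nonzero q Dq) as na. pose proof (beta_nonzero q Dq) as nb.
assert (E1 : partial I1 (fun q => sum3 (fun i => chart_adjugate c q I1 i * Y (chart c q) i)) q
  = partial I1 (fun y => alpha (coord I1 y) / beta (coord I1 y) * partial I1 (in_chart c f) y) q).
{ apply (dderiv_ext D); [exact oD|exact Dq|]. intros y Dy. rewrite EY by exact Dy. simpl. field.
  now apply beta_nonzero. }
assert (E3 : partial I3 (fun q => sum3 (fun i => chart_adjugate c q I3 i * Y (chart c q) i)) q = 0).
{ rewrite <- (dderiv_const (E := pt_module) 0 (basis I3) q).
  apply (dderiv_ext D); [exact oD|exact Dq|]. intros y Dy. rewrite EY by exact Dy.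
  rewrite (invariant_partial f sf If) by exact Dy. unfold Rdiv. ring. }
assert (E2 : partial I2 (fun q => sum3 (fun i => chart_adjugate c q I2 i * Y (chart c q) i)) q
  = / (alpha (coord I1 q) * beta (coord I1 q)) * partial I2 (partial I2 (in_chart c f)) q).
{ transitivity (partial I2 (fun y => / (alpha (coord I1 y) * beta (coord I1 y)) * partial I2 (in_chart c f) y) q).
  - apply (dderiv_ext D); [exact oD|exact Dq|]. intros y Dy. rewrite EY by exact Dy. simpl. field.
    split; [now apply beta_nonzero|now apply alpha_nonzero].
  (* The coefficient depends on $r$ alone, hence is constant along the psi lines and can be frozen
     at [q]. *)
  - transitivity (partial I2 (fun y => / (alpha (coord I1 q) * beta (coord I1 q)) * partial I2 (in_chart c f) y) q).
    + apply Derive_ext. intros s.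
      assert (e : coord I1 (plus q (scal s (basis I2))) = coord I1 q) by (rewrite line_coord; simpl; ring).
      exact (f_equal (fun u => / (alpha u * beta u) * partial I2 (in_chart c f) (plus q (scal s (basis I2)))) e).
    + apply (dderiv_scal (E := pt_module)). }
change (/ mu (chart c q) * sum3 (fun i => partial i (fun x => Y x i) (chart c q)) = 
  1 / (alpha (coord I1 q) * beta (coord I1 q)) *
      partial I1 (fun y => alpha (coord I1 y) / beta (coord I1 y) * partial I1 (in_chart c f) y) q
    + 1 / (alpha (coord I1 q) ^ 2 * beta (coord I1 q) ^ 2) * partial I2 (partial I2 (in_chart c f)) q).
unfold sum3 at 1 in Hdiv. rewrite E1, E2, E3 in Hdiv.
pose proof (domain_det q Dq) as Hd.
pose proof (volume_pullback q Dq) as Hv.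
pose proof (volume_nonzero _ (domain_in_manifold q Dq)) as nm.
apply (Rmult_eq_reg_l (mu (chart c q) * chart_det c q)).
2:{ rewrite Hv. now apply Rmult_integral_contrapositive. }
transitivity (chart_det c q * sum3 (fun i => partial i (fun x => Y x i) (chart c q))); [field; exact nm|].
rewrite <- Hdiv, Hv. field. split; assumption.
Qed.

(** * The Killing equation *)

Definition rotation_gradient (i k : ix) : R :=
  match c, i, k with
  | Rotational, I1, I3 => -1 | Rotational, I3, I1 => 1 | _, _, _ => 0 end.

Lemma killing_partial i k x : M x -> partial k (fun y => K y i) x = rotation_gradient i k.
Proof.
intros Mx. transitivity (partial k (fun y => rotation_field c y i) x).
- apply (dderiv_ext M); [exact open_manifold|exact Mx|]. intros y My. now apply killing_field_eq.
- unfold rotation_field, rotation_gradient. unfold partial. clear.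
  assert (H0 : forall a : R, dderiv (basis k) (fun _ : pt => a) x = 0) by (intros a; apply dderiv_const).
  pose proof (fun i => dderiv_coord i (basis k) x) as Hc.
  pose proof (dderiv_opp (E := pt_module)
    (coord I3) (basis k) x) as Ho.
  rewrite Hc in Ho.
  destruct c, i; [etransitivity; [exact Ho|] |etransitivity; [apply H0|]|etransitivity; [apply Hc|]
    |etransitivity; [apply H0|]..]; destruct k; simpl; ring.
Qed.

Lemma chart_jacobian_smooth i a : smooth_on D (fun q => J q i a).
Proof.
pose proof open_chart_domain as oD.
assert (sc : smooth_on D (fun q => cos (coord I3 q))) by (intros k; now apply trig_Ck).
assert (ss : smooth_on D (fun q => sin (coord I3 q))) by (intros k; now apply trig_Ck).
pose proof (smooth_coord I1 D) as s1. revert oD sc ss s1. generalize D. clear.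
intros D oD sc ss s1.
destruct c, a, i; unfold chart_jacobian, delta; auto using smooth_const, smooth_mult, smooth_opp.
Qed.

(** The chart turns translation in theta into the flow of [K]. The derivative in theta of the
    jacobian is therefore the constant matrix of derivatives of the rotation field applied to the
    jacobian. *)
Lemma chart_jacobian_angular i a q :
  partial I3 (fun q => J q i a) q = sum3 (fun k => rotation_gradient i k * J q k a).
Proof.
clear. apply dderiv_unique. destruct q as [[r psi] theta]. unfold rotation_gradient, sum3.
destruct c, a, i; unfold chart_jacobian, delta; simpl;
  unfold plus, scal; simpl; unfold prod_plus, prod_scal, plus, scal; simpl;
  unfold prod_plus, prod_scal, plus, scal, mult; simpl; unfold mult; simpl;
  (auto_derive; [easy|rewrite ?Rmult_0_l, ?Rmult_1_r, ?Rmult_0_r, ?Rplus_0_r; ring]).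
Qed.

(** Only points of the axis need an argument, and there a small displacement along the first
    coordinate leaves the axis while staying in [M]. *)
Lemma off_axis_dense (h : pt -> R) x : M x -> continuous h x -> (forall y, M0 y -> h y = 0) -> h x = 0.
Proof.
intros Mx ch H0. apply (continuous_locally_eq h x ch). intros P HP.
destruct (classic (off_axis c x)) as [Ho|Ho].
- exists x. split; [exact (locally_singleton _ _ HP)|]. apply H0, nonzero_set_iff. now split.
- assert (Ha : c = Rotational /\ axis_dist x = 0).
  { unfold off_axis in Ho. destruct c; [|elim Ho; discriminate]. split; [reflexivity|].
    apply NNPP. intros n. now apply Ho. }
  destruct Ha as [ec Ha]. pose proof (axis_dist_sqr x) as Hx. rewrite Ha in Hx.
  assert (e1 : coord I1 x = 0) by nra. assert (e3 : coord I3 x = 0) by nra.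
  destruct (filter_and _ _ HP (open_manifold x Mx)) as [e He].
  assert (He2 : 0 < e / 2) by (pose proof (cond_pos e); lra).
  set (y := (e / 2, coord I2 x, 0) : pt).
  assert (By : ball x e y).
  { apply ball_coord. intros i. pose proof (cond_pos e).
    destruct i; simpl coord; rewrite ?e1, ?e3, ?Rminus_0_r, ?Rminus_diag, ?Rabs_R0, ?Rabs_pos_eq; lra. }
  exists y. destruct (He y By) as [Py My]. split; [exact Py|]. apply H0, nonzero_set_iff.
  split; [exact My|]. intros _. unfold axis_dist, y; simpl coord.
  replace ((e / 2) ^ 2 + 0 ^ 2) with ((e / 2) ^ 2) by ring. rewrite sqrt_pow2 by lra. lra.
Qed.

Lemma pullback2_injective q (L : ix -> ix -> R) : D q ->
  (forall a b, sum3 (fun i => sum3 (fun j => L i j * J q i a * J q j b)) = 0) -> forall i j, L i j = 0.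
Proof.
intros Dq H.
assert (H1 : forall b i, sum3 (fun j => L i j * J q j b) = 0).
{ intros b. apply (covector_injective q (fun i => sum3 (fun j => L i j * J q j b)) (fun _ => 0) Dq).
  intros a. transitivity 0; [|unfold sum3; ring]. rewrite <- (H a b). unfold sum3; ring. }
intros i. apply (covector_injective q (fun j => L i j) (fun _ => 0) Dq).
intros b. transitivity 0; [|unfold sum3; ring]. rewrite <- (H1 b i). unfold sum3; ring.
Qed.

Lemma lie_derivative_smooth i j : smooth_on M (fun x => lie_derivative_metric K g x i j).
Proof.
pose proof open_manifold as oM. unfold lie_derivative_metric, deriv_along.
apply smooth_plus; [exact oM| |].
- apply (smooth_sum3 M (fun k x => K x k * partial k (fun y => g y i j) x)); [exact oM|]. intros k.
  apply smooth_mult; [exact oM|apply killing_smooth|apply smooth_dderiv, metric_smooth].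
- apply (smooth_sum3 M (fun k x => g x k j * partial i (fun y => K y k) x + g x i k * partial j (fun y => K y k) x));
    [exact oM|]. intros k.
  apply smooth_plus; [exact oM| |]; (apply smooth_mult; [exact oM|apply metric_smooth|apply smooth_dderiv, killing_smooth]).
Qed.

(** Along $\partial_\theta$ the Lie derivative has as chart components the theta derivatives of the
    chart components of the metric, and these do not depend on theta. *)
Lemma lie_derivative_chart q a b : D q ->
  sum3 (fun i => sum3 (fun j => lie_derivative_metric K g (chart c q) i j * J q i a * J q j b)) = 0.
Proof.
intros Dq. pose proof open_chart_domain as oD.
pose proof (domain_in_manifold q Dq) as Mq.
set (G := fun i j => in_chart c (fun x => g x i j)).
assert (sG0 : forall i j, smooth_on M0 (fun x => g x i j)).
{ intros i j. apply (smooth_subset M); [now intros x []|apply metric_smooth]. }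
assert (sG : forall i j, smooth_on D (G i j)) by (intros i j; apply smooth_in_chart, sG0).
pose proof chart_jacobian_smooth as sJ.
assert (sGJ : forall i j, smooth_on D (fun q => G i j q * J q i a)) by (intros i j; apply smooth_mult; auto).
assert (sGJJ : forall i j, smooth_on D (fun q => G i j q * J q i a * J q j b)).
{ intros i j. apply (smooth_mult D (fun q => G i j q * J q i a)); auto. }
(* The components being differentiated form the warped metric, a function of $r$ alone; expanding
   the product on the other side gives the terms of the Lie derivative. *)
assert (E : partial I3 (fun q => sum3 (fun i => sum3 (fun j => G i j q * J q i a * J q j b))) q = 0).
{ transitivity (partial I3 (fun q => delta a b * weight q a) q).
  - apply (dderiv_ext D); [exact oD|exact Dq|]. intros y Dy. now apply metric_pullback.
  - transitivity (partial I3 (fun _ : pt => delta a b * weight q a) q); [|apply dderiv_const].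
    apply Derive_ext. intros s.
    assert (e : coord I1 (plus q (scal s (basis I3))) = coord I1 q) by (rewrite line_coord; simpl; ring).
    unfold weight. now destruct a; [|exact (f_equal (fun u => delta I2 b * alpha u ^ 2) e)
      |exact (f_equal (fun u => delta I3 b * beta u ^ 2) e)]. }
assert (sS : forall i, smooth_on D (fun q => sum3 (fun j => G i j q * J q i a * J q j b))).
{ intros i. apply (smooth_sum3 D (fun j q => G i j q * J q i a * J q j b)); auto. }
unfold partial in E.
rewrite (dderiv_sum3_on D (fun i q => sum3 (fun j => G i j q * J q i a * J q j b))) in E by auto.
assert (E' : forall i j, dderiv (basis I3) (fun q => G i j q * J q i a * J q j b) q
   = (partial I3 (G i j) q * J q i a + G i j q * partial I3 (fun q => J q i a) q) * J q j b
     + G i j q * J q i a * partial I3 (fun q => J q j b) q).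
{ intros i j. rewrite (dderiv_mult_on D (fun q => G i j q * J q i a)) by auto.
  now rewrite (dderiv_mult_on D (G i j)) by auto. }
assert (E2 : sum3 (fun i => sum3 (fun j =>
     (partial I3 (G i j) q * J q i a + G i j q * partial I3 (fun q => J q i a) q) * J q j b
     + G i j q * J q i a * partial I3 (fun q => J q j b) q)) = 0).
{ rewrite <- E. apply sum3_ext; intros i.
  rewrite (dderiv_sum3_on D (fun j q => G i j q * J q i a * J q j b)) by auto.
  apply sum3_ext; intros j. symmetry; apply E'. }
rewrite <- E2. unfold lie_derivative_metric.
assert (HG : forall i j, deriv_along K (fun y => g y i j) (chart c q) = partial I3 (G i j) q).
{ intros i j. etransitivity; [exact (deriv_along_pushes _ (sG0 i j) q K (delta I3) Dq (killing_pushes q Dq))|].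
  change (sum3 (fun k => delta I3 k * partial k (G i j) q) = partial I3 (G i j) q).
  unfold sum3; simpl. ring. }
assert (Hgr : forall i k, partial k (fun y => K y i) (chart c q) = rotation_gradient i k).
{ intros i k. now apply killing_partial. }
transitivity (sum3 (fun i => sum3 (fun j => (partial I3 (G i j) q
   + sum3 (fun k => G k j q * rotation_gradient k i + G i k q * rotation_gradient k j)) * J q i a * J q j b))).
{ apply sum3_ext; intros i. apply sum3_ext; intros j. rewrite HG. unfold sum3. now rewrite !Hgr. }
transitivity (sum3 (fun i => sum3 (fun j =>
     (partial I3 (G i j) q * J q i a + G i j q * sum3 (fun k => rotation_gradient i k * J q k a)) * J q j b
     + G i j q * J q i a * sum3 (fun k => rotation_gradient j k * J q k b)))).
{ unfold sum3. ring. }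
apply sum3_ext; intros i. apply sum3_ext; intros j. now rewrite <- !chart_jacobian_angular.
Qed.

Lemma killing : killing_on M g K.
Proof.
split; [exact killing_smooth|]. intros x Mx i j.
apply (off_axis_dense (fun x => lie_derivative_metric K g x i j) x Mx).
- apply (smooth_continuous M); [apply lie_derivative_smooth|exact Mx].
- intros y My. destruct (nonzero_chart y My) as (q & Dq & <-).
  apply (pullback2_injective q _ Dq). intros a b. now apply lie_derivative_chart.
Qed.

(** * Invariant functions and profiles *)

Lemma angular_constant (V : pt -> Prop) (h : pt -> R) (r psi theta theta' : R) :
  smooth_on V h -> (forall t, V (r, psi, t)) -> (forall q, V q -> partial I3 h q = 0) ->
  h (r, psi, theta) = h (r, psi, theta').
Proof.
intros sh HV Hz.
destruct (mean_value (fun t => h (r, psi, t)) (fun _ => 0) theta' theta) as (t & _ & e).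
- intros t _.
  assert (line : forall s : R, plus ((r, psi, 0) : pt) (scal s (basis I3)) = (r, psi, s)).
  { intros s. change ((r + s * 0, psi + s * 0, 0 + s * 1) = (r, psi, s)). f_equal; [f_equal|]; ring. }
  apply (is_derive_ext (fun s : R => h (plus ((r, psi, 0) : pt) (scal s (basis I3))))).
  + intros s. exact (f_equal h (line s)).
  + evar_last; [|exact (Hz (r, psi, t) (HV t))].
    exact (is_derive_line_at 0 V h (r, psi, 0) (basis I3) t (r, psi, t) (sh 1%nat) (eq_sym (line t)) (HV t)).
- lra.
Qed.

(** The domain [V] contains $r \le 0$ as well, since the chart maps these points into [M]; the
    identity can then be used at $r = 0$ and for negative $r$. *)
Lemma invariant_angular f r psi theta theta' : smooth_on M f -> invariant_on M K f -> Omega (r, psi) ->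
  f (chart c (r, psi, theta)) = f (chart c (r, psi, theta')).
Proof.
intros sf If Or.
set (V := fun q : pt => Omega (coord I1 q, coord I2 q)).
assert (VM : forall q, V q -> M (chart c q)) by (intros q; apply chart_in_manifold).
apply (angular_constant V (in_chart c f)).
- apply (in_chart_smooth c V M); [apply open_plane_preimage|apply open_manifold|exact VM|exact sf].
- intros t. exact Or.
- intros q Vq. rewrite (in_chart_partial c V M);
    [|apply open_plane_preimage|apply open_manifold|exact VM|exact sf|exact Vq].
  rewrite <- (If _ (VM q Vq)). apply sum3_ext; intros i.
  now rewrite killing_field_eq, rotation_field_chart by now apply VM.
Qed.

Lemma chart_zero (r psi : R) : chart c (r, psi, 0) = (r, psi, 0).
Proof. unfold chart. destruct c; [|reflexivity]. rewrite cos_0, sin_0. f_equal; [f_equal|]; ring. Qed.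

(** The profile is the restriction to the half-turn plane $x_3 = 0$, which crosses the axis inside
    [M]. Smoothness through $r = 0$ is thus inherited from [f]. *)
Lemma profile_of_invariant f : smooth_on M f -> invariant_on M K f ->
  exists F : R * R -> R, profile c Omega F /\ given_by_profile c Omega f F.
Proof.
intros sf If. exists (fun z => f (fst z, snd z, 0)). split; [split|].
- intros k. apply (Ck_subset k (fun z : R * R => M (fst z, snd z, 0))).
  + intros [r psi] Or. pose proof (chart_in_manifold (r, psi, 0) Or) as H.
    rewrite chart_zero in H. exact H.
  + apply (Ck_affine (fun z : R * R => (fst z, snd z, 0) : pt) (fun z : R * R => (fst z, snd z, 0) : pt) k M f);
      [| |apply sf].
    * intros [a b] s [v w]. simpl. change ((a + s * v, b + s * w, 0) = (a + s * v, b + s * w, 0 + s * 0)).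
      f_equal. ring.
    * intros z P [e He]. exists e. intros y [B1 B2]. apply He.
      split; [split; [exact B1|exact B2]|exact (ball_center (0 : R) e)].
- intros ec r psi Or. change (f (- r, psi, 0) = f (r, psi, 0)).
  (* Evenness is invariance under the half turn. *)
  assert (e : chart c (r, psi, PI) = (- r, psi, 0)).
  { rewrite ec. unfold chart. rewrite cos_PI, sin_PI. f_equal; [f_equal|]; ring. }
  rewrite <- e, <- (chart_zero r psi). now apply invariant_angular.
- intros r psi theta [Or _]. change (f (chart c (r, psi, theta)) = f (r, psi, 0)).
  rewrite <- (chart_zero r psi). now apply invariant_angular.
Qed.

Lemma invariant_of_profile F : profile c Omega F ->
  exists f : pt -> R, smooth_on M f /\ invariant_on M K f /\ given_by_profile c Omega f F.
Proof.
intros HF. pose proof hOmega as hO. pose proof killing_field_eq as HK. pose proof axis_dist_chart as Ha.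
destruct c.
- assert (D1 := fun x Mx v => dderiv_unique (lift F) v x _ (lift_is_derive Omega hO F x v HF Mx)).
  exists (lift F). split; [|split].
  + intros k. now apply lift_Ck.
  + intros x Mx. unfold deriv_along, sum3, partial. rewrite !HK, !D1 by exact Mx. simpl. ring.
  + intros r psi theta [Or Hr]. unfold lift. rewrite Ha by reflexivity. simpl. rewrite Rabs_pos_eq; auto.
- exists (fun x => F (coord I1 x, coord I2 x)). split; [|split].
  + intros k. apply (Ck_subset k (fun x : pt => Omega (coord I1 x, coord I2 x))); [now intros [[a b] d]|].
    apply (Ck_affine (fun x : pt => (coord I1 x, coord I2 x)) (fun x : pt => (coord I1 x, coord I2 x)) k Omega F);
      [| |apply HF].
    * intros x s v. rewrite !line_coord. reflexivity.
    * intros x. exact (continuous_meridian x).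
  + intros x Mx. unfold deriv_along, sum3. rewrite !HK by exact Mx. simpl.
    assert (e : partial I3 (fun x => F (coord I1 x, coord I2 x)) x = 0).
    { rewrite <- (dderiv_const (E := pt_module)
        (F (coord I1 x, coord I2 x)) (basis I3) x).
      apply Derive_ext. intros s. f_equal. f_equal; rewrite line_coord; simpl; ring. }
    rewrite e. ring.
  + intros r psi theta _. reflexivity.
Qed.

(** * The dual one-form and its exterior derivative *)

Definition flat (X : vfield) (x : pt) (i : ix) : R := sum3 (fun j => g x i j * X x j).

(** The components of the exterior derivative of the one-form [w]. *)
Definition curl (w : pt -> ix -> R) (i j : ix) (x : pt) : R :=
  partial i (fun y => w y j) x - partial j (fun y => w y i) x.

Lemma flat_smooth X i : (forall i, smooth_on M (fun x => X x i)) -> smooth_on M (fun x => flat X x i).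
Proof.
intros sX. pose proof open_manifold as oM.
apply (smooth_sum3 M (fun j x => g x i j * X x j)); [exact oM|]. intros j.
apply smooth_mult; [exact oM|apply metric_smooth|apply sX].
Qed.

(* The identity [(nabla_X X)^flat = i_X d(X^flat) + d|X|^2 / 2]. *)
Lemma covariant_flat X i x : (forall i, smooth_on M (fun x => X x i)) -> M x ->
  sum3 (fun k => g x i k * covariant g X X x k)
  = sum3 (fun j => X x j * curl (flat X) j i x)
    + / 2 * partial i (fun y => sum3 (fun j => flat X y j * X y j)) x.
Proof.
intros sX Mx. pose proof open_manifold as oM.
set (dg := fun k a b => partial k (fun y => g y a b) x).
set (dX := fun k a => partial k (fun y => X y a) x).
assert (Hflat : forall k a, partial k (fun y => flat X y a) x
   = sum3 (fun l => dg k a l * X x l + g x a l * dX k l)).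
{ intros k a. etransitivity; [apply (dderiv_sum3_on M (fun l y => g y a l * X y l)); [exact oM| |exact Mx]|].
  - intros l. apply smooth_mult; [exact oM|apply metric_smooth|apply sX].
  - apply sum3_ext; intros l.
    exact (dderiv_mult_on M (fun y => g y a l) (fun y => X y l) (basis k) x (metric_smooth a l) (sX l) Mx). }
assert (HN : partial i (fun y => sum3 (fun j => flat X y j * X y j)) x
   = sum3 (fun j => sum3 (fun l => dg i j l * X x l + g x j l * dX i l) * X x j + flat X x j * dX i j)).
{ etransitivity; [apply (dderiv_sum3_on M (fun j y => flat X y j * X y j)); [exact oM| |exact Mx]|].
  - intros j. apply smooth_mult; [exact oM|now apply flat_smooth|apply sX].
  - apply sum3_ext; intros j. rewrite <- Hflat.
    exact (dderiv_mult_on M (fun y => flat X y j) (fun y => X y j) (basis i) x (flat_smooth X j sX) (sX j) Mx). }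
rewrite HN. unfold curl.
rewrite (sum3_ext (fun j => X x j * (partial j (fun y => flat X y i) x - partial i (fun y => flat X y j) x))
  (fun j => X x j * (sum3 (fun l => dg j i l * X x l + g x i l * dX j l)
     - sum3 (fun l => dg i j l * X x l + g x j l * dX i l)))) by (intros j; now rewrite !Hflat).
unfold covariant, deriv_along.
change (fun k => g x i k * (sum3 (fun j => X x j * partial j (fun y => X y k) x)
   + sum3 (fun a => sum3 (fun b => christoffel g x k a b * X x a * X x b))))
  with (fun k => g x i k * (sum3 (fun j => X x j * dX j k)
   + sum3 (fun a => sum3 (fun b => / 2 * sum3 (fun l => inv3 (g x) k l *
       (dg a b l + dg b a l - dg l a b)) * X x a * X x b)))).
transitivity (sum3 (fun k => g x i k * sum3 (fun j => X x j * dX j k))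
  + sum3 (fun k => g x i k * sum3 (fun l => inv3 (g x) k l *
     sum3 (fun a => sum3 (fun b => / 2 * (dg a b l + dg b a l - dg l a b) * X x a * X x b))))).
{ generalize (inv3 (g x)) dg dX (g x) (X x). clear. intros iv dg dX G Y. unfold sum3. ring. }
(* Lowering the index cancels the inverse metric in the Christoffel symbols; a polynomial identity
   remains, true by the symmetry of the metric and of its derivatives. *)
rewrite inv3_apply by now apply metric_det_nonzero.
assert (sg : forall a b, g x a b = g x b a) by (intros; now apply hg).
assert (sdg : forall k a b, dg k a b = dg k b a).
{ intros k a b. apply (dderiv_ext M); [exact oM|exact Mx|]. intros y My. now apply hg. }
unfold flat. revert sg sdg. generalize dg dX (g x) (X x). clear. intros dg dX G Y sg sdg.
unfold sum3.
destruct i; rewrite ?(sg I2 I1), ?(sg I3 I1), ?(sg I3 I2), ?(sdg _ I2 I1), ?(sdg _ I3 I1), ?(sdg _ I3 I2); field.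
Qed.

Definition chart_covector (w : pt -> ix -> R) (a : ix) (q : pt) : R :=
  sum3 (fun i => J q i a * w (chart c q) i).

Lemma chart_jacobian_symmetric i a b q :
  partial a (fun q => J q i b) q = partial b (fun q => J q i a) q.
Proof.
assert (oT : open (fun _ : pt => True)) by (intros z _; apply filter_true).
assert (H : forall a b, partial a (fun q => J q i b) q = partial a (partial b (chart_coord c i)) q).
{ intros a' b'. apply (dderiv_ext (fun _ : pt => True)); [exact oT|easy|]. intros y _.
  symmetry. apply chart_jacobian_eq. }
rewrite !H. apply (smooth_comm (fun _ : pt => True)); [exact oT|now apply chart_coord_smooth|easy].
Qed.

(** The exterior derivative commutes with pullback: the second derivatives of the chart are
    symmetric and cancel. *)
Lemma curl_pullback (w : pt -> ix -> R) a b q : (forall i, smooth_on M0 (fun x => w x i)) -> D q ->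
  partial a (chart_covector w b) q - partial b (chart_covector w a) q
  = sum3 (fun i => sum3 (fun j => curl w i j (chart c q) * J q i a * J q j b)).
Proof.
intros sw Dq. pose proof open_chart_domain as oD.
assert (H : forall a b, partial a (chart_covector w b) q = sum3 (fun i =>
    partial a (fun q => J q i b) q * w (chart c q) i
    + J q i b * sum3 (fun j => J q j a * partial j (fun x => w x i) (chart c q)))).
{ intros a' b'. etransitivity.
  - apply (dderiv_sum3_on D (fun i q => J q i b' * w (chart c q) i)); [exact oD| |exact Dq].
    intros i. apply smooth_mult; [exact oD|apply chart_jacobian_smooth|].
    exact (smooth_in_chart (fun x => w x i) (sw i)).
  - apply sum3_ext; intros i. rewrite <- (partial_in_chart (fun x => w x i) (sw i)) by exact Dq.
    apply (dderiv_mult_on D (fun q => J q i b') (in_chart c (fun x => w x i)));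
      [apply chart_jacobian_smooth|now apply smooth_in_chart|exact Dq]. }
rewrite !H. unfold curl, sum3. rewrite !(chart_jacobian_symmetric _ a b). ring.
Qed.

Lemma flat_chart X Xc a q : D q -> pushes q (X (chart c q)) Xc ->
  chart_covector (flat X) a q = weight q a * Xc a.
Proof.
intros Dq HX. unfold chart_covector, flat.
transitivity (sum3 (fun b => sum3 (fun i => sum3 (fun j => g (chart c q) i j * J q i a * J q j b)) * Xc b)).
- unfold pushes, sum3 in *. rewrite !HX. ring.
- transitivity (sum3 (fun b => delta a b * weight q a * Xc b)).
  + apply sum3_ext; intros b. now rewrite metric_pullback.
  + destruct a; unfold sum3; simpl; ring.
Qed.

(** An equality of values rather than a vanishing derivative, so that it passes at once to products,
    to time derivatives and to partial derivatives in $r$ and psi. *)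
Definition angular_invariant (h : pt -> R) : Prop :=
  forall r psi t t', D (r, psi, t) -> h (r, psi, t) = h (r, psi, t').

Lemma angular_invariant_partial3 h q : angular_invariant h -> D q -> partial I3 h q = 0.
Proof.
intros Ah Dq. destruct q as [[r psi] t].
apply dderiv_unique. apply (is_derive_ext (fun _ => h (r, psi, t)));
  [|exact (is_derive_const (V := R_NormedModule) _ _)].
intros s.
assert (e : plus ((r, psi, t) : pt) (scal s (basis I3)) = (r, psi, t + s)).
{ change ((r + s * 0, psi + s * 0, t + s * 1) = (r, psi, t + s)). f_equal; [f_equal|]; Req; ring. }
etransitivity; [apply (Ah r psi t (t + s) Dq)|]. symmetry. exact (f_equal h e).
Qed.

Lemma angular_invariant_partial h a : a <> I3 -> angular_invariant h -> angular_invariant (partial a h).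
Proof.
intros na Ah r psi t t' Dq. apply Derive_ext_loc.
pose proof (line_locally_0 (E := pt_module)
  D (r, psi, t) (basis a) (open_chart_domain _ Dq)) as HL.
revert HL. apply filter_imp. intros s Ds.
destruct a; [| |easy].
- change (D (r + s * 1, psi + s * 0, t + s * 0)) in Ds.
  change (h (r + s * 1, psi + s * 0, t + s * 0) = h (r + s * 1, psi + s * 0, t' + s * 0)). now apply Ah.
- change (D (r + s * 0, psi + s * 1, t + s * 0)) in Ds.
  change (h (r + s * 0, psi + s * 1, t + s * 0) = h (r + s * 0, psi + s * 1, t' + s * 0)). now apply Ah.
Qed.

Lemma angular_invariant_ext h k : (forall q, D q -> h q = k q) -> angular_invariant h -> angular_invariant k.
Proof.
intros e Ah r psi t t' Dq. rewrite <- !e; [now apply Ah| |exact Dq].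
destruct Dq as [O H]. now split.
Qed.

Lemma laplacian_smooth f : smooth_on M0 f -> smooth_on M0 (laplacianK g mu K f).
Proof.
intros sf. pose proof open_nonzero_set as oM0. unfold laplacianK, divergence.
assert (sub : forall h, smooth_on M h -> smooth_on M0 h).
{ intros h. apply smooth_subset. now intros x []. }
apply smooth_mult; [exact oM0| |].
- apply smooth_inv; [exact oM0| |apply sub, volume_smooth]. intros x [Mx _]. now apply volume_nonzero.
- apply (smooth_sum3 M0 (fun i => partial i (fun y => mu y * (grad g f y i / inner g K K y)))); [exact oM0|].
  intros i. apply smooth_dderiv. apply smooth_mult; [exact oM0|apply sub, volume_smooth|].
  apply smooth_div; [exact oM0|now intros x []|now apply grad_smooth|].
  apply sub, inner_smooth; apply killing_smooth.
Qed.

Lemma domain_angular r psi t t' : D (r, psi, t) -> D (r, psi, t').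
Proof. intros [O H]. now split. Qed.

(** * The Euler equation *)

Section Flow.
Context (T : R -> Prop) (u : R -> vfield) (f sigma : R -> pt -> R).
Hypothesis (oT : open T)
  (su : forall i, spacetime_smooth T M (fun t x => u t x i))
  (sf : spacetime_smooth T M f) (ss : spacetime_smooth T M sigma)
  (If : forall t, T t -> invariant_on M K (f t))
  (Is : forall t, T t -> invariant_on M K (sigma t))
  (hu : forall t x, T t -> M0 x -> forall i, u t x i = stream_swirl_field g mu K (f t) (sigma t) x i).

Definition vorticity_residual (t : R) (q : pt) : R :=
  Derive (fun s => laplacianK g mu K (f s) (chart c q)) t
  + poisson g mu K (f t) (laplacianK g mu K (f t)) (chart c q)
  + Derive beta (coord I1 q) / (alpha (coord I1 q) * beta (coord I1 q) ^ 4)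
    * partial I2 (in_chart c (fun y => sigma t y ^ 2)) q.

Definition swirl_residual (t : R) (q : pt) : R :=
  Derive (fun s => sigma s (chart c q)) t + poisson g mu K (f t) (sigma t) (chart c q).

(** The covector whose equality with the differential of the pressure is Euler's momentum
    equation. *)
Definition momentum (t : R) (x : pt) (i : ix) : R :=
  - sum3 (fun k => g x i k * (Derive (fun s => u s x k) t + covariant g (u t) (u t) x k)).

Definition energy (t : R) (x : pt) : R := sum3 (fun j => flat (u t) x j * u t x j).

(** The Lamb covector $i_u\,d(u^\flat)$. *)
Definition lamb (t : R) (x : pt) (i : ix) : R := sum3 (fun j => u t x j * curl (flat (u t)) j i x).

Lemma slice_M h t : spacetime_smooth T M h -> T t -> smooth_on M (h t).
Proof. apply spacetime_slice. Qed.

Lemma slice_M0 h t : spacetime_smooth T M h -> T t -> smooth_on M0 (h t).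
Proof. intros H Tt. apply (smooth_subset M); [now intros x []|]. now apply (spacetime_slice T M). Qed.

Lemma velocity_smooth t i : T t -> smooth_on M (fun x => u t x i).
Proof. apply (spacetime_slice T M (fun t x => u t x i)), su. Qed.

Lemma flat_spacetime i : spacetime_smooth T M (fun t x => flat (u t) x i).
Proof.
apply (spacetime_sum3 T M oT open_manifold (fun j t x => g x i j * u t x j)). intros j.
apply (spacetime_mult T M oT open_manifold (fun _ x => g x i j)); [|apply su].
apply (spacetime_stationary T M (fun x => g x i j)), metric_smooth.
Qed.

Lemma curl_spacetime i j : spacetime_smooth T M (fun t => curl (flat (u t)) i j).
Proof.
apply (spacetime_minus T M oT open_manifold (fun t => partial i (fun y => flat (u t) y j))
  (fun t => partial j (fun y => flat (u t) y i)));
  apply (spacetime_partial T M oT open_manifold), flat_spacetime.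
Qed.

Lemma lamb_spacetime i : spacetime_smooth T M (fun t x => lamb t x i).
Proof.
apply (spacetime_sum3 T M oT open_manifold (fun j t x => u t x j * curl (flat (u t)) j i x)). intros j.
apply (spacetime_mult T M oT open_manifold (fun t x => u t x j)); [apply su|apply curl_spacetime].
Qed.

Lemma energy_spacetime : spacetime_smooth T M energy.
Proof.
apply (spacetime_sum3 T M oT open_manifold (fun j t x => flat (u t) x j * u t x j)). intros j.
apply (spacetime_mult T M oT open_manifold (fun t x => flat (u t) x j)); [apply flat_spacetime|apply su].
Qed.

Lemma momentum_eq t x i : T t -> M x -> momentum t x i =
  - (Derive (fun s => flat (u s) x i) t + lamb t x i + / 2 * partial i (energy t) x).
Proof.
intros Tt Mx. unfold momentum, lamb, energy.
assert (Dt : Derive (fun s => flat (u s) x i) t = sum3 (fun k => g x i k * Derive (fun s => u s x k) t)).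
{ apply is_derive_unique.
  assert (Du : forall k, is_derive (fun s => g x i k * u s x k) t (g x i k * Derive (fun s => u s x k) t)).
  { intros k. apply (is_derive_scal (fun s => u s x k)), Derive_correct.
    exact (spacetime_ex_derive T M (fun t x => u t x k) t x (su k) Tt Mx). }
  exact (is_derive_Rplus _ _ t _ _ (is_derive_Rplus _ _ t _ _ (Du I1) (Du I2)) (Du I3)). }
rewrite Dt.
pose proof (covariant_flat (u t) i x (fun i => velocity_smooth t i Tt) Mx) as Hc.
rewrite Rplus_assoc, <- Hc. unfold sum3. ring.
Qed.

Lemma momentum_spacetime i : spacetime_smooth T M (fun t x => momentum t x i).
Proof.
pose proof open_manifold as oM.
apply (spacetime_ext T M oT oM (fun t x =>
  - (time_derive (fun t x => flat (u t) x i) t x + lamb t x i + / 2 * partial i (energy t) x))).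
- intros t x Tt Mx. symmetry. now apply momentum_eq.
- apply (spacetime_opp T M oT oM (fun t x =>
    time_derive (fun t x => flat (u t) x i) t x + lamb t x i + / 2 * partial i (energy t) x)).
  apply (spacetime_plus T M oT oM (fun t x => time_derive (fun t x => flat (u t) x i) t x + lamb t x i)).
  + apply (spacetime_plus T M oT oM (time_derive (fun t x => flat (u t) x i))).
    * apply (spacetime_time_derive T M oT oM), flat_spacetime.
    * apply lamb_spacetime.
  + apply (spacetime_mult T M oT oM (fun _ _ => / 2)).
    * apply (spacetime_stationary T M (fun _ => / 2)), smooth_const.
    * apply (spacetime_partial T M oT oM energy), energy_spacetime.
Qed.

(** The kinetic energy enters [momentum] as a gradient and drops out; time and space derivatives
    commute on smooth space-time functions. *)
Lemma curl_momentum t x i j : T t -> M x -> curl (momentum t) i j x =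
  - (Derive (fun s => curl (flat (u s)) i j x) t + curl (lamb t) i j x).
Proof.
intros Tt Mx. pose proof open_manifold as oM.
pose proof (fun k => slice_M _ t (spacetime_time_derive T M oT oM _ (flat_spacetime k)) Tt) as s1.
pose proof (fun k => slice_M _ t (lamb_spacetime k) Tt) as s2.
pose proof (slice_M _ t energy_spacetime Tt) as s3.
pose proof (fun k => smooth_dderiv M (energy t) (basis k) s3) as s4.
assert (H : forall a b, partial a (fun y => momentum t y b) x =
   - (Derive (fun s => partial a (fun y => flat (u s) y b) x) t + partial a (fun y => lamb t y b) x
      + / 2 * partial a (partial b (energy t)) x)).
{ intros a b. transitivity (partial a (fun y => - (time_derive (fun t x => flat (u t) x b) t y
    + lamb t y b + / 2 * partial b (energy t) y)) x).
  - apply (dderiv_ext M); [exact oM|exact Mx|]. intros y My. now apply momentum_eq.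
  - etransitivity; [apply (dderiv_opp (E := pt_module)
      (fun y => time_derive (fun t x => flat (u t) x b) t y + lamb t y b + / 2 * partial b (energy t) y))|].
    f_equal.
    etransitivity; [apply (dderiv_plus_on M (fun y => time_derive (fun t x => flat (u t) x b) t y + lamb t y b)
      (fun y => / 2 * partial b (energy t) y)); [apply smooth_plus; auto| |exact Mx]|].
    { apply smooth_mult; [exact oM|apply smooth_const|apply s4]. }
    f_equal; [|exact (dderiv_scal (E := pt_module)
      (/ 2) (partial b (energy t)) (basis a) x)].
    etransitivity; [apply (dderiv_plus_on M (fun y => time_derive (fun t x => flat (u t) x b) t y)
      (fun y => lamb t y b)); auto|].
    f_equal. symmetry.
    exact (spacetime_comm T M oT oM _ a t x (flat_spacetime b) Tt Mx). }
unfold curl at 1. rewrite !H.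
assert (Hs : partial j (partial i (energy t)) x = partial i (partial j (energy t)) x).
{ now apply (smooth_comm M). }
assert (Hd : Derive (fun s => curl (flat (u s)) i j x) t
  = Derive (fun s => partial i (fun y => flat (u s) y j) x) t
    - Derive (fun s => partial j (fun y => flat (u s) y i) x) t).
{ unfold curl.
  apply (Derive_minus (fun s => partial i (fun y => flat (u s) y j) x)
    (fun s => partial j (fun y => flat (u s) y i) x)).
  - exact (spacetime_ex_derive T M _ t x (spacetime_partial T M oT oM _ i (flat_spacetime j)) Tt Mx).
  - exact (spacetime_ex_derive T M _ t x (spacetime_partial T M oT oM _ j (flat_spacetime i)) Tt Mx). }
rewrite Hd, Hs. unfold curl. ring.
Qed.

(** * Velocity, vorticity and Lamb covector in the chart *)

Definition velocity_chart (t : R) (q : pt) (a : ix) : R :=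
  match a with
  | I1 => - partial I2 (in_chart c (f t)) q / (alpha (coord I1 q) * beta (coord I1 q))
  | I2 => partial I1 (in_chart c (f t)) q / (alpha (coord I1 q) * beta (coord I1 q))
  | I3 => in_chart c (sigma t) q / beta (coord I1 q) ^ 2
  end.

Lemma velocity_pushes t q : T t -> D q -> pushes q (u t (chart c q)) (velocity_chart t q).
Proof.
intros Tt Dq i. rewrite hu by (try apply domain_nonzero; assumption). unfold stream_swirl_field.
rewrite (grad_perp_pushes (f t) (slice_M0 f t sf Tt) q Dq i), (killing_pushes q Dq i), (killing_norm q Dq).
unfold velocity_chart, in_chart, sum3; simpl delta. pose proof (beta_nonzero q Dq).
pose proof (alpha_nonzero q Dq). field. auto.
Qed.

Lemma flat_velocity_chart t a q : T t -> D q ->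
  chart_covector (flat (u t)) a q = weight q a * velocity_chart t q a.
Proof. intros Tt Dq. apply flat_chart; [exact Dq|now apply velocity_pushes]. Qed.

Lemma angular_stream t : T t -> angular_invariant (in_chart c (f t)).
Proof.
intros Tt r psi a b Dq. apply invariant_angular; [now apply slice_M|now apply If|apply Dq].
Qed.

Lemma angular_swirl t : T t -> angular_invariant (in_chart c (sigma t)).
Proof.
intros Tt r psi a b Dq. apply invariant_angular; [now apply slice_M|now apply Is|apply Dq].
Qed.

Lemma invariant_M0 t : T t -> invariant_on M0 K (f t).
Proof. intros Tt x [Mx _]. now apply If. Qed.

Lemma angular_laplacian t : T t -> angular_invariant (in_chart c (laplacianK g mu K (f t))).
Proof.
intros Tt.
assert (A1 := angular_invariant_partial _ I1 ltac:(discriminate) (angular_stream t Tt)).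
assert (A2 := angular_invariant_partial _ I2 ltac:(discriminate)
  (angular_invariant_partial _ I2 ltac:(discriminate) (angular_stream t Tt))).
assert (A3 : angular_invariant (partial I1 (fun y => alpha (coord I1 y) / beta (coord I1 y)
    * partial I1 (in_chart c (f t)) y))).
{ apply angular_invariant_partial; [discriminate|]. intros r psi a b Dq. simpl coord.
  now rewrite (A1 r psi a b Dq). }
intros r psi a b Dq. pose proof (domain_angular r psi a b Dq) as Dq'.
change (laplacianK g mu K (f t) (chart c (r, psi, a)) = laplacianK g mu K (f t) (chart c (r, psi, b))).
rewrite !laplacian_chart by auto using slice_M0, invariant_M0. simpl coord.
now rewrite (A3 r psi a b Dq), (A2 r psi a b Dq).
Qed.

Lemma angular_velocity t a : T t -> angular_invariant (fun q => velocity_chart t q a).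
Proof.
intros Tt r psi b b' Dq. unfold velocity_chart. simpl coord. destruct a.
- now rewrite (angular_invariant_partial _ I2 ltac:(discriminate) (angular_stream t Tt) r psi b b' Dq).
- now rewrite (angular_invariant_partial _ I1 ltac:(discriminate) (angular_stream t Tt) r psi b b' Dq).
- now rewrite (angular_swirl t Tt r psi b b' Dq).
Qed.

Lemma angular_flat t a : T t -> angular_invariant (chart_covector (flat (u t)) a).
Proof.
intros Tt. apply (angular_invariant_ext (fun q => weight q a * velocity_chart t q a)).
- intros q Dq. symmetry. now apply flat_velocity_chart.
- intros r psi b b' Dq. change (weight (r, psi, b) a) with (weight (r, psi, b') a).
  f_equal. now apply (angular_velocity t a Tt).
Qed.

Definition curl_chart (t : R) (q : pt) (a b : ix) : R :=
  sum3 (fun i => sum3 (fun j => curl (flat (u t)) i j (chart c q) * J q i a * J q j b)).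

Lemma flat_smooth_M0 t i : T t -> smooth_on M0 (fun x => flat (u t) x i).
Proof. intros Tt. exact (slice_M0 _ t (flat_spacetime i) Tt). Qed.

(** This identifies $\Delta_K f$ as the vorticity about [K], up to the area factor $\alpha\beta$. *)
Lemma curl_chart_12 t q : T t -> D q ->
  curl_chart t q I1 I2 = alpha (coord I1 q) * beta (coord I1 q) * laplacianK g mu K (f t) (chart c q).
Proof.
intros Tt Dq. pose proof open_chart_domain as oD. unfold curl_chart.
rewrite <- (curl_pullback (flat (u t)) I1 I2 q (fun i => flat_smooth_M0 t i Tt) Dq).
rewrite laplacian_chart by auto using slice_M0, invariant_M0.
pose proof (alpha_nonzero q Dq). pose proof (beta_nonzero q Dq).
assert (E1 : partial I1 (chart_covector (flat (u t)) I2) q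
   = partial I1 (fun y => alpha (coord I1 y) / beta (coord I1 y) * partial I1 (in_chart c (f t)) y) q).
{ apply (dderiv_ext D); [exact oD|exact Dq|]. intros y Dy. rewrite flat_velocity_chart by auto. simpl. field.
  split; [now apply beta_nonzero|now apply alpha_nonzero]. }
assert (E2 : partial I2 (chart_covector (flat (u t)) I1) q
   = - / (alpha (coord I1 q) * beta (coord I1 q)) * partial I2 (partial I2 (in_chart c (f t))) q).
{ transitivity (partial I2 (fun y => - / (alpha (coord I1 y) * beta (coord I1 y)) * partial I2 (in_chart c (f t)) y) q).
  - apply (dderiv_ext D); [exact oD|exact Dq|]. intros y Dy. rewrite flat_velocity_chart by auto. simpl. field.
    split; [now apply beta_nonzero|now apply alpha_nonzero].
  - transitivity (partial I2 (fun y => - / (alpha (coord I1 q) * beta (coord I1 q)) * partial I2 (in_chart c (f t)) y) q).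
    + apply Derive_ext. intros s.
      assert (e : coord I1 (plus q (scal s (basis I2))) = coord I1 q) by (rewrite line_coord; simpl; ring).
      exact (f_equal (fun z => - / (alpha z * beta z) * partial I2 (in_chart c (f t)) (plus q (scal s (basis I2)))) e).
    + apply (dderiv_scal (E := pt_module)). }
rewrite E1, E2. field. auto.
Qed.

(** Derivatives in theta vanish, and the theta component of the dual one-form is [sigma]. *)
Lemma curl_chart_3 t q a : a <> I3 -> T t -> D q ->
  curl_chart t q a I3 = partial a (in_chart c (sigma t)) q.
Proof.
intros na Tt Dq. pose proof open_chart_domain as oD. unfold curl_chart.
rewrite <- (curl_pullback (flat (u t)) a I3 q (fun i => flat_smooth_M0 t i Tt) Dq).
rewrite (angular_invariant_partial3 _ q (angular_flat t a Tt) Dq), Rminus_0_r.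
apply (dderiv_ext D); [exact oD|exact Dq|]. intros y Dy. rewrite flat_velocity_chart by auto. simpl. field.
now apply beta_nonzero.
Qed.

Lemma curl_chart_antisym t q a b : curl_chart t q b a = - curl_chart t q a b.
Proof. unfold curl_chart, sum3, curl. ring. Qed.

Lemma lamb_chart t a q : T t -> D q ->
  chart_covector (lamb t) a q = sum3 (fun b => velocity_chart t q b * curl_chart t q b a).
Proof.
intros Tt Dq. pose proof (velocity_pushes t q Tt Dq) as Hp. unfold pushes in Hp.
unfold chart_covector, lamb, curl_chart, sum3 in *. rewrite !Hp. ring.
Qed.

Notation fc t := (in_chart c (f t)).
Notation sc t := (in_chart c (sigma t)).
Notation Lc t := (in_chart c (laplacianK g mu K (f t))).

Lemma lamb_chart_1 t q : T t -> D q -> chart_covector (lamb t) I1 q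
  = - (partial I1 (fc t) q * Lc t q) - sc t q * partial I1 (sc t) q * / beta (coord I1 q) ^ 2.
Proof.
intros Tt Dq. rewrite lamb_chart by auto. unfold sum3.
rewrite (curl_chart_antisym t q I1 I2), (curl_chart_antisym t q I1 I3), curl_chart_12, curl_chart_3
  by (auto; discriminate).
replace (curl_chart t q I1 I1) with 0 by (unfold curl_chart, sum3, curl; ring).
unfold velocity_chart, in_chart. pose proof (alpha_nonzero q Dq). pose proof (beta_nonzero q Dq). field. auto.
Qed.

Lemma lamb_chart_2 t q : T t -> D q -> chart_covector (lamb t) I2 q
  = - (partial I2 (fc t) q * Lc t q) - sc t q * partial I2 (sc t) q * / beta (coord I1 q) ^ 2.
Proof.
intros Tt Dq. rewrite lamb_chart by auto. unfold sum3.
rewrite (curl_chart_antisym t q I2 I3), curl_chart_12, curl_chart_3 by (auto; discriminate).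
replace (curl_chart t q I2 I2) with 0 by (unfold curl_chart, sum3, curl; ring).
unfold velocity_chart, in_chart. pose proof (alpha_nonzero q Dq). pose proof (beta_nonzero q Dq). field. auto.
Qed.

(** The theta component is the derivative of [sigma] along the velocity, to which only $\nabla^\perp
    f$ contributes. *)
Lemma lamb_chart_3 t q : T t -> D q ->
  chart_covector (lamb t) I3 q = poisson g mu K (f t) (sigma t) (chart c q).
Proof.
intros Tt Dq. rewrite lamb_chart, poisson_chart by auto using slice_M0. unfold sum3.
rewrite !curl_chart_3 by (auto; discriminate).
replace (curl_chart t q I3 I3) with 0 by (unfold curl_chart, sum3, curl; ring).
unfold velocity_chart. pose proof (alpha_nonzero q Dq). pose proof (beta_nonzero q Dq). field. auto.
Qed.

Lemma energy_chart t q : T t -> D q ->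
  in_chart c (energy t) q = sum3 (fun a => weight q a * velocity_chart t q a * velocity_chart t q a).
Proof.
intros Tt Dq. rewrite <- (inner_pushes q (u t) (u t)) by auto using velocity_pushes.
unfold in_chart, energy, flat, inner, sum3. ring.
Qed.

Lemma angular_energy t : T t -> angular_invariant (in_chart c (energy t)).
Proof.
intros Tt. eapply angular_invariant_ext; [intros q Dq; symmetry; now apply energy_chart|].
intros r psi b b' Dq. apply sum3_ext; intros a.
change (weight (r, psi, b) a) with (weight (r, psi, b') a).
now rewrite (angular_velocity t a Tt r psi b b' Dq).
Qed.

Lemma momentum_chart t a q : T t -> D q -> chart_covector (momentum t) a q =
  - (Derive (fun s => chart_covector (flat (u s)) a q) t + chart_covector (lamb t) a q
     + / 2 * partial a (in_chart c (energy t)) q).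
Proof.
intros Tt Dq. pose proof (domain_in_manifold q Dq) as Mq.
assert (Dt : Derive (fun s => chart_covector (flat (u s)) a q) t
  = sum3 (fun i => J q i a * Derive (fun s => flat (u s) (chart c q) i) t)).
{ apply is_derive_unique.
  assert (Du : forall i, is_derive (fun s => J q i a * flat (u s) (chart c q) i) t
     (J q i a * Derive (fun s => flat (u s) (chart c q) i) t)).
  { intros i. apply (is_derive_scal (fun s => flat (u s) (chart c q) i)), Derive_correct.
    exact (spacetime_ex_derive T M _ t (chart c q) (flat_spacetime i) Tt Mq). }
  exact (is_derive_Rplus _ _ t _ _ (is_derive_Rplus _ _ t _ _ (Du I1) (Du I2)) (Du I3)). }
rewrite Dt, (partial_in_chart (energy t) (slice_M0 _ t energy_spacetime Tt) q a Dq).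
unfold chart_covector, sum3. rewrite !momentum_eq by assumption. ring.
Qed.

Lemma momentum_chart_3 t q : T t -> D q -> chart_covector (momentum t) I3 q = - swirl_residual t q.
Proof.
intros Tt Dq. rewrite momentum_chart, lamb_chart_3 by assumption.
rewrite (angular_invariant_partial3 _ q (angular_energy t Tt) Dq). unfold swirl_residual.
replace (Derive (fun s => chart_covector (flat (u s)) I3 q) t) with (Derive (fun s => sigma s (chart c q)) t).
- ring.
- apply Derive_ext_loc. apply (filter_imp T); [|now apply oT]. intros s Ts.
  rewrite flat_velocity_chart by assumption. simpl. unfold in_chart. field. now apply beta_nonzero.
Qed.

(** With these components independent of theta, the parts of $d$[momentum] involving $d\theta$
    reduce to derivatives of the theta component alone. *)
Lemma angular_momentum t a : a <> I3 -> T t -> angular_invariant (chart_covector (momentum t) a).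
Proof.
intros na Tt. eapply angular_invariant_ext; [intros q Dq; symmetry; now apply momentum_chart|].
intros r psi b b' Dq. pose proof (domain_angular r psi b b' Dq) as Dq'.
assert (E1 : Derive (fun s => chart_covector (flat (u s)) a (r, psi, b)) t
  = Derive (fun s => chart_covector (flat (u s)) a (r, psi, b')) t).
{ apply Derive_ext_loc. apply (filter_imp T); [|now apply oT]. intros s Ts. now apply angular_flat. }
assert (E2 : chart_covector (lamb t) a (r, psi, b) = chart_covector (lamb t) a (r, psi, b')).
{ destruct a; [| |easy].
  - rewrite !lamb_chart_1 by assumption. simpl coord.
    now rewrite (angular_invariant_partial _ I1 ltac:(discriminate) (angular_stream t Tt) r psi b b' Dq),
      (angular_invariant_partial _ I1 ltac:(discriminate) (angular_swirl t Tt) r psi b b' Dq),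
      (angular_swirl t Tt r psi b b' Dq), (angular_laplacian t Tt r psi b b' Dq).
  - rewrite !lamb_chart_2 by assumption. simpl coord.
    now rewrite (angular_invariant_partial _ I2 ltac:(discriminate) (angular_stream t Tt) r psi b b' Dq),
      (angular_invariant_partial _ I2 ltac:(discriminate) (angular_swirl t Tt) r psi b b' Dq),
      (angular_swirl t Tt r psi b b' Dq), (angular_laplacian t Tt r psi b b' Dq). }
now rewrite E1, E2, (angular_invariant_partial _ a na (angular_energy t Tt) r psi b b' Dq).
Qed.

Lemma angular_swirl_residual t : T t -> angular_invariant (swirl_residual t).
Proof.
intros Tt r psi b b' Dq. pose proof (domain_angular r psi b b' Dq) as Dq'.
unfold swirl_residual. rewrite !poisson_chart by auto using slice_M0. simpl coord.
assert (E1 : Derive (fun s => sigma s (chart c (r, psi, b))) t = Derive (fun s => sigma s (chart c (r, psi, b'))) t).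
{ apply Derive_ext_loc. apply (filter_imp T); [|now apply oT]. intros s Ts. now apply (angular_swirl s Ts). }
now rewrite E1, (angular_invariant_partial _ I1 ltac:(discriminate) (angular_stream t Tt) r psi b b' Dq),
  (angular_invariant_partial _ I1 ltac:(discriminate) (angular_swirl t Tt) r psi b b' Dq),
  (angular_invariant_partial _ I2 ltac:(discriminate) (angular_stream t Tt) r psi b b' Dq),
  (angular_invariant_partial _ I2 ltac:(discriminate) (angular_swirl t Tt) r psi b b' Dq).
Qed.

Lemma inverse_beta_sqr_smooth : smooth_on D (fun q => / beta (coord I1 q) ^ 2).
Proof.
apply smooth_inv; [exact open_chart_domain| |apply smooth_pow; [exact open_chart_domain|exact beta_smooth]].
intros q Dq. now apply pow_nonzero, beta_nonzero.
Qed.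

Lemma inverse_beta_sqr_partial a q : D q -> partial a (fun q => / beta (coord I1 q) ^ 2) q
  = delta I1 a * (- 2 * Derive beta (coord I1 q) / beta (coord I1 q) ^ 3).
Proof.
intros Dq. pose proof (beta_nonzero q Dq) as nb.
apply dderiv_unique. apply (is_derive_ext (fun s => / beta (coord I1 q + s * coord I1 (basis a)) ^ 2)).
{ intros s. now rewrite line_coord. }
assert (eb : ex_derive beta (coord I1 q)).
{ apply (smooth_R_ex_derive (r_range Omega)); [apply hwarp|].
  destruct q as [[r psi] theta]. exists psi. apply Dq. }
replace (coord I1 (basis a)) with (delta I1 a) by (destruct a; reflexivity).
evar_last.
- apply (is_derive_comp (fun r => / beta r ^ 2) (fun s => coord I1 q + s * delta I1 a)).
  + rewrite Rmult_0_l, Rplus_0_r. auto_derive; [|reflexivity]. split; [exact eb|].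
    split; [|easy]. now rewrite Rmult_1_r; apply Rmult_integral_contrapositive.
  + auto_derive; [easy|reflexivity].
- change (Derive (fun x : R => beta x)) with (Derive beta). unfold scal; simpl. unfold mult; simpl. field. exact nb.
Qed.

Lemma lamb_partial (A B C E G : pt -> R) a q :
  smooth_on D A -> smooth_on D B -> smooth_on D C -> smooth_on D E -> smooth_on D G -> D q ->
  partial a (fun y => - (A y * B y) - C y * E y * G y) q =
  - (partial a A q * B q + A q * partial a B q)
  - ((partial a C q * E q + C q * partial a E q) * G q + C q * E q * partial a G q).
Proof.
intros sA sB sC sE sG Dq. pose proof open_chart_domain as oD.
assert (sAB : smooth_on D (fun y => A y * B y)) by now apply smooth_mult.
assert (sCE : smooth_on D (fun y => C y * E y)) by now apply smooth_mult.
unfold partial.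
rewrite (dderiv_minus_on D (fun y => - (A y * B y)) (fun y => C y * E y * G y));
  [|now apply smooth_opp|now apply (smooth_mult D (fun y => C y * E y))|exact Dq].
rewrite (dderiv_opp (fun y => A y * B y)), (dderiv_mult_on D A B) by assumption.
rewrite (dderiv_mult_on D (fun y => C y * E y) G), (dderiv_mult_on D C E) by assumption.
reflexivity.
Qed.

(** The mixed second derivatives of [f] and [sigma] cancel. What is left is the jacobian of [f] and
    its Laplacian, and the swirl term in which the $r$ derivative falls on $1/\beta^2$. *)
Lemma curl_lamb_chart t q : T t -> D q ->
  partial I1 (chart_covector (lamb t) I2) q - partial I2 (chart_covector (lamb t) I1) q =
  partial I1 (fc t) q * partial I2 (Lc t) q - partial I2 (fc t) q * partial I1 (Lc t) q
  + 2 * Derive beta (coord I1 q) / beta (coord I1 q) ^ 3 * (sc t q * partial I2 (sc t) q).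
Proof.
intros Tt Dq. pose proof open_chart_domain as oD.
pose proof (smooth_in_chart (f t) (slice_M0 f t sf Tt)) as sF.
pose proof (smooth_in_chart (sigma t) (slice_M0 sigma t ss Tt)) as sS.
pose proof (smooth_in_chart _ (laplacian_smooth (f t) (slice_M0 f t sf Tt))) as sL.
pose proof (fun a => smooth_dderiv D _ (basis a) sF) as sF'.
pose proof (fun a => smooth_dderiv D _ (basis a) sS) as sS'.
assert (E1 : partial I1 (chart_covector (lamb t) I2) q = partial I1 (fun y =>
   - (partial I2 (fc t) y * Lc t y) - sc t y * partial I2 (sc t) y * / beta (coord I1 y) ^ 2) q).
{ apply (dderiv_ext D); [exact oD|exact Dq|]. intros y Dy. now apply lamb_chart_2. }
assert (E2 : partial I2 (chart_covector (lamb t) I1) q = partial I2 (fun y =>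
   - (partial I1 (fc t) y * Lc t y) - sc t y * partial I1 (sc t) y * / beta (coord I1 y) ^ 2) q).
{ apply (dderiv_ext D); [exact oD|exact Dq|]. intros y Dy. now apply lamb_chart_1. }
rewrite E1, E2.
rewrite (lamb_partial (partial I2 (fc t)) (Lc t) (sc t) (partial I2 (sc t)) (fun y => / beta (coord I1 y) ^ 2) I1 q
  (sF' I2) sL sS (sS' I2) inverse_beta_sqr_smooth Dq).
rewrite (lamb_partial (partial I1 (fc t)) (Lc t) (sc t) (partial I1 (sc t)) (fun y => / beta (coord I1 y) ^ 2) I2 q
  (sF' I1) sL sS (sS' I1) inverse_beta_sqr_smooth Dq).
rewrite !inverse_beta_sqr_partial by exact Dq.
assert (Hf : partial I1 (partial I2 (fc t)) q = partial I2 (partial I1 (fc t)) q) by now apply (smooth_comm D).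
assert (Hs : partial I1 (partial I2 (sc t)) q = partial I2 (partial I1 (sc t)) q) by now apply (smooth_comm D).
rewrite Hf, Hs. pose proof (beta_nonzero q Dq). simpl delta. field. assumption.
Qed.

(** Factoring out $\alpha\beta$ turns the swirl term $2\beta'\beta^{-3}\sigma\sigma_\psi$ into
    $\beta'(\alpha\beta^4)^{-1}\partial_\psi(\sigma^2)$; this is where the fourth power comes
    from. *)
Lemma curl_momentum_chart t q : T t -> D q ->
  sum3 (fun i => sum3 (fun j => curl (momentum t) i j (chart c q) * J q i I1 * J q j I2))
  = - (alpha (coord I1 q) * beta (coord I1 q) * vorticity_residual t q).
Proof.
intros Tt Dq. pose proof (domain_in_manifold q Dq) as Mq.
assert (Dt : Derive (fun s => curl_chart s q I1 I2) t = sum3 (fun i => sum3 (fun j =>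
   Derive (fun s => curl (flat (u s)) i j (chart c q)) t * J q i I1 * J q j I2))).
{ apply is_derive_unique.
  assert (Du : forall i j, is_derive (fun s => curl (flat (u s)) i j (chart c q) * J q i I1 * J q j I2) t
     (Derive (fun s => curl (flat (u s)) i j (chart c q)) t * J q i I1 * J q j I2)).
  { intros i j. apply is_derive_Rscal_r, is_derive_Rscal_r, Derive_correct.
    exact (spacetime_ex_derive T M _ t (chart c q) (curl_spacetime i j) Tt Mq). }
  assert (Di : forall i, is_derive (fun s => sum3 (fun j => curl (flat (u s)) i j (chart c q) * J q i I1 * J q j I2)) t
     (sum3 (fun j => Derive (fun s => curl (flat (u s)) i j (chart c q)) t * J q i I1 * J q j I2))).
  { intros i. exact (is_derive_Rplus _ _ t _ _ (is_derive_Rplus _ _ t _ _ (Du i I1) (Du i I2)) (Du i I3)). }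
  exact (is_derive_Rplus _ _ t _ _ (is_derive_Rplus _ _ t _ _ (Di I1) (Di I2)) (Di I3)). }
assert (Dt' : Derive (fun s => curl_chart s q I1 I2) t
  = alpha (coord I1 q) * beta (coord I1 q) * Derive (fun s => laplacianK g mu K (f s) (chart c q)) t).
{ rewrite <- Derive_scal. apply Derive_ext_loc. apply (filter_imp T); [|now apply oT].
  intros s Ts. now apply curl_chart_12. }
pose proof (curl_pullback (lamb t) I1 I2 q (fun i => slice_M0 _ t (lamb_spacetime i) Tt) Dq) as Hl.
rewrite (curl_lamb_chart t q Tt Dq) in Hl.
transitivity (- (sum3 (fun i => sum3 (fun j =>
   Derive (fun s => curl (flat (u s)) i j (chart c q)) t * J q i I1 * J q j I2))
   + sum3 (fun i => sum3 (fun j => curl (lamb t) i j (chart c q) * J q i I1 * J q j I2)))).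
{ unfold sum3. rewrite !curl_momentum by assumption. ring. }
rewrite <- Dt, Dt', <- Hl. unfold vorticity_residual.
rewrite (poisson_chart (f t) (laplacianK g mu K (f t))) by auto using slice_M0, laplacian_smooth.
pose proof (smooth_in_chart (sigma t) (slice_M0 sigma t ss Tt)) as sS.
assert (E : partial I2 (in_chart c (fun y => sigma t y ^ 2)) q = 2 * (sc t q * partial I2 (sc t) q)).
{ transitivity (partial I2 (fun y => sc t y * sc t y) q).
  - apply Derive_ext. intros s. unfold in_chart. Req. ring.
  - etransitivity; [exact (dderiv_mult_on D (sc t) (sc t) (basis I2) q sS sS Dq)|].
    change (dderiv (basis I2) (sc t) q) with (partial I2 (sc t) q). ring. }
rewrite E. pose proof (alpha_nonzero q Dq). pose proof (beta_nonzero q Dq). field. auto.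
Qed.

(** * Existence of a pressure and the two scalar equations *)

Lemma momentum_closed t : T t -> (forall q, D q -> vorticity_residual t q = 0 /\ swirl_residual t q = 0) ->
  forall i j x, M x -> curl (momentum t) i j x = 0.
Proof.
intros Tt H i j x Mx. pose proof open_manifold as oM. pose proof open_chart_domain as oD.
pose proof (fun i => slice_M _ t (momentum_spacetime i) Tt) as sm.
apply (off_axis_dense (curl (momentum t) i j) x Mx).
- apply (smooth_continuous M); [|exact Mx]. apply smooth_minus; [exact oM| |]; apply smooth_dderiv, sm.
- intros y My. destruct (nonzero_chart y My) as (q & Dq & <-).
  revert i j. apply (pullback2_injective q _ Dq).
  assert (H12 := curl_momentum_chart t q Tt Dq). rewrite (proj1 (H q Dq)) in H12.
  (* The theta component of [momentum] is minus the swirl residual, zero on the whole open chart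
     domain, so its derivatives vanish too. *)
  assert (Ha3 : forall a, a <> I3 ->
    sum3 (fun i => sum3 (fun j => curl (momentum t) i j (chart c q) * J q i a * J q j I3)) = 0).
  { intros a na. rewrite <- (curl_pullback (momentum t) a I3 q (fun i => slice_M0 _ t (momentum_spacetime i) Tt) Dq).
    rewrite (angular_invariant_partial3 _ q (angular_momentum t a na Tt) Dq), Rminus_0_r.
    transitivity (partial a (fun _ : pt => 0) q); [|apply dderiv_const].
    apply (dderiv_ext D); [exact oD|exact Dq|]. intros z Dz.
    rewrite momentum_chart_3, (proj2 (H z Dz)) by assumption. ring. }
  assert (anti : forall a b,
    sum3 (fun i => sum3 (fun j => curl (momentum t) i j (chart c q) * J q i a * J q j b))
    = - sum3 (fun i => sum3 (fun j => curl (momentum t) i j (chart c q) * J q i b * J q j a))).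
  { intros a b. unfold sum3, curl. ring. }
  pose proof (Ha3 I1 ltac:(discriminate)) as H13. pose proof (Ha3 I2 ltac:(discriminate)) as H23.
  intros a b. pose proof (anti a b) as Hab. destruct a, b; lra.
Qed.

Lemma swirl_residual_zero t q P : T t -> D q -> smooth_on M P ->
  (c = Translational -> invariant_on M K P) -> (forall x i, M x -> momentum t x i = partial i P x) ->
  swirl_residual t q = 0.
Proof.
intros Tt Dq sP IP HP.
assert (sP0 : smooth_on M0 P) by (apply (smooth_subset M); [now intros x []|exact sP]).
assert (E : forall q, D q -> partial I3 (in_chart c P) q = - swirl_residual t q).
{ intros y Dy. rewrite <- momentum_chart_3 by assumption.
  rewrite (partial_in_chart P sP0 y I3 Dy). apply sum3_ext; intros i. rewrite HP; [easy|].
  now apply domain_in_manifold. }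
assert (sPc := smooth_in_chart P sP0).
assert (dich : c = Translational \/ c = Rotational) by (clear; destruct c; auto).
destruct dich as [ec|ec].
- assert (E0 : partial I3 (in_chart c P) q = 0).
  { apply (invariant_partial P sP0); [|exact Dq]. intros x [Mx _]. now apply IP. }
  rewrite E in E0 by exact Dq. lra.
- destruct q as [[r psi] theta].
  assert (Dt : forall s, D (r, psi, s)) by (intros s; now apply (domain_angular r psi theta)).
  assert (line : forall s : R, plus ((r, psi, 0) : pt) (scal s (basis I3)) = (r, psi, s)).
  { intros s. change ((r + s * 0, psi + s * 0, 0 + s * 1) = (r, psi, s)). f_equal; [f_equal|]; ring. }
  (* Over one full turn [P] returns to its value, while by the mean value theorem its increment is
     $-2\pi$ times the residual at some angle; the residual is the same at every angle. *)
  destruct (mean_value (fun s => in_chart c P (r, psi, s)) (fun s => - swirl_residual t (r, psi, s)) 0 (2 * PI))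
    as (xi & _ & e).
  + intros s _.
    apply (is_derive_ext (fun s : R => in_chart c P (plus ((r, psi, 0) : pt) (scal s (basis I3))))).
    { intros s'. exact (f_equal (in_chart c P) (line s')). }
    evar_last; [|exact (E (r, psi, s) (Dt s))].
    exact (is_derive_line_at 0 D (in_chart c P) (r, psi, 0) (basis I3) s (r, psi, s)
      (sPc 1%nat) (eq_sym (line s)) (Dt s)).
  + assert (ep : in_chart c P (r, psi, 2 * PI) = in_chart c P (r, psi, 0)).
    { unfold in_chart. rewrite ec. unfold chart. now rewrite cos_2PI, sin_2PI, cos_0, sin_0. }
    rewrite ep in e. rewrite (angular_swirl_residual t Tt r psi theta xi Dq).
    pose proof PI_RGT_0. nra.
Qed.

Lemma euler_iff : simply_connected M ->
  (forall t, T t -> axisymmetric_on M mu K (u t)) ->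
  ((exists p : R -> pt -> R, spacetime_smooth T M p /\
      (c = Translational -> forall t, T t -> invariant_on M K (p t)) /\ euler_on T M g mu u p)
   <-> (forall t q, T t -> D q -> vorticity_residual t q = 0 /\ swirl_residual t q = 0)).
Proof.
intros hM hax. pose proof open_manifold as oM. split.
- intros (p & sp & Ip & He) t q Tt Dq.
  assert (HP : forall x i, M x -> momentum t x i = partial i (p t) x).
  { intros x i Mx. destruct (He t x Tt Mx) as [Hm _]. unfold momentum, sum3. rewrite !Hm.
    rewrite <- (inv3_apply (g x) (fun i => partial i (p t) x) i (metric_det_nonzero x Mx)).
    unfold grad, sum3. ring. }
  pose proof (slice_M p t sp Tt) as sP.
  split; [|apply (swirl_residual_zero t q (p t)); auto].
  pose proof (curl_momentum_chart t q Tt Dq) as H12.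
  (* [momentum] is the differential of the pressure, so its exterior derivative vanishes. *)
  assert (Hc : forall i j, curl (momentum t) i j (chart c q) = 0).
  { intros i j. pose proof (domain_in_manifold q Dq) as Mq. unfold curl.
    assert (Hd : forall a b, partial a (fun y => momentum t y b) (chart c q) = partial a (partial b (p t)) (chart c q)).
    { intros a b. apply (dderiv_ext M); [exact oM|exact Mq|]. intros y My. now apply HP. }
    rewrite !Hd. apply Rminus_diag_eq. now apply (smooth_comm M). }
  unfold sum3 in H12. rewrite !Hc in H12.
  pose proof (alpha_nonzero q Dq). pose proof (beta_nonzero q Dq).
  apply (Rmult_eq_reg_l (alpha (coord I1 q) * beta (coord I1 q)));
    [lra|now apply Rmult_integral_contrapositive].
- intros H.
  destruct (spacetime_primitive T M oT oM (fun i t x => momentum t x i) hM momentum_spacetime) as (p & sp & Hp).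
  { intros t Tt i j x Mx. pose proof (momentum_closed t Tt (fun q => H t q Tt) i j x Mx) as Hc.
    unfold curl in Hc. lra. }
  exists p. split; [exact sp|split].
  (* Here the invariance of the constructed pressure is the swirl equation itself. *)
  + intros ec t Tt x Mx.
    assert (Mx0 : M0 x).
    { apply nonzero_set_iff. split; [exact Mx|]. intros ec'. rewrite ec in ec'. discriminate. }
    destruct (nonzero_chart x Mx0) as (q & Dq & <-).
    unfold deriv_along.
    transitivity (chart_covector (momentum t) I3 q).
    * apply sum3_ext; intros i. rewrite (killing_pushes q Dq i), Hp by auto.
      unfold sum3; simpl; ring.
    * rewrite momentum_chart_3, (proj2 (H t q Tt Dq)) by assumption. ring.
  + intros t x Tt Mx. split; [|apply (hax t Tt x Mx)]. intros i. unfold grad.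
    rewrite (sum3_ext _ (fun j => inv3 (g x) i j * momentum t x j)) by (intros j; now rewrite Hp).
    (* Raising the index of [momentum] returns the vector form of the momentum equation. *)
    rewrite (inv3_solve (g x) (fun k => Derive (fun s => u s x k) t + covariant g (u t) (u t) x k)
      (fun j => - momentum t x j) i (metric_det_nonzero x Mx)).
    * unfold sum3. ring.
    * intros j. unfold momentum. ring.
Qed.

End Flow.

End Geometry.

Theorem theorem6p8 (c : symmetry) (Omega : R * R -> Prop) (alpha beta : R -> R)
    (g : tensor2) (mu : pt -> R) (K : vfield)
    (hOmega : range_ok c Omega)
    (hM : simply_connected (manifold c Omega))
    (hwarp : warping_ok c Omega alpha beta)
    (hg : riemannian_metric_on (manifold c Omega) g)
    (hchart : forall q, chart_domain c Omega q -> forall a b,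
        pullback_metric (chart c) g q a b = warped_metric alpha beta q a b)
    (hmu : volume_form_on (manifold c Omega) g mu)
    (horient : forall q, chart_domain c Omega q ->
        pullback_volume (chart c) mu q = alpha (coord I1 q) * beta (coord I1 q))
    (hK : forall q, closed_chart_domain c Omega q -> forall i,
        K (chart c q) i = jacobian (chart c) q i I3) :
  let M := manifold c Omega in
  let M0 := nonzero_set M g K in
  killing_on M g K /\
  (forall f : pt -> R, smooth_on M f -> invariant_on M K f ->
     exists F : R * R -> R, profile c Omega F /\ given_by_profile c Omega f F) /\
  (forall F : R * R -> R, profile c Omega F ->
     exists f : pt -> R, smooth_on M f /\ invariant_on M K f /\ given_by_profile c Omega f F) /\
  (forall f h : pt -> R,
     smooth_on M0 f -> invariant_on M0 K f ->
     smooth_on M0 h -> invariant_on M0 K h ->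
     forall r psi theta, chart_domain c Omega (r, psi, theta) ->
       let q := (r, psi, theta) in
       let D i k := partial i (in_chart c k) q in
       poisson g mu K f h (chart c q)
       = 1 / (alpha r * beta r) * (D I1 f * D I2 h - D I2 f * D I1 h)) /\
  (forall f : pt -> R,
     smooth_on M0 f -> invariant_on M0 K f ->
     forall r psi theta, chart_domain c Omega (r, psi, theta) ->
       let q := (r, psi, theta) in
       laplacianK g mu K f (chart c q)
       = 1 / (alpha r * beta r) *
           partial I1 (fun y => alpha (coord I1 y) / beta (coord I1 y)
                                * partial I1 (in_chart c f) y) q
         + 1 / (alpha r ^ 2 * beta r ^ 2) *
           partial I2 (partial I2 (in_chart c f)) q) /\
  (forall (T : R -> Prop) (u : R -> vfield) (f sigma : R -> pt -> R),
     open T ->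
     (forall i, spacetime_smooth T M (fun t x => u t x i)) ->
     spacetime_smooth T M f -> spacetime_smooth T M sigma ->
     (forall t, T t -> axisymmetric_on M mu K (u t)) ->
     (forall t, T t -> invariant_on M K (f t)) ->
     (forall t, T t -> invariant_on M K (sigma t)) ->
     (forall t x, T t -> M0 x -> forall i,
        u t x i = stream_swirl_field g mu K (f t) (sigma t) x i) ->
     ((exists p : R -> pt -> R,
         spacetime_smooth T M p /\
         (c = Translational -> forall t, T t -> invariant_on M K (p t)) /\
         euler_on T M g mu u p)
      <->
      (forall t r psi theta, T t -> chart_domain c Omega (r, psi, theta) ->
         let q := (r, psi, theta) in
         let x := chart c q in
         Derive (fun s => laplacianK g mu K (f s) x) t
         + poisson g mu K (f t) (laplacianK g mu K (f t)) x
         + Derive beta r / (alpha r * beta r ^ 4)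
           * partial I2 (in_chart c (fun y => sigma t y ^ 2)) q = 0 /\
         Derive (fun s => sigma s x) t + poisson g mu K (f t) (sigma t) x = 0))).
Proof.
intros M M0.
split; [|split; [|split; [|split; [|split]]]].
- eapply killing; eassumption.
- eapply profile_of_invariant; eassumption.
- eapply invariant_of_profile; eassumption.
- intros f h sf If sh Ih r psi theta Dq q D. eapply poisson_chart; eassumption.
- intros f sf If r psi theta Dq q. eapply (laplacian_chart c Omega alpha beta g mu K); eassumption.
- intros T u f sigma oT su sf ss hax If Is hu.
  assert (E : (exists p : R -> pt -> R, spacetime_smooth T M p /\
      (c = Translational -> forall t, T t -> invariant_on M K (p t)) /\ euler_on T M g mu u p)
   <-> (forall t q, T t -> chart_domain c Omega q ->
     vorticity_residual c alpha beta g mu K f sigma t q = 0 /\ swirl_residual c g mu K f sigma t q = 0)).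
  { eapply euler_iff; eassumption. }
  etransitivity; [exact E|]. split.
  + intros H t r psi theta Tt Dq. exact (H t (r, psi, theta) Tt Dq).
  + intros H t [[r psi] theta] Tt Dq. exact (H t r psi theta Tt Dq).
Qed.
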